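(* (Over $\mathsf{RCA}_0$.) Cousin's lemma for continuous functions implies $\mathsf{WKL}_0$. That is, $\mathsf{RCA}_0$ proves that if every continuous gauge $\delta\colon[0,1]\to\mathbb{R}^+$ admits a $\delta$-fine cover of $[0,1]$, then weak König's lemma holds.
   Context: We work in second-order arithmetic, with continuous functions given by codes in the usual sense. $\mathsf{RCA}_0$ is the base system of recursive comprehension with $\Sigma^0_1$-induction; $\mathsf{WKL}_0$ is $\mathsf{RCA}_0$ plus weak König's lemma (every infinite binary tree has a path). A gauge on $[0,1]$ is a function $\delta\colon[0,1]\to\mathbb{R}^+$. A $\delta$-fine cover of $[0,1]$ is a finite set $P\subseteq[0,1]$ together with $p\mapsto r_p\in\mathbb{R}^+$ such that $[0,1]=\bigcup_{p\in P}(p-r_p,p+r_p)$ and $r_p\le\delta(p)$ for all $p\in P$. *)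

(* Defs.v *)
From Stdlib Require Import List.
Import ListNotations.

(** * Second-order arithmetic: syntax

    Two sorts, with separate de Bruijn index spaces for number variables and
    set variables.  The only set terms are set variables; equality is primitive
    for numbers only. *)

Inductive term : Type :=
| Var (i : nat)
| Zero
| One
| Add (s t : term)
| Mul (s t : term).

Inductive form : Type :=
| Eq (s t : term)
| Lt (s t : term)
| Mem (t : term) (X : nat)
| Bot
| Imp (A B : form)
| AllN (A : form)
| AllS (A : form).

Definition Not (A : form) : form := Imp A Bot.
Definition And (A B : form) : form := Not (Imp A (Not B)).
Definition Or (A B : form) : form := Imp (Not A) B.
Definition Iff (A B : form) : form := And (Imp A B) (Imp B A).
Definition ExN (A : form) : form := Not (AllN (Not A)).
Definition ExS (A : form) : form := Not (AllS (Not A)).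

Fixpoint subst_term (f : nat -> term) (t : term) : term :=
  match t with
  | Var i => f i
  | Zero => Zero
  | One => One
  | Add s u => Add (subst_term f s) (subst_term f u)
  | Mul s u => Mul (subst_term f s) (subst_term f u)
  end.

Definition shift_term : term -> term := subst_term (fun i => Var (S i)).

Definition up_num (f : nat -> term) (i : nat) : term :=
  match i with 0 => Var 0 | S j => shift_term (f j) end.

Definition up_set (g : nat -> nat) (i : nat) : nat :=
  match i with 0 => 0 | S j => S (g j) end.

(** Simultaneous substitution of terms for number variables and of set
    variables for set variables. *)
Fixpoint subst (f : nat -> term) (g : nat -> nat) (A : form) : form :=
  match A with
  | Eq s t => Eq (subst_term f s) (subst_term f t)
  | Lt s t => Lt (subst_term f s) (subst_term f t)
  | Mem t X => Mem (subst_term f t) (g X)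
  | Bot => Bot
  | Imp B C => Imp (subst f g B) (subst f g C)
  | AllN B => AllN (subst (up_num f) g B)
  | AllS B => AllS (subst f (up_set g) B)
  end.

Definition shiftN : form -> form := subst (fun i => Var (S i)) (fun X => X).
Definition shiftS : form -> form := subst Var S.

Definition instN (t : term) : form -> form :=
  subst (fun i => match i with 0 => t | S j => Var j end) (fun X => X).
Definition instS (Y : nat) : form -> form :=
  subst Var (fun X => match X with 0 => Y | S Z => Z end).

(** * Provability

    Classical two-sorted natural deduction with equality.  The axioms [T] may
    be open formulas: by rule [prv_ax] they are available in every context,
    so each axiom stands for its universal closure. *)

Inductive prv (T : form -> Prop) : list form -> form -> Prop :=
| prv_ax G A : T A -> prv T G A
| prv_hyp G A : In A G -> prv T G A
| prv_impI G A B : prv T (A :: G) B -> prv T G (Imp A B)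
| prv_impE G A B : prv T G (Imp A B) -> prv T G A -> prv T G B
| prv_raa G A : prv T (Not A :: G) Bot -> prv T G A
| prv_allNI G A : prv T (map shiftN G) A -> prv T G (AllN A)
| prv_allNE G A t : prv T G (AllN A) -> prv T G (instN t A)
| prv_allSI G A : prv T (map shiftS G) A -> prv T G (AllS A)
| prv_allSE G A Y : prv T G (AllS A) -> prv T G (instS Y A)
| prv_eq_refl G t : prv T G (Eq t t)
| prv_eq_subst G A s t :
    prv T G (Eq s t) -> prv T G (instN s A) -> prv T G (instN t A).

Definition proves (T : form -> Prop) (A : form) : Prop := prv T [] A.

(** * Arithmetical formulas and the axioms of RCA0 *)

(** Bounded-quantifier formulas, with arbitrary number and set parameters.  The
    bounded existential quantifier is the dual of the universal one; [shift_term]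
    ensures that the bound does not contain the quantified variable. *)
Inductive Delta0 : form -> Prop :=
| Delta0_eq s t : Delta0 (Eq s t)
| Delta0_lt s t : Delta0 (Lt s t)
| Delta0_mem t X : Delta0 (Mem t X)
| Delta0_bot : Delta0 Bot
| Delta0_imp A B : Delta0 A -> Delta0 B -> Delta0 (Imp A B)
| Delta0_ball t A :
    Delta0 A -> Delta0 (AllN (Imp (Lt (Var 0) (shift_term t)) A)).

Inductive Sigma1 : form -> Prop :=
| Sigma1_ex A : Delta0 A -> Sigma1 (ExN A).

Inductive Pi1 : form -> Prop :=
| Pi1_all A : Delta0 A -> Pi1 (AllN A).

(** In the two schemes the distinguished number variable is [Var 0]; all other
    free variables are parameters. *)

Definition substSucc : form -> form :=
  subst (fun i => match i with 0 => Add (Var 0) One | S j => Var (S j) end)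
        (fun X => X).

Definition induction_ax (A : form) : form :=
  Imp (And (instN Zero A) (AllN (Imp A (substSucc A)))) (AllN A).

Definition comprehension_ax (A B : form) : form :=
  Imp (AllN (Iff A B)) (ExS (AllN (Iff (Mem (Var 0) 0) (shiftS A)))).

Inductive RCA0 : form -> Prop :=
| RCA0_succ_neq0 : RCA0 (Not (Eq (Add (Var 0) One) Zero))
| RCA0_succ_inj :
    RCA0 (Imp (Eq (Add (Var 0) One) (Add (Var 1) One)) (Eq (Var 0) (Var 1)))
| RCA0_add0 : RCA0 (Eq (Add (Var 0) Zero) (Var 0))
| RCA0_addS :
    RCA0 (Eq (Add (Var 0) (Add (Var 1) One)) (Add (Add (Var 0) (Var 1)) One))
| RCA0_mul0 : RCA0 (Eq (Mul (Var 0) Zero) Zero)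
| RCA0_mulS :
    RCA0 (Eq (Mul (Var 0) (Add (Var 1) One)) (Add (Mul (Var 0) (Var 1)) (Var 0)))
| RCA0_lt0 : RCA0 (Not (Lt (Var 0) Zero))
| RCA0_ltS :
    RCA0 (Iff (Lt (Var 0) (Add (Var 1) One))
              (Or (Lt (Var 0) (Var 1)) (Eq (Var 0) (Var 1))))
| RCA0_induction A : Sigma1 A -> RCA0 (induction_ax A)
| RCA0_comprehension A B :
    Sigma1 A -> Pi1 B -> RCA0 (comprehension_ax A B).

(** * Writing formulas with named binders

    An [fm] is a formula waiting for the numbers of number and set quantifiers
    it is under.  A variable bound at level [n] becomes, at level [n'], the
    de Bruijn index [n' - S n]; thus [all] and its companions are ordinary
    binders, and [sentence] produces the closed formula. *)

Definition tm := nat -> term.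
Definition sv := nat -> nat.
Definition fm := nat -> nat -> form.

Definition sentence (A : fm) : form := A 0 0.

Definition zero : tm := fun _ => Zero.
Definition one : tm := fun _ => One.
Definition add (s t : tm) : tm := fun n => Add (s n) (t n).
Definition mul (s t : tm) : tm := fun n => Mul (s n) (t n).

Definition eq_ (s t : tm) : fm := fun n _ => Eq (s n) (t n).
Definition lt_ (s t : tm) : fm := fun n _ => Lt (s n) (t n).
Definition mem (X : sv) (t : tm) : fm := fun n m => Mem (t n) (X m).
Definition neg (A : fm) : fm := fun n m => Not (A n m).
Definition imp (A B : fm) : fm := fun n m => Imp (A n m) (B n m).
Definition and_ (A B : fm) : fm := fun n m => And (A n m) (B n m).
Definition or_ (A B : fm) : fm := fun n m => Or (A n m) (B n m).

Definition all (F : tm -> fm) : fm :=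
  fun n m => AllN (F (fun n' => Var (n' - S n)) (S n) m).
Definition ex (F : tm -> fm) : fm :=
  fun n m => ExN (F (fun n' => Var (n' - S n)) (S n) m).
Definition allS (F : sv -> fm) : fm :=
  fun n m => AllS (F (fun m' => m' - S m) n (S m)).
Definition exS (F : sv -> fm) : fm :=
  fun n m => ExS (F (fun m' => m' - S m) n (S m)).

Declare Scope fm_scope.
Delimit Scope fm_scope with fm.
Bind Scope fm_scope with tm fm.

Module FmNotations.

Notation "0" := zero : fm_scope.
Notation "1" := one : fm_scope.
Notation "2" := (add one one) : fm_scope.
Notation "s + t" := (add s t) : fm_scope.
Notation "s * t" := (mul s t) : fm_scope.
Notation "s == t" := (eq_ s t) (at level 70, no associativity) : fm_scope.
Notation "s < t" := (lt_ s t) : fm_scope.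
Notation "s <= t" := (or_ (lt_ s t) (eq_ s t)) : fm_scope.
Notation "t \in X" := (mem X t) (at level 70, no associativity) : fm_scope.
Notation "~ A" := (neg A) : fm_scope.
Notation "A =>> B" := (imp A B) (at level 99, right associativity) : fm_scope.
Notation "A /\ B" := (and_ A B) : fm_scope.
Notation "A \/ B" := (or_ A B) : fm_scope.
Notation "'All' x .. y , A" := (all (fun x => .. (all (fun y => A%fm)) ..))
  (at level 200, x binder, y binder, right associativity) : fm_scope.
Notation "'Ex' x .. y , A" := (ex (fun x => .. (ex (fun y => A%fm)) ..))
  (at level 200, x binder, y binder, right associativity) : fm_scope.
Notation "'AllSet' X .. Y , A" := (allS (fun X => .. (allS (fun Y => A%fm)) ..))
  (at level 200, X binder, Y binder, right associativity) : fm_scope.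
Notation "'ExSet' X .. Y , A" := (exS (fun X => .. (exS (fun Y => A%fm)) ..))
  (at level 200, X binder, Y binder, right associativity) : fm_scope.
End FmNotations.
Import FmNotations.
Local Open Scope fm_scope.

(** * Pairs, powers of two, finite binary strings *)

Definition pair (i j : tm) : tm := (i + j) * (i + j) + i.

(** Goedel's beta function: [c] is the remainder of [a] modulo [(i+1)b+1]. *)
Definition beta (a b i c : tm) : fm :=
  c < (i + 1) * b + 1 /\ Ex u, a == u * ((i + 1) * b + 1) + c.

Definition pow2 (k m : tm) : fm :=
  Ex a b, beta a b 0 1 /\ beta a b k m /\
    All i, i < k =>> Ex c, beta a b i c /\ beta a b (i + 1) (c + c).

(** The binary string [b_0 ... b_(k-1)] is coded by the positive number with
    binary expansion [1 b_0 ... b_(k-1)], the last entry being the least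
    significant digit.  This is a bijection between strings and positive
    numbers; appending [b] to [s] gives [s + s + b]. *)

Definition len (s k : tm) : fm := Ex m, pow2 k m /\ m <= s /\ s < m + m.

Definition initseg (s t : tm) : fm :=
  0 < s /\ Ex j m v, pow2 j m /\ v < m /\ t == s * m + v.

Definition entry (s i b : tm) : fm := Ex t, len t i /\ initseg (t + t + b) s.

Definition binary_tree (T : sv) : fm :=
  (All s, s \in T =>> 0 < s) /\
  (All s t, t \in T =>> initseg s t =>> s \in T).

Definition infinite (T : sv) : fm := All k, Ex s, s \in T /\ k < s.

(** [F] is the graph of a function from the numbers to {0,1}. *)
Definition binary_function (F : sv) : fm :=
  (All z, z \in F =>> Ex i b, z == pair i b /\ b < 2) /\
  (All i, Ex b, pair i b \in F) /\
  (All i b c, pair i b \in F =>> pair i c \in F =>> b == c).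

(** [s] codes the restriction of [F] to numbers below [k]. *)
Definition restriction (F : sv) (k s : tm) : fm :=
  len s k /\ All i b, i < k =>> pair i b \in F =>> entry s i b.

Definition path (F T : sv) : fm :=
  binary_function F /\ All k, Ex s, restriction F k s /\ s \in T.

Definition WKL : form := sentence
  (AllSet T, binary_tree T =>> infinite T =>> ExSet F, path F T).

(** * Rational numbers

    [Rat p n d] stands for the rational (p - n)/d.  A rational is coded by
    ((p,n),d) with d > 0.  Codes are not unique, so equality of rationals is
    not equality of codes. *)

Record rat := Rat { rpos : tm; rneg : tm; rden : tm }.

Definition code (q : rat) : tm := pair (pair (rpos q) (rneg q)) (rden q).

Definition allQ (F : rat -> fm) : fm := All p n d, F (Rat p n (d + 1)).
Definition exQ (F : rat -> fm) : fm := Ex p n d, F (Rat p n (d + 1)).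

Module RatNotations.
Notation "'AllQ' x .. y , A" := (allQ (fun x => .. (allQ (fun y => A%fm)) ..))
  (at level 200, x binder, y binder, right associativity) : fm_scope.
Notation "'ExQ' x .. y , A" := (exQ (fun x => .. (exQ (fun y => A%fm)) ..))
  (at level 200, x binder, y binder, right associativity) : fm_scope.
End RatNotations.
Import RatNotations.

Definition rat0 : rat := Rat 0 0 1.
Definition rat1 : rat := Rat 1 0 1.

Definition radd (q r : rat) : rat :=
  Rat (rpos q * rden r + rpos r * rden q)
      (rneg q * rden r + rneg r * rden q)
      (rden q * rden r).
Definition ropp (q : rat) : rat := Rat (rneg q) (rpos q) (rden q).
Definition rsub (q r : rat) : rat := radd q (ropp r).

Definition rlt (q r : rat) : fm :=
  rpos q * rden r + rneg r * rden q < rpos r * rden q + rneg q * rden r.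
Definition rle (q r : rat) : fm :=
  rpos q * rden r + rneg r * rden q <= rpos r * rden q + rneg q * rden r.

(** |q - r| <= e  and  |q - r| < e *)
Definition rdist_le (q r e : rat) : fm := rle (rsub q r) e /\ rle (rsub r q) e.
Definition rdist_lt (q r e : rat) : fm := rlt (rsub q r) e /\ rlt (rsub r q) e.

(** * Real numbers

    A real is (the graph of) a sequence of rationals q_k with
    |q_k - q_(k+i)| <= 2^(-k).  [cls] is a definable class of numbers: either a
    set or a section of a set, so that the notions below apply to the terms of
    a sequence of reals as well. *)

Definition cls := tm -> fm.

(** Section {z | (i,z) in P}: the [i]-th term of the sequence coded by [P]. *)
Definition sect (P : sv) (i : tm) : cls := fun z => pair i z \in P.

(** A real expression [x] is given by its approximations: [x k K] says that the
    k-th term [q] of the sequence satisfies [K q]. *)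
Definition rexp := tm -> (rat -> fm) -> fm.

Definition val (x : cls) : rexp := fun k K => ExQ q, x (pair k (code q)) /\ K q.
Definition const (q : rat) : rexp := fun _ K => K q.
Definition eadd (x y : rexp) : rexp :=
  fun k K => x (k + 1) (fun q => y (k + 1) (fun r => K (radd q r))).
Definition esub (x y : rexp) : rexp :=
  fun k K => x (k + 1) (fun q => y (k + 1) (fun r => K (rsub q r))).

Definition real (x : cls) : fm :=
  (All z, x z =>> Ex k, ExQ q, z == pair k (code q)) /\
  (All k, ExQ q, x (pair k (code q))) /\
  (All k, AllQ q r, x (pair k (code q)) =>> x (pair k (code r)) =>>
     code q == code r) /\
  (All k i, Ex m, pow2 k m /\
     val x k (fun q => val x (k + i) (fun r => rdist_le q r (Rat 1 0 m)))).

(** x <= y  iff  q_k <= r_k + 2^(-k+1) for all k. *)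
Definition ele (x y : rexp) : fm :=
  All k, Ex m, pow2 k m /\
    x k (fun q => y k (fun r => rle q (radd r (Rat 2 0 m)))).
Definition elt (x y : rexp) : fm := ~ ele y x.
Definition eeq (x y : rexp) : fm := ele x y /\ ele y x.

(** y - e < x < y + e  and  y - e <= x <= y + e *)
Definition edist_lt (x y e : rexp) : fm := elt (esub y e) x /\ elt x (eadd y e).
Definition edist_le (x y e : rexp) : fm := ele (esub y e) x /\ ele x (eadd y e).

Definition unit_interval (x : cls) : fm :=
  real x /\ ele (const rat0) (val x) /\ ele (val x) (const rat1).

Definition positive_real (x : cls) : fm :=
  real x /\ elt (const rat0) (val x).

(** * Codes of continuous functions

    A code of a continuous partial function from R to R is a set of quintuples
    (n,a,r,b,s) with a, b rational and r, s positive rational.  That some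
    (n,a,r,b,s) is in the code, written (a,r) Phi (b,s), means that the open
    ball B(a,r) is mapped into the closed ball with center b and radius s. *)

Definition quintuple (n : tm) (a r b s : rat) : tm :=
  pair (pair (pair (pair n (code a)) (code r)) (code b)) (code s).

Definition maps (Phi : sv) (a r b s : rat) : fm :=
  Ex n, quintuple n a r b s \in Phi.

(** (a',r') < (a,r), that is, |a - a'| + r' < r *)
Definition subball (a' r' a r : rat) : fm := rdist_lt a a' (rsub r r').

Definition continuous_code (Phi : sv) : fm :=
  (All z, z \in Phi =>> Ex n, ExQ a r b s,
     z == quintuple n a r b s /\ rlt rat0 r /\ rlt rat0 s) /\
  (AllQ a r b s b' s', maps Phi a r b s =>> maps Phi a r b' s' =>>
     rdist_le b b' (radd s s')) /\
  (AllQ a r b s a' r', maps Phi a r b s =>> rlt rat0 r' =>>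
     subball a' r' a r =>> maps Phi a' r' b s) /\
  (AllQ a r b s b' s', maps Phi a r b s =>> rlt rat0 s' =>>
     subball b s b' s' =>> maps Phi a r b' s').

Definition in_domain (Phi : sv) (x : cls) : fm :=
  AllQ e, rlt rat0 e =>>
    ExQ a r b s, maps Phi a r b s /\
      edist_lt (val x) (const a) (const r) /\ rlt s e.

(** The function coded by [Phi] is defined at [x] and its value is [y]. *)
Definition value (Phi : sv) (x y : cls) : fm :=
  real y /\ in_domain Phi x /\
  (AllQ a r b s, maps Phi a r b s =>>
     edist_lt (val x) (const a) (const r) =>>
     edist_le (val y) (const b) (const s)).

(** * Cousin's lemma for continuous functions *)

Definition continuous_gauge (Phi : sv) : fm :=
  continuous_code Phi /\
  AllSet X, unit_interval (mem X) =>>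
    ExSet Y, value Phi (mem X) (mem Y) /\ positive_real (mem Y).

(** The finite set is {P_i | i < n} and the radius of P_i is R_i; the second
    clause says that the radius is a function of the point. *)
Definition fine_cover (Phi P R : sv) (n : tm) : fm :=
  (All i, i < n =>>
     unit_interval (sect P i) /\ positive_real (sect R i) /\
     ExSet Y, value Phi (sect P i) (mem Y) /\
       ele (val (sect R i)) (val (mem Y))) /\
  (All i j, i < n =>> j < n =>>
     eeq (val (sect P i)) (val (sect P j)) =>>
     eeq (val (sect R i)) (val (sect R j))) /\
  (AllSet X, unit_interval (mem X) =>>
     Ex i, i < n /\
       edist_lt (val (mem X)) (val (sect P i)) (val (sect R i))).

Definition Cousin : form := sentence
  (AllSet Phi, continuous_gauge Phi =>>
     ExSet P R, Ex n, fine_cover Phi P R n).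

(* Main.v *)
From Stdlib Require Import List.
From HB Require Import structures.
From mathcomp Require Import all_boot all_order all_algebra boolp ring lra.
Require Import Defs.

(** By completeness it is enough to work in an arbitrary, possibly nonstandard,
    model of RCA0.  Suppose that the infinite binary tree [T] has no path.  A
    string [s] of length [k] stands for the dyadic interval
    [[s/2^k - 1, (s+1)/2^k - 1]] (codes of strings of length [k] lie in
    [[2^k, 2^(k+1))]), and [T_k] is the union of the intervals of the strings of
    length [k] in [T].  The gauge is

      [delta x = sup_k min (2^-k) (dist (x, T_k) / 2)],

    a uniform limit of Lipschitz functions with a computable modulus, hence
    coded by a set.  If [delta x = 0] then [x] lies in every [T_k], and a path
    of [T] is computable from [x]: the binary expansion of [x], or, for dyadic
    [x], one of its two expansions.  So [delta] is positive.  Moreover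
    [delta x < dist (x, T_k)] for some [k], so the points of a [delta]-fine
    cover stay away from [T_k] by more than their radius; by Sigma1-collection a
    single [k] serves all points of the cover, which therefore misses [T_k],
    although [T_k] is not empty. *)

(** * Substitution *)

(** The model offers only Sigma1-induction, and keeping every predicate Delta1 shapes the
    development. The distance to [T_k] is a minimum over a possibly nonstandard number of intervals.
    It is never computed: only the relation that it exceeds a given rational is used, a bounded
    quantifier over strings, so that the lower cuts of the approximations of the gauge are Delta1.
    Truncating at 2^-k makes the terms beyond n negligible at precision 2^-n. The factor 1/2 turns
    [r <= delta x] into a distance of about 2r, and the spare r > 0 absorbs the errors of rational
    approximation. Whether a real is dyadic, and which expansion to take, is settled by classical
    logic in the metatheory; in each case the path is Delta1 in fixed parameters. Powers of two are
    given in the formal language by the beta function, so the totality of exponentiation has to be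
    proved inside the model, by Chinese remaindering under Sigma1-induction. The estimates take
    place in the ordered field of fractions of the model's numbers. *)

Definition scons {X : Type} (x : X) (f : nat -> X) (i : nat) : X :=
  match i with 0 => x | S j => f j end.

Lemma subst_term_comp f g t :
  subst_term f (subst_term g t) = subst_term (fun i => subst_term f (g i)) t.
Proof. by elim: t => //= [s -> t ->|s -> t ->]. Qed.

Lemma subst_term_id t : subst_term Var t = t.
Proof. by elim: t => //= [s -> t ->|s -> t ->]. Qed.

Lemma up_num_comp f g :
  (fun i => subst_term (up_num f) (up_num g i)) =
  up_num (fun i => subst_term f (g i)).
Proof.
by apply: funext => -[|i] //=; rewrite /shift_term !subst_term_comp.
Qed.

Lemma up_num_id : up_num Var = Var.
Proof. by apply: funext => -[]. Qed.

Lemma up_set_comp f g : (fun i => up_set f (up_set g i)) = up_set (fun i => f (g i)).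
Proof. by apply: funext => -[]. Qed.

Lemma up_set_id : up_set (fun X => X) = fun X => X.
Proof. by apply: funext => -[]. Qed.

Lemma subst_comp f g f' g' A :
  subst f g (subst f' g' A) =
  subst (fun i => subst_term f (f' i)) (fun X => g (g' X)) A.
Proof.
elim: A f g f' g' => //= [s t|s t|t X|A IA B IB|A IA|A IA] f g f' g'.
- by rewrite !subst_term_comp.
- by rewrite !subst_term_comp.
- by rewrite !subst_term_comp.
- by rewrite IA IB.
- by rewrite IA up_num_comp.
- by rewrite IA up_set_comp.
Qed.

Lemma subst_id A : subst Var (fun X => X) A = A.
Proof.
elim: A => //= [s t|s t|t X|A -> B -> //|A IA|A IA];
  rewrite ?subst_term_id ?up_num_id ?up_set_id //; by rewrite ?IA.
Qed.

Lemma instN_subst_up t f g A :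
  instN t (subst (up_num f) g A) = subst (scons t f) g A.
Proof.
rewrite /instN subst_comp; congr subst; apply: funext => -[|i] //=.
by rewrite /shift_term subst_term_comp subst_term_id.
Qed.

Lemma instS_subst_up Y f g A :
  instS Y (subst f (up_set g) A) = subst f (scons Y g) A.
Proof.
rewrite /instS subst_comp; congr subst; apply: funext => -[|i] //=;
  by rewrite ?subst_term_id.
Qed.

Lemma subst_instN f g t A :
  subst f g (instN t A) = subst (scons (subst_term f t) f) g A.
Proof. by rewrite /instN subst_comp; congr subst; apply: funext => -[]. Qed.

Lemma subst_instS f g Y A :
  subst f g (instS Y A) = subst f (scons (g Y) g) A.
Proof. by rewrite /instS subst_comp; congr subst; apply: funext => -[]. Qed.

(** Free variables are described by their effect under substitution; one bound [k] serves both
    sorts, the form in which freshness is used. *)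
Definition vars_below (k : nat) (A : form) : Prop :=
  forall f f' g g', (forall i, i < k -> f i = f' i) ->
    (forall i, i < k -> g i = g' i) -> subst f g A = subst f' g' A.

Lemma vars_belowS k l A : k <= l -> vars_below k A -> vars_below l A.
Proof.
move=> kl H f f' g g' Hf Hg; apply: H => i ik;
  [apply: Hf|apply: Hg]; exact: leq_trans kl.
Qed.

Lemma term_vars_below t : exists k, forall f f',
  (forall i, i < k -> f i = f' i) -> subst_term f t = subst_term f' t.
Proof.
elim: t => [i|||s [k Hk] t [l Hl]|s [k Hk] t [l Hl]]; try by exists 0.
- by exists i.+1 => f f' /= ->.
- exists (maxn k l) => f f' H /=; congr Add; [apply: Hk|apply: Hl] => i Hi;
    by apply: H; rewrite leq_max Hi ?orbT.
- exists (maxn k l) => f f' H /=; congr Mul; [apply: Hk|apply: Hl] => i Hi;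
    by apply: H; rewrite leq_max Hi ?orbT.
Qed.

Lemma form_vars_below A : exists k, vars_below k A.
Proof.
elim: A => [s t|s t|t X||A [k Hk] B [l Hl]|A [k Hk]|A [k Hk]].
- have [k Hk] := term_vars_below s; have [l Hl] := term_vars_below t.
  exists (maxn k l) => f f' g g' H _ /=; congr Eq; [apply: Hk|apply: Hl] => i Hi;
    by apply: H; rewrite leq_max Hi ?orbT.
- have [k Hk] := term_vars_below s; have [l Hl] := term_vars_below t.
  exists (maxn k l) => f f' g g' H _ /=; congr Lt; [apply: Hk|apply: Hl] => i Hi;
    by apply: H; rewrite leq_max Hi ?orbT.
- have [k Hk] := term_vars_below t.
  exists (maxn k X.+1) => f f' g g' H Hg /=; congr Mem; [apply: Hk => i Hi;
    by apply: H; rewrite leq_max Hi|by apply: Hg; rewrite leq_max leqnn orbT].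
- by exists 0.
- exists (maxn k l) => f f' g g' H Hg /=; congr Imp; [apply: Hk|apply: Hl] => i Hi;
    (apply: H || apply: Hg); by rewrite leq_max Hi ?orbT.
- exists k => f f' g g' H Hg /=; congr AllN; apply: Hk => // -[|i] //= Hi.
  by rewrite H //; apply: ltnW.
- exists k => f f' g g' H Hg /=; congr AllS; apply: Hk => // -[|i] //= Hi.
  by rewrite Hg //; apply: ltnW.
Qed.

Lemma context_vars_below (G : list form) :
  exists k, forall A, In A G -> vars_below k A.
Proof.
elim: G => [|A G [k Hk]]; first by exists 0.
have [l Hl] := form_vars_below A; exists (maxn k l) => B [<-|HB].
- by apply: vars_belowS Hl; apply: leq_maxr.
- by apply: vars_belowS (Hk _ HB); apply: leq_maxl.
Qed.

(** * Provability *)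

Section Provability.

Variable T : form -> Prop.

Lemma prv_weak G G' A : prv T G A -> incl G G' -> prv T G' A.
Proof.
move=> H; elim: H G' => {G A} [G A HA|G A HA|G A B _ IH|G A B _ IH1 _ IH2|G A _ IH
  |G A _ IH|G A t _ IH|G A _ IH|G A t _ IH|G t|G A s t _ IH1 _ IH2] G' GG'.
- exact: prv_ax.
- by apply: prv_hyp; apply: GG'.
- apply: prv_impI; apply: IH => B' /= [->|/GG' ?]; by [left|right].
- by apply: (prv_impE _ _ A); [apply: IH1|apply: IH2].
- apply: prv_raa; apply: IH => B' /= [->|/GG' ?]; by [left|right].
- by apply: prv_allNI; apply: IH; apply: incl_map.
- by apply: prv_allNE; apply: IH.
- by apply: prv_allSI; apply: IH; apply: incl_map.
- by apply: prv_allSE; apply: IH.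
- exact: prv_eq_refl.
- by apply: (prv_eq_subst _ _ _ s); [apply: IH1|apply: IH2].
Qed.

Lemma prv_iter_allN G k A : (forall G, prv T G A) -> prv T G (iter k AllN A).
Proof. by elim: k G => //= k IH G H; apply: prv_allNI; apply: IH. Qed.

Lemma prv_iter_allS G k A : (forall G, prv T G A) -> prv T G (iter k AllS A).
Proof. by elim: k G => //= k IH G H; apply: prv_allSI; apply: IH. Qed.

Lemma prv_iter_allN_inst G k A f f' g : prv T G (subst f' g (iter k AllN A)) ->
  prv T G (subst (fun i => if i < k then f i else f' (i - k)) g A).
Proof.
elim: k f' => [|k IH] f' /=.
  by congr (prv T G (subst _ _ _)); apply: funext => i; rewrite subn0.
(* The outermost of [k + 1] quantifiers binds index [k], hence receives [f k]. *)
move=> /(prv_allNE _ _ _ (f k)); rewrite instN_subst_up => /IH.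
congr (prv T G (subst _ _ _)); apply: funext => i.
case: (ltngtP i k) => [ik|ki|->].
- by rewrite ltnS (ltnW ik).
- rewrite ltnS leqNgt ki /= subnS /scons.
  by case E : (i - k) => //=; move/eqP: E; rewrite subn_eq0 leqNgt ki.
- by rewrite ltnSn subnn.
Qed.

Lemma prv_iter_allS_inst G k A f g g' : prv T G (subst f g' (iter k AllS A)) ->
  prv T G (subst f (fun i => if i < k then g i else g' (i - k)) A).
Proof.
elim: k g' => [|k IH] g' /=.
  by congr (prv T G (subst _ _ _)); apply: funext => i; rewrite subn0.
move=> /(prv_allSE _ _ _ (g k)); rewrite instS_subst_up => /IH.
congr (prv T G (subst _ _ _)); apply: funext => i.
case: (ltngtP i k) => [ik|ki|->].
- by rewrite ltnS (ltnW ik).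
- rewrite ltnS leqNgt ki /= subnS /scons.
  by case E : (i - k) => //=; move/eqP: E; rewrite subn_eq0 leqNgt ki.
- by rewrite ltnSn subnn.
Qed.

(** An axiom is available in every context, so it can be closed by [k] quantifiers of each sort and
    then instantiated; as its variables lie below [k], the result is the substitution instance. *)
Lemma prv_ax_subst G A f g : T A -> prv T G (subst f g A).
Proof.
move=> HA; have [k Hk] := form_vars_below A.
have H : prv T G (subst Var (fun X => X) (iter k AllN (iter k AllS A))).
  rewrite subst_id; apply: prv_iter_allN => G'; apply: prv_iter_allS => G''.
  exact: prv_ax.
move/(prv_iter_allN_inst _ _ _ f)/(prv_iter_allS_inst _ _ _ _ g): H.
by congr (prv T G _); apply: Hk => i ->.
Qed.

(** Serves to turn a fresh free variable into a bound one. The only case that is not structural is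
    that of an open axiom, settled by [prv_ax_subst]. *)
Lemma prv_subst G A f g :
  prv T G A -> prv T (List.map (subst f g) G) (subst f g A).
Proof.
move=> H; elim: H f g => {G A} [G A HA|G A HA|G A B _ IH|G A B _ IH1 _ IH2|G A _ IH
  |G A _ IH|G A t _ IH|G A _ IH|G A t _ IH|G t|G A s t _ IH1 _ IH2] f g /=.
- exact: prv_ax_subst.
- by apply: prv_hyp; apply: in_map.
- by apply: prv_impI; apply: IH.
- by apply: (prv_impE _ _ (subst f g A)); [apply: IH1|apply: IH2].
- by apply: prv_raa; apply: IH.
- apply: prv_allNI; move: (IH (up_num f) g).
  rewrite !map_map; congr (prv T _ _); apply: List.map_ext => B.
  by rewrite /shiftN !subst_comp.
- move: (prv_allNE _ _ _ (subst_term f t) (IH f g)).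
  by rewrite subst_instN instN_subst_up.
- apply: prv_allSI; move: (IH f (up_set g)).
  rewrite !map_map; congr (prv T _ _); apply: List.map_ext => B.
  rewrite /shiftS !subst_comp; congr subst; apply: funext => i.
  by rewrite subst_term_id.
- move: (prv_allSE _ _ _ (g t) (IH f g)).
  by rewrite subst_instS instS_subst_up.
- exact: prv_eq_refl.
- move: (prv_eq_subst T _ (subst (up_num f) g A) _ _ (IH1 f g)).
  rewrite !subst_instN !instN_subst_up; apply; move: (IH2 f g).
  by rewrite subst_instN.
Qed.

(** The substitution sending [y] to index 0 and every other variable one up agrees with [shiftN] on
    formulas whose variables lie below [y], so it turns the given derivation into a premise of
    [prv_allNI]. *)
Lemma prv_gen_fresh G B y :
  (forall A, In A (B :: G) -> vars_below y A) ->
  prv T G (instN (Var y) B) -> prv T G (AllN B).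
Proof.
move=> Hy H; apply: prv_allNI.
pose f i := if i == y then Var 0 else Var i.+1.
have Hf i : i < y -> f i = Var i.+1 by rewrite /f => Hi; rewrite ltn_eqF.
move: (prv_subst _ _ f (fun X => X) H); rewrite subst_instN /=.
have -> : List.map (subst f (fun X => X)) G = List.map shiftN G.
  by apply: map_ext_in => A HA; apply: (Hy _ (or_intror HA)).
congr (prv T _ _); rewrite -[RHS]subst_id; apply: (Hy _ (or_introl (erefl _))) => //.
by move=> [|i] Hi /=; [rewrite /f eqxx|rewrite Hf // ltnW].
Qed.

Lemma prv_genS_fresh G B y :
  (forall A, In A (B :: G) -> vars_below y A) ->
  prv T G (instS y B) -> prv T G (AllS B).
Proof.
move=> Hy H; apply: prv_allSI.
pose f i := if i == y then 0 else i.+1.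
have Hf i : i < y -> f i = i.+1 by rewrite /f => Hi; rewrite ltn_eqF.
move: (prv_subst _ _ Var f H); rewrite subst_instS /=.
have -> : List.map (subst Var f) G = List.map shiftS G.
  by apply: map_ext_in => A HA; apply: (Hy _ (or_intror HA)).
congr (prv T _ _); rewrite -[RHS]subst_id; apply: (Hy _ (or_introl (erefl _))) => //.
by move=> [|i] Hi /=; [rewrite /f eqxx|rewrite Hf // ltnW].
Qed.

Lemma prv_bot G A : prv T G Bot -> prv T G A.
Proof. by move=> H; apply: prv_raa; apply: prv_weak H _ => B; right. Qed.

Lemma prv_hyp0 G A : prv T (A :: G) A.
Proof. by apply: prv_hyp; left. Qed.

End Provability.

(** * Completeness *)

Record model := Model {
  num : Type;
  sets : Type;
  m0 : num;
  m1 : num;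
  madd : num -> num -> num;
  mmul : num -> num -> num;
  mlt : num -> num -> Prop;
  mmem : num -> sets -> Prop }.

Section Satisfaction.

Variable M : model.

Fixpoint teval (r : nat -> num M) (t : term) : num M :=
  match t with
  | Var i => r i
  | Zero => m0 M
  | One => m1 M
  | Add s u => madd M (teval r s) (teval r u)
  | Mul s u => mmul M (teval r s) (teval r u)
  end.

Fixpoint sat (r : nat -> num M) (w : nat -> sets M) (A : form) : Prop :=
  match A with
  | Eq s t => teval r s = teval r t
  | Lt s t => mlt M (teval r s) (teval r t)
  | Mem t X => mmem M (teval r t) (w X)
  | Bot => False
  | Imp B C => sat r w B -> sat r w C
  | AllN B => forall x, sat (scons x r) w B
  | AllS B => forall X, sat r (scons X w) B
  end.

Definition models (T : form -> Prop) : Prop :=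
  forall A, T A -> forall r w, sat r w A.

Lemma teval_subst r f t :
  teval r (subst_term f t) = teval (fun i => teval r (f i)) t.
Proof. by elim: t => //= [s -> t ->|s -> t ->]. Qed.

Lemma sat_subst r w f g A :
  sat r w (subst f g A) <-> sat (fun i => teval r (f i)) (fun X => w (g X)) A.
Proof.
elim: A r w f g => [s t|s t|t X||A IA B IB|A IA|A IA] r w f g /=;
  rewrite ?teval_subst //.
- by split=> H /IA/H/IB.
- split=> H x; move: (H x) => /=; rewrite IA.
  + move=> H'; congr (sat _ _ _): H'; apply: funext => -[|i] //=.
    by rewrite /shift_term teval_subst.
  + congr (sat _ _ _); apply: funext => -[|i] //=.
    by rewrite /shift_term teval_subst.
- split=> H x; move: (H x) => /=; rewrite IA.
  + by move=> H'; congr (sat _ _ _): H'; apply: funext => -[|i].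
  + by congr (sat _ _ _); apply: funext => -[|i].
Qed.

Lemma sat_instN r w t A : sat r w (instN t A) <-> sat (scons (teval r t) r) w A.
Proof.
rewrite /instN sat_subst; set f := fun i => _.
by have -> : f = scons (teval r t) r by apply: funext => -[].
Qed.

Lemma sat_And r w A B : sat r w (And A B) <-> sat r w A /\ sat r w B.
Proof. by split=> [/not_implyP[? /contrapT]|[? ?] H] //; apply: H. Qed.

Lemma sat_Or r w A B : sat r w (Or A B) <-> sat r w A \/ sat r w B.
Proof.
split=> [H|[HA|HB] nA] //; last by case: (nA HA).
by have [?|/H] := pselect (sat r w A); [left|right].
Qed.

Lemma sat_Iff r w A B : sat r w (Iff A B) <-> (sat r w A <-> sat r w B).
Proof. by rewrite sat_And. Qed.

Lemma sat_ExN r w A : sat r w (ExN A) <-> exists x, sat (scons x r) w A.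
Proof.
split=> [/existsNP[x /contrapT Hx]|[x Hx] H]; first by exists x.
exact: (H x).
Qed.

Lemma sat_ExS r w A : sat r w (ExS A) <-> exists X, sat r (scons X w) A.
Proof.
split=> [/existsNP[x /contrapT Hx]|[x Hx] H]; first by exists x.
exact: (H x).
Qed.

End Satisfaction.

(** * Quotients by an equivalence relation, for the term model and for fractions *)

Section Quotient.

Variables (X : Type) (E : X -> X -> Prop).
Hypotheses (Erefl : forall x, E x x) (Esym : forall x y, E x y -> E y x)
  (Etrans : forall x y z, E x y -> E y z -> E x z).

(** Classes are predicates, so propositional extensionality turns equivalence of representatives
    into equality. *)
Definition quot : Type := {P : X -> Prop | exists x, P = E x}.

Definition qclass (x : X) : quot := exist _ (E x) (ex_intro _ x (erefl (E x))).

Definition qrepr (q : quot) : X := proj1_sig (cid (proj2_sig q)).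

Lemma qclassP x y : qclass x = qclass y <-> E x y.
Proof.
split=> [[] ->|Exy]; first exact: Erefl.
apply: eq_exist => /=; apply: funext => z; apply: propext; split=> H.
- by apply: Etrans H; apply: Esym.
- exact: Etrans H.
Qed.

Lemma qreprK q : qclass (qrepr q) = q.
Proof.
rewrite /qrepr; case: q => P HP /=; case: (cid HP) => x Hx /=.
exact: eq_exist.
Qed.

End Quotient.

(** * An enumeration of all formulas *)

Fixpoint encode_term (t : term) : GenTree.tree nat :=
  match t with
  | Var i => GenTree.Leaf i
  | Zero => GenTree.Node 0 [::]
  | One => GenTree.Node 1 [::]
  | Add s u => GenTree.Node 2 [:: encode_term s; encode_term u]
  | Mul s u => GenTree.Node 3 [:: encode_term s; encode_term u]
  end.

(** The code of [One] is read by the catch-all branch; so is that of [Bot] in [decode]. *)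
Fixpoint decode_term (t : GenTree.tree nat) : term :=
  match t with
  | GenTree.Leaf i => Var i
  | GenTree.Node 0 _ => Zero
  | GenTree.Node 2 [:: s; u] => Add (decode_term s) (decode_term u)
  | GenTree.Node 3 [:: s; u] => Mul (decode_term s) (decode_term u)
  | GenTree.Node _ _ => One
  end.

Fixpoint encode (A : form) : GenTree.tree nat :=
  match A with
  | Eq s t => GenTree.Node 0 [:: encode_term s; encode_term t]
  | Lt s t => GenTree.Node 1 [:: encode_term s; encode_term t]
  | Mem t X => GenTree.Node 2 [:: encode_term t; GenTree.Leaf X]
  | Bot => GenTree.Node 3 [::]
  | Imp B C => GenTree.Node 4 [:: encode B; encode C]
  | AllN B => GenTree.Node 5 [:: encode B]
  | AllS B => GenTree.Node 6 [:: encode B]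
  end.

Fixpoint decode (t : GenTree.tree nat) : form :=
  match t with
  | GenTree.Node 0 [:: s; u] => Eq (decode_term s) (decode_term u)
  | GenTree.Node 1 [:: s; u] => Lt (decode_term s) (decode_term u)
  | GenTree.Node 2 [:: s; GenTree.Leaf X] => Mem (decode_term s) X
  | GenTree.Node 4 [:: s; u] => Imp (decode s) (decode u)
  | GenTree.Node 5 [:: s] => AllN (decode s)
  | GenTree.Node 6 [:: s] => AllS (decode s)
  | _ => Bot
  end.

Lemma encode_termK : cancel encode_term decode_term.
Proof. by elim=> //= [s -> t ->|s -> t ->]. Qed.

Lemma encodeK : cancel encode decode.
Proof.
by elim=> //= [s t|s t|t X|A -> B ->|A ->|A ->]; rewrite ?encode_termK.
Qed.

Definition nth_form (n : nat) : form :=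
  if unpickle n is Some t then decode t else Bot.

Lemma nth_form_surj A : exists n, nth_form n = A.
Proof. by exists (pickle (encode A)); rewrite /nth_form pickleK encodeK. Qed.

(** * Henkin's construction and the term model *)

Section Henkin.

Variables (T : form -> Prop) (A0 : form).
Hypothesis notprv : ~ prv T nil A0.

(** Each stage of the construction is a finite list, so some variable is fresh for it; the variables
    themselves serve as Henkin constants. *)
Definition fresh_var (G : list form) : nat := proj1_sig (cid (context_vars_below G)).

Lemma fresh_varP G A : In A G -> vars_below (fresh_var G) A.
Proof. by rewrite /fresh_var; case: (cid _) => /= k; apply. Qed.

Definition witness (G : list form) (A : form) : list form :=
  match A with
  | AllN B => Not (instN (Var (fresh_var (B :: Not A :: G))) B) :: nil
  | AllS B => Not (instS (fresh_var (B :: Not A :: G)) B) :: nil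
  | _ => nil
  end.

Definition extend (G : list form) (A : form) : list form :=
  if `[< prv T (A :: G) Bot >] then (witness G A ++ Not A :: G)%list else A :: G.

Fixpoint henkin (n : nat) : list form :=
  if n is m.+1 then extend (henkin m) (nth_form m) else Not A0 :: nil.

(** If the counterexample to a refuted universal formula made the stage inconsistent, generalization
    over the fresh variable would derive that formula, against the consistency of its negation with
    [G]. *)
Lemma extend_consistent G A : ~ prv T G Bot -> ~ prv T (extend G A) Bot.
Proof.
rewrite /extend; case: asboolP => // H nG.
have nG' : ~ prv T (Not A :: G) Bot.
  move=> /prv_raa H'; apply: nG; apply: prv_impE H'; exact: prv_impI.
rewrite /witness; case: A H nG' => //= B H nG' /prv_raa H'; apply: nG';
  apply: prv_impE (prv_hyp0 _ _ _) _.
- apply: prv_gen_fresh H' => C HC; exact: fresh_varP.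
- apply: prv_genS_fresh H' => C HC; exact: fresh_varP.
Qed.

Lemma henkin_consistent n : ~ prv T (henkin n) Bot.
Proof.
elim: n => [|n IH]; last exact: extend_consistent.
by move=> /= /prv_raa.
Qed.

Lemma henkin_incl n m : n <= m -> incl (henkin n) (henkin m).
Proof.
move/subnK <-; elim: (m - n) => [|k IH] B HB //=; rewrite /extend.
case: asboolP => _; last by right; apply: IH.
by apply: in_or_app; right; right; apply: IH.
Qed.

(** The theory is the union of the stages; deriving from a single stage keeps contexts finite. *)
Definition thm (A : form) : Prop := exists n, prv T (henkin n) A.

Lemma thm_prv A : (forall G, prv T G A) -> thm A.
Proof. by move=> H; exists 0; apply: H. Qed.

Lemma thm_mp A B : thm (Imp A B) -> thm A -> thm B.
Proof.
move=> [n Hn] [m Hm]; exists (maxn n m); apply: (prv_impE _ _ A).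
- by apply: prv_weak Hn _; apply: henkin_incl; apply: leq_maxl.
- by apply: prv_weak Hm _; apply: henkin_incl; apply: leq_maxr.
Qed.

Lemma thm_bot : ~ thm Bot.
Proof. by move=> [n /henkin_consistent]. Qed.

Lemma thm_decided A : thm A \/ thm (Not A).
Proof.
have [n <-] := nth_form_surj A.
case E : `[< prv T (nth_form n :: henkin n) Bot >].
- by right; exists n; apply: prv_impI; apply/asboolP.
- by left; exists n.+1; rewrite /= /extend E; apply: prv_hyp0.
Qed.

Lemma thm_imp A B : thm (Imp A B) <-> (thm A -> thm B).
Proof.
split; first exact: thm_mp.
have [tA|tnA] := thm_decided A => H.
- have [n Hn] := H tA; exists n; apply: prv_impI.
  by apply: prv_weak Hn _ => C; right.
- have [n Hn] := tnA; exists n; apply: prv_impI; apply: prv_bot.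
  apply: prv_impE (prv_hyp0 _ _ _).
  by apply: prv_weak Hn _ => C; right.
Qed.

(** If the formula was rejected when its turn came in the enumeration, a counterexample was added at
    that stage and contradicts the instance supplied by [H]; otherwise the formula itself was
    added. *)
Lemma thm_allN B : thm (AllN B) <-> forall t, thm (instN t B).
Proof.
split=> [[n Hn] t|H]; first by exists n; apply: prv_allNE.
have [n En] := nth_form_surj (AllN B).
case E : `[< prv T (nth_form n :: henkin n) Bot >].
- exfalso; apply: thm_bot; apply: thm_mp (H (Var (fresh_var (B :: Not (nth_form n) :: henkin n)))).
  by exists n.+1; rewrite /= /extend E En /=; apply: prv_hyp0.
- by exists n.+1; rewrite /= /extend E En; apply: prv_hyp0.
Qed.

Lemma thm_allS B : thm (AllS B) <-> forall Y, thm (instS Y B).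
Proof.
split=> [[n Hn] t|H]; first by exists n; apply: prv_allSE.
have [n En] := nth_form_surj (AllS B).
case E : `[< prv T (nth_form n :: henkin n) Bot >].
- exfalso; apply: thm_bot; apply: thm_mp (H (fresh_var (B :: Not (nth_form n) :: henkin n))).
  by exists n.+1; rewrite /= /extend E En /=; apply: prv_hyp0.
- by exists n.+1; rewrite /= /extend E En; apply: prv_hyp0.
Qed.

Lemma thm_eq_subst A s t : thm (Eq s t) -> thm (instN s A) -> thm (instN t A).
Proof.
move=> [n Hn] [m Hm]; exists (maxn n m); apply: (prv_eq_subst _ _ _ s).
- by apply: prv_weak Hn _; apply: henkin_incl; apply: leq_maxl.
- by apply: prv_weak Hm _; apply: henkin_incl; apply: leq_maxr.
Qed.

Definition teq (s t : term) : Prop := thm (Eq s t).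

Lemma shift_termK t s :
  subst_term (fun i => match i with 0 => t | S j => Var j end) (shift_term s) = s.
Proof. by rewrite /shift_term subst_term_comp subst_term_id. Qed.

Lemma teq_refl t : teq t t.
Proof. by apply: thm_prv => G; apply: prv_eq_refl. Qed.

Lemma teq_sym s t : teq s t -> teq t s.
Proof.
move=> H; move: (thm_eq_subst (Eq (Var 0) (shift_term s)) s t H).
by rewrite /instN /= !shift_termK; apply; apply: teq_refl.
Qed.

Lemma teq_trans s t u : teq s t -> teq t u -> teq s u.
Proof.
move=> H1 H2; move: (thm_eq_subst (Eq (shift_term s) (Var 0)) t u H2).
by rewrite /instN /= !shift_termK; apply.
Qed.

Lemma teq_cong (F : term -> term -> term) s s' t t' :
  (forall f a b, subst_term f (F a b) = F (subst_term f a) (subst_term f b)) ->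
  teq s s' -> teq t t' -> teq (F s t) (F s' t').
Proof.
move=> HF H1 H2.
have H3 : teq (F s t) (F s' t).
  move: (thm_eq_subst (Eq (shift_term (F s t)) (F (Var 0) (shift_term t))) s s' H1).
  by rewrite /instN /= !shift_termK !HF /= !shift_termK; apply; apply: teq_refl.
apply: teq_trans H3 _.
move: (thm_eq_subst (Eq (shift_term (F s' t)) (F (shift_term s') (Var 0))) t t' H2).
by rewrite /instN /= !shift_termK !HF /= !shift_termK; apply; apply: teq_refl.
Qed.

Notation cls := (qclass term teq).
Notation rep := (qrepr term teq).

Lemma clsP s t : cls s = cls t <-> teq s t.
Proof. exact: (qclassP _ _ teq_refl teq_sym teq_trans). Qed.

Lemma teq_rep t : teq (rep (cls t)) t.
Proof. by apply/clsP; rewrite qreprK. Qed.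

Lemma thm_rel_cong (F : term -> term -> form) s s' t t' :
  (forall f g a b, subst f g (F a b) = F (subst_term f a) (subst_term f b)) ->
  teq s s' -> teq t t' -> thm (F s t) -> thm (F s' t').
Proof.
move=> HF H1 H2 H.
have H3 : thm (F s' t).
  move: (thm_eq_subst (F (Var 0) (shift_term t)) s s' H1).
  by rewrite /instN !HF /= !shift_termK; apply.
move: (thm_eq_subst (F (shift_term s') (Var 0)) t t' H2).
by rewrite /instN !HF /= !shift_termK; apply.
Qed.

(** Equality of numbers is interpreted by identity, hence terms modulo provable equality. The
    language has no equality of sets, so the sets are the bare set variables. *)
Definition term_model : model :=
  Model (quot term teq) nat (cls Zero) (cls One)
    (fun x y => cls (Add (rep x) (rep y))) (fun x y => cls (Mul (rep x) (rep y)))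
    (fun x y => thm (Lt (rep x) (rep y))) (fun x X => thm (Mem (rep x) X)).

Lemma term_model_eval f t :
  teval term_model (fun i => cls (f i)) t = cls (subst_term f t).
Proof.
elim: t => //= [s -> t ->|s -> t ->]; apply/clsP;
  apply: teq_cong => //; exact: teq_rep.
Qed.

(** The substitution is general so that a quantifier can extend it by a representative of an
    arbitrary element; the quantifier cases rest on the counterexamples of the construction. *)
Lemma term_model_sat f g A :
  sat term_model (fun i => cls (f i)) g A <-> thm (subst f g A).
Proof.
elim: A f g => [s t|s t|t X||A IA B IB|A IA|A IA] f g; rewrite /= ?term_model_eval.
- exact: clsP.
- split; apply: (thm_rel_cong Lt) => //; (exact: teq_rep || (apply: teq_sym; exact: teq_rep)).
- have H s s' : teq s s' -> thm (Mem s (g X)) -> thm (Mem s' (g X)).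
    by move=> /(thm_eq_subst (Mem (Var 0) (g X))).
  by split; apply: H; [|apply: teq_sym]; apply: teq_rep.
- by split=> // /thm_bot.
- by rewrite thm_imp IA IB.
- have E t : (fun i => cls (scons t f i)) = scons (cls t) (fun i => cls (f i)).
    by apply: funext => -[].
  rewrite thm_allN; split=> [H t|H x].
  + by rewrite instN_subst_up -IA E; apply: H.
  + by rewrite -(qreprK _ _ x) -E IA -instN_subst_up; apply: H.
- rewrite thm_allS; split=> [H Y|H Y].
  + by rewrite instS_subst_up -IA; apply: H.
  + by rewrite IA -instS_subst_up; apply: H.
Qed.

Lemma term_model_models : models term_model T.
Proof.
move=> A HA r w.
have -> : r = fun i => cls (rep (r i)) by apply: funext => i; rewrite qreprK.
by rewrite term_model_sat; apply: thm_prv => G; apply: prv_ax_subst.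
Qed.

Lemma term_model_refutes : ~ sat term_model (fun i => cls (Var i)) (fun X => X) A0.
Proof.
rewrite term_model_sat subst_id => H; apply: thm_bot; apply: thm_mp H.
by exists 0; apply: prv_hyp0.
Qed.

End Henkin.

Theorem completeness (T : form -> Prop) (A : form) :
  (forall M, models M T -> forall r w, sat M r w A) -> proves T A.
Proof.
move=> H; apply: contrapT => nA; apply: (term_model_refutes T A nA).
by apply: H; apply: term_model_models.
Qed.

(** * Definability in models of RCA0 *)

Record rca0 := Rca0 {
  rmodel :> model;
  rset0 : sets rmodel; (* [models] is vacuous without sets *)
  rmodelP : models rmodel RCA0 }.

Definition N (M : rca0) : Type := num M.
Definition St (M : rca0) : Type := sets M.

Definition nlt {M : rca0} (x y : N M) : Prop := mlt M x y.
Definition nle {M : rca0} (x y : N M) : Prop := nlt x y \/ x = y.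
Definition nmem {M : rca0} (x : N M) (X : St M) : Prop := mmem M x X.

Notation "x <n y" := (nlt x y) (at level 70, no associativity).
Notation "x <=n y" := (nle x y) (at level 70, no associativity).

Section Definability.

Variable M : rca0.
Notation N := (N M).
Notation St := (St M).

(* [ctx n] holds the values of the variables [n-1, ..., 0], the innermost one
   last; all further variables are parameters. *)
Fixpoint ctx (n : nat) : Type := if n is m.+1 then (ctx m * N)%type else unit.

Fixpoint env {n : nat} : ctx n -> (nat -> N) -> nat -> N :=
  match n return ctx n -> (nat -> N) -> nat -> N with
  | 0 => fun _ p => p
  | m.+1 => fun c p => scons c.2 (env c.1 p)
  end.

Fixpoint ren (n : nat) (h : nat -> nat) (i : nat) : nat :=
  if n is m.+1 then (if i is j.+1 then (ren m h j).+1 else 0) else h i.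

Lemma env_ren n (c : ctx n) p h i : env c p (ren n h i) = env c (fun j => p (h j)) i.
Proof. by elim: n c i => [|n IH] c [|i] //=. Qed.

(** Two definitions come with two assignments of parameters. Moving one to the even and the other to
    the odd indices lets both be read under a single assignment. *)
Definition interleave {X : Type} (p q : nat -> X) (i : nat) : X :=
  if odd i then q i./2 else p i./2.

Lemma interleave_even {X : Type} (p q : nat -> X) :
  (fun i => interleave p q i.*2) = p.
Proof. by apply: funext => i; rewrite /interleave odd_double doubleK. Qed.

Lemma interleave_odd {X : Type} (p q : nat -> X) :
  (fun i => interleave p q i.*2.+1) = q.
Proof.
by apply: funext => i; rewrite /interleave /= odd_double /= uphalf_double.
Qed.

(** Definability is a property of metatheoretic functions and predicates, each with some defining
    term or formula and its own parameters; later arguments thus never write formulas. *)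
Definition T0 {n} (t : ctx n -> N) : Prop :=
  exists s p, forall c, teval M (env c p) s = t c.

Definition D0 {n} (P : ctx n -> Prop) : Prop :=
  exists A p w, Delta0 A /\ forall c, sat M (env c p) w A <-> P c.

Definition Sig {n} (P : ctx n -> Prop) : Prop :=
  exists2 R : ctx n.+1 -> Prop, D0 R & forall c, P c <-> exists y, R (c, y).

Definition D1 {n} (P : ctx n -> Prop) : Prop := Sig P /\ Sig (fun c => ~ P c).

Lemma shift_term_up f t :
  subst_term (up_num f) (shift_term t) = shift_term (subst_term f t).
Proof. by rewrite /shift_term !subst_term_comp. Qed.

Lemma Delta0_subst f g A : Delta0 A -> Delta0 (subst f g A).
Proof.
move=> H; elim: H f g => {A} [s t|s t|t X||A B _ IA _ IB|t A _ IA] f g /=;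
  try constructor; rewrite ?shift_term_up; by [apply: IA|apply: IB|constructor].
Qed.

Lemma T0_ren n (t : ctx n -> N) s p q h :
  (forall c, teval M (env c p) s = t c) -> (fun i => q (h i)) = p ->
  forall c, teval M (env c q) (subst_term (fun i => Var (ren n h i)) s) = t c.
Proof.
move=> H E c; rewrite teval_subst -H -E; congr (teval _ _ _).
by apply: funext => i /=; rewrite env_ren.
Qed.

Lemma T0_pair n (t u : ctx n -> N) : T0 t -> T0 u ->
  exists s s' p, (forall c, teval M (env c p) s = t c) /\
                 (forall c, teval M (env c p) s' = u c).
Proof.
move=> [s [p Hs]] [s' [p' Hs']].
exists (subst_term (fun i => Var (ren n double i)) s).
exists (subst_term (fun i => Var (ren n (fun i => i.*2.+1) i)) s').
exists (interleave p p'); split.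
- by apply: T0_ren Hs _; apply: interleave_even.
- by apply: T0_ren Hs' _; apply: interleave_odd.
Qed.

Lemma D0_ren n (P : ctx n -> Prop) A p w q v h : Delta0 A ->
  (forall c, sat M (env c p) w A <-> P c) ->
  (fun i => q (h i)) = p -> (fun i => v (h i)) = w ->
  let B := subst (fun i => Var (ren n h i)) h A in
  Delta0 B /\ forall c, sat M (env c q) v B <-> P c.
Proof.
move=> dA HA E F; split; first exact: Delta0_subst.
move=> c; rewrite sat_subst -HA -E -F.
suff -> : (fun i => teval M (env c q) (Var (ren n h i))) = env c (fun i => q (h i)) by [].
by apply: funext => i /=; rewrite env_ren.
Qed.

Lemma D0_pair n (P Q : ctx n -> Prop) : D0 P -> D0 Q ->
  exists A B p w, [/\ Delta0 A, Delta0 B,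
    forall c, sat M (env c p) w A <-> P c & forall c, sat M (env c p) w B <-> Q c].
Proof.
move=> [A [p [w [dA HA]]]] [B [q [v [dB HB]]]].
have [dA' HA'] := D0_ren _ _ _ _ _ (interleave p q) (interleave w v) _ dA HA
  (interleave_even _ _) (interleave_even _ _).
have [dB' HB'] := D0_ren _ _ _ _ _ (interleave p q) (interleave w v) _ dB HB
  (interleave_odd _ _) (interleave_odd _ _).
by do 4!eexists; split; [exact: dA'|exact: dB'|exact: HA'|exact: HB'].
Qed.

Lemma T0_const n (x : N) : T0 (fun _ : ctx n => x).
Proof.
exists (Var n), (fun _ => x).
by elim: n => [|n IH] c //=; apply: IH.
Qed.

Lemma T0_snd n : T0 (fun c : ctx n.+1 => c.2).
Proof. by exists (Var 0), (fun _ => m0 M). Qed.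

Lemma T0_fst n (t : ctx n -> N) : T0 t -> T0 (fun c : ctx n.+1 => t c.1).
Proof.
move=> [s [p H]]; exists (shift_term s), p => c.
by rewrite -H /shift_term teval_subst.
Qed.

Lemma T0_add n (t u : ctx n -> N) : T0 t -> T0 u -> T0 (fun c => madd M (t c) (u c)).
Proof.
move=> Ht Hu; have [s [s' [p [Hs Hs']]]] := T0_pair _ _ _ Ht Hu.
by exists (Add s s'), p => c /=; rewrite Hs Hs'.
Qed.

Lemma T0_mul n (t u : ctx n -> N) : T0 t -> T0 u -> T0 (fun c => mmul M (t c) (u c)).
Proof.
move=> Ht Hu; have [s [s' [p [Hs Hs']]]] := T0_pair _ _ _ Ht Hu.
by exists (Mul s s'), p => c /=; rewrite Hs Hs'.
Qed.

Lemma D0_ext n (P Q : ctx n -> Prop) : (forall c, P c <-> Q c) -> D0 P -> D0 Q.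
Proof.
move=> PQ [A [p [w [dA HA]]]]; exists A, p, w; split=> // c.
by rewrite HA PQ.
Qed.

Lemma D0_eq n (t u : ctx n -> N) : T0 t -> T0 u -> D0 (fun c => t c = u c).
Proof.
move=> Ht Hu; have [s [s' [p [Hs Hs']]]] := T0_pair _ _ _ Ht Hu.
exists (Eq s s'), p, (fun _ => rset0 M); split; first exact: Delta0_eq.
by move=> c /=; rewrite Hs Hs'.
Qed.

Lemma D0_lt n (t u : ctx n -> N) : T0 t -> T0 u -> D0 (fun c => t c <n u c).
Proof.
move=> Ht Hu; have [s [s' [p [Hs Hs']]]] := T0_pair _ _ _ Ht Hu.
exists (Lt s s'), p, (fun _ => rset0 M); split; first exact: Delta0_lt.
by move=> c /=; rewrite Hs Hs'.
Qed.

Lemma D0_mem n (t : ctx n -> N) X : T0 t -> D0 (fun c => nmem (t c) X).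
Proof.
move=> [s [p H]]; exists (Mem s 0), p, (fun _ => X); split; first exact: Delta0_mem.
by move=> c /=; rewrite H.
Qed.

Lemma D0_false n : D0 (fun _ : ctx n => False).
Proof. exists Bot, (fun _ => m0 M), (fun _ => rset0 M); split=> //; exact: Delta0_bot. Qed.

Lemma D0_imp n (P Q : ctx n -> Prop) : D0 P -> D0 Q -> D0 (fun c => P c -> Q c).
Proof.
move=> dP dQ; have [A [B [p [w [dA dB HA HB]]]]] := D0_pair _ _ _ dP dQ.
exists (Imp A B), p, w; split; first exact: Delta0_imp.
by move=> c /=; rewrite HA HB.
Qed.

Lemma D0_not n (P : ctx n -> Prop) : D0 P -> D0 (fun c => ~ P c).
Proof. by move=> dP; apply: D0_imp => //; apply: D0_false. Qed.

Lemma D0_and n (P Q : ctx n -> Prop) : D0 P -> D0 Q -> D0 (fun c => P c /\ Q c).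
Proof.
move=> dP dQ; apply: (D0_ext _ (fun c => ~ (P c -> ~ Q c))) => [c|].
  by split=> [/not_implyP[? /contrapT]|[? ?] H] //; apply: H.
by apply: D0_not; apply: D0_imp => //; apply: D0_not.
Qed.

Lemma D0_or n (P Q : ctx n -> Prop) : D0 P -> D0 Q -> D0 (fun c => P c \/ Q c).
Proof.
move=> dP dQ; apply: (D0_ext _ (fun c => ~ P c -> Q c)) => [c|].
  split=> [H|[?|?] //]; by have [?|/H] := pselect (P c); [left|right].
by apply: D0_imp => //; apply: D0_not.
Qed.

Lemma D0_ball n (t : ctx n -> N) (P : ctx n -> N -> Prop) : T0 t ->
  D0 (fun c : ctx n.+1 => P c.1 c.2) -> D0 (fun c => forall y, y <n t c -> P c y).
Proof.
move=> Ht dP.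
have [s [p Hs]] := Ht; have [A [q [w [dA HA]]]] := dP.
pose s' := subst_term (fun i => Var (ren n double i)) s.
pose A' := subst (fun i => Var (ren n.+1 (fun i => i.*2.+1) i)) (fun i => i) A.
exists (AllN (Imp (Lt (Var 0) (shift_term s')) A')), (interleave p q), w; split.
  by apply: Delta0_ball; apply: Delta0_subst.
have Es c y : teval M (env (n := n.+1) (c, y) (interleave p q)) (shift_term s') = t c.
  rewrite -Hs /shift_term teval_subst /s' teval_subst /=; congr (teval _ _ _).
  by apply: funext => i; rewrite env_ren interleave_even.
have EA c y : sat M (env (n := n.+1) (c, y) (interleave p q)) w A' <-> P c y.
  rewrite -(HA (c, y)) /A' sat_subst.
  suff -> : (fun i => teval M (env (n := n.+1) (c, y) (interleave p q))
    (Var (ren n.+1 (fun i => i.*2.+1) i))) = env (n := n.+1) (c, y) q by [].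
  apply: funext => i; rewrite [LHS](env_ren n.+1 (c, y)); congr (env _ _ _).
  exact: interleave_odd.
move=> c; split=> H y.
- by move=> Hy; apply/EA; apply: (H y); rewrite [X in mlt _ _ X](Es c y).
- by move=> Hy; apply/EA; apply: H; rewrite -(Es c y).
Qed.

Lemma D0_bex n (t : ctx n -> N) (P : ctx n -> N -> Prop) : T0 t ->
  D0 (fun c : ctx n.+1 => P c.1 c.2) -> D0 (fun c => exists y, y <n t c /\ P c y).
Proof.
move=> Ht dP; apply: (D0_ext _ (fun c => ~ forall y, y <n t c -> ~ P c y)) => [c|].
  split; last by move=> [y [Hy Py]] H; apply: (H y).
  by move=> /existsNP[y /not_implyP[Hy /contrapT Py]]; exists y.
by apply: D0_not; apply: D0_ball => //; apply: D0_not.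
Qed.

Lemma D0_fst n (P : ctx n -> Prop) : D0 P -> D0 (fun c : ctx n.+1 => P c.1).
Proof.
move=> [A [p [w [dA HA]]]]; exists (shiftN A), p, w; split; first exact: Delta0_subst.
by move=> c; rewrite -HA /shiftN sat_subst.
Qed.

Lemma Sig_induction (P : N -> Prop) : Sig (fun c : ctx 1 => P c.2) ->
  P (m0 M) -> (forall x, P x -> P (madd M x (m1 M))) -> forall x, P x.
Proof.
move=> [R [A [p [w [dA HA]]]] HP] P0 PS.
have HE x : sat M (scons x p) w (ExN A) <-> P x.
  by rewrite (HP (tt, x)) sat_ExN; split=> -[y Hy]; exists y; apply/(HA ((tt, x), y)).
pose E := ExN A.
have H : sat M p w (And (instN Zero E) (AllN (Imp E (substSucc E)))) ->
    sat M p w (AllN E) := rmodelP M _ (RCA0_induction _ (Sigma1_ex _ dA)) p w.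
move=> x; rewrite -HE; apply: (H _ x); rewrite sat_And sat_instN HE; split=> // y.
move=> /HE/PS/HE Hy; apply: (proj2 (sat_subst M (scons y p) w _ _ E)).
suff -> : (fun i => teval M (scons y p)
    match i with 0 => Add (Var 0) One | j.+1 => Var j.+1 end) =
  scons (madd M y (m1 M)) p by [].
by apply: funext => -[].
Qed.

Lemma D1_comprehension (P : N -> Prop) : D1 (fun c : ctx 1 => P c.2) ->
  exists X : St, forall x, nmem x X <-> P x.
Proof.
move=> [[R dR HR] [Q dQ HQ]].
have [A [B [p [w [dA dB HA HB]]]]] := D0_pair _ _ _ dR dQ.
have dB' : Pi1 (AllN (Not B)).
  by apply: Pi1_all; apply: Delta0_imp => //; apply: Delta0_bot.
have HE x : sat M (scons x p) w (ExN A) <-> P x.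
  by rewrite (HR (tt, x)) sat_ExN; split=> -[y Hy]; exists y; apply/(HA ((tt, x), y)).
have HF x : sat M (scons x p) w (AllN (Not B)) <-> P x.
  rewrite -[P x]/(P (tt, x).2); split=> [H|Px y /(HB ((tt, x), y)) Hy].
  - by apply: contrapT => /(HQ (tt, x))[y /(HB ((tt, x), y))]; apply: H.
  - by have /(HQ (tt, x)) := ex_intro (fun y => Q ((tt, x), y)) y Hy.
pose E := ExN A.
have H : sat M p w (AllN (Iff E (AllN (Not B)))) ->
    sat M p w (ExS (AllN (Iff (Mem (Var 0) 0) (shiftS E)))) :=
  rmodelP M _ (RCA0_comprehension _ _ (Sigma1_ex _ dA) dB') p w.
have {}H : sat M p w (ExS (AllN (Iff (Mem (Var 0) 0) (shiftS E)))).
  refine (H _) => x; refine (proj2 (sat_Iff M (scons x p) w E (AllN (Not B))) _).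
  by rewrite HE HF.
have [X HX] := proj1 (sat_ExS _ _ _ _) H; exists X => x.
have := proj1 (sat_Iff M (scons x p) (scons X w) (Mem (Var 0) 0) (shiftS E)) (HX x).
by rewrite -(HE x) /shiftS sat_subst.
Qed.

Lemma D0_Sig n (P : ctx n -> Prop) : D0 P -> Sig P.
Proof.
move=> dP; exists (fun c => P c.1); first exact: D0_fst.
by move=> c; split=> [Pc|[]//]; exists (m0 M).
Qed.

Lemma D0_induction (P : N -> Prop) : D0 (fun c : ctx 1 => P c.2) ->
  P (m0 M) -> (forall x, P x -> P (madd M x (m1 M))) -> forall x, P x.
Proof. by move/D0_Sig; apply: Sig_induction. Qed.

End Definability.

Arguments T0 {M n}.
Arguments D0 {M n}.
Arguments Sig {M n}.
Arguments D1 {M n}.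

Ltac t0_var_proof M n k :=
  lazymatch n with
  | S ?m =>
      lazymatch k with
      | 0 => constr:(T0_snd M m)
      | S ?j => let p := t0_var_proof M m j in constr:(T0_fst M m _ p)
      end
  end.

Ltac t0_var :=
  lazymatch goal with
  | |- @T0 ?M ?n _ =>
      let go k := (let p := t0_var_proof M n k in exact p) in
      first [go 0 | go 1 | go 2 | go 3 | go 4 | go 5 | go 6 | go 7 | go 8]
  end.

Ltac t0m :=
  lazymatch goal with
  | |- T0 (fun c => madd _ (@?s c) (@?t c)) => apply (T0_add _ _ s t); t0m
  | |- T0 (fun c => mmul _ (@?s c) (@?t c)) => apply (T0_mul _ _ s t); t0m
  | |- _ => first [apply T0_const | t0_var]
  end.

Ltac ind0 := apply: D0_induction; [apply D0_eq; t0m|..].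

(** * The ordered semiring of numbers *)

Section Semiring.

Variable M : rca0.
Notation N := (N M).
Notation z := (m0 M : N).
Notation o := (m1 M : N).
Notation "x + y" := (madd M x y).
Notation "x * y" := (mmul M x y).

Let axm A (HA : RCA0 A) (x y : N) :
  sat M (scons x (scons y (fun _ => z))) (fun _ => rset0 M) A := rmodelP M _ HA _ _.

Lemma nS_neq0 (x : N) : x + o <> z.
Proof. exact: (axm _ RCA0_succ_neq0 x x). Qed.
Lemma nS_inj (x y : N) : x + o = y + o -> x = y.
Proof. exact: (axm _ RCA0_succ_inj x y). Qed.
Lemma nadd0 (x : N) : x + z = x.
Proof. exact: (axm _ RCA0_add0 x x). Qed.
Lemma naddS (x y : N) : x + (y + o) = (x + y) + o.
Proof. exact: (axm _ RCA0_addS x y). Qed.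
Lemma nmul0 (x : N) : x * z = z.
Proof. exact: (axm _ RCA0_mul0 x x). Qed.
Lemma nmulS (x y : N) : x * (y + o) = x * y + x.
Proof. exact: (axm _ RCA0_mulS x y). Qed.
Lemma nlt0 (x : N) : ~ x <n z.
Proof. exact: (axm _ RCA0_lt0 x x). Qed.
Lemma nltS (x y : N) : x <n y + o <-> x <=n y.
Proof.
by have := axm _ RCA0_ltS x y; rewrite sat_Iff sat_Or.
Qed.

Lemma nadd0l (x : N) : z + x = x.
Proof.
move: x; ind0 => [|x IH]; first exact: nadd0.
by rewrite naddS IH.
Qed.

Lemma naddSl (x y : N) : (x + o) + y = (x + y) + o.
Proof.
move: y; ind0 => [|y IH]; first by rewrite !nadd0.
by rewrite !naddS IH.
Qed.

Lemma naddA (x y u : N) : x + (y + u) = (x + y) + u.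
Proof.
move: u; ind0 => [|u IH]; first by rewrite !nadd0.
by rewrite !naddS IH.
Qed.

Lemma naddC (x y : N) : x + y = y + x.
Proof.
move: y; ind0 => [|y IH]; first by rewrite nadd0 nadd0l.
by rewrite naddS naddSl IH.
Qed.

Lemma nmul0l (x : N) : z * x = z.
Proof.
move: x; ind0 => [|x IH]; first exact: nmul0.
by rewrite nmulS IH nadd0.
Qed.

Lemma nmulSl (x y : N) : (x + o) * y = x * y + y.
Proof.
move: y; ind0 => [|y IH]; first by rewrite !nmul0 nadd0.
by rewrite !nmulS IH -!naddA [y + (_ + _)]naddA [y + x]naddC -naddA.
Qed.

Lemma nmulC (x y : N) : x * y = y * x.
Proof.
move: y; ind0 => [|y IH]; first by rewrite nmul0 nmul0l.
by rewrite nmulS nmulSl IH.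
Qed.

Lemma nmulDl (x y u : N) : (x + y) * u = x * u + y * u.
Proof.
move: u; ind0 => [|u IH]; first by rewrite !nmul0 nadd0.
by rewrite !nmulS IH -!naddA [y * u + (_ + _)]naddA [y * u + x]naddC -naddA.
Qed.

Lemma nmulA (x y u : N) : x * (y * u) = (x * y) * u.
Proof.
move: u; ind0 => [|u IH]; first by rewrite !nmul0.
by rewrite !nmulS -IH nmulC nmulDl nmulC [_ * x]nmulC.
Qed.

Lemma nmul1 (x : N) : o * x = x.
Proof. by rewrite -[o]nadd0l nmulSl nmul0l nadd0l. Qed.

Lemma n1_neq0 : o <> z.
Proof. by rewrite -[o]nadd0l; apply: nS_neq0. Qed.

End Semiring.

HB.instance Definition _ (M : rca0) := gen_eqMixin (N M).
HB.instance Definition _ (M : rca0) := gen_choiceMixin (N M).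
HB.instance Definition _ (M : rca0) :=
  GRing.isNmodule.Build (N M) (naddA M) (naddC M) (nadd0l M).

Lemma n1_neq0b (M : rca0) : (m1 M : N M) != GRing.zero :> N M.
Proof. by apply/eqP; apply: n1_neq0. Qed.

HB.instance Definition _ (M : rca0) :=
  GRing.Nmodule_isComNzSemiRing.Build (N M)
    (nmulA M) (nmulC M) (nmul1 M) (nmulDl M) (nmul0l M) (n1_neq0b M).

Import GRing.Theory Num.Theory Order.TTheory.
Local Open Scope ring_scope.

Lemma T0_addr (M : rca0) n (s t : ctx M n -> N M) :
  T0 s -> T0 t -> T0 (fun c => s c + t c).
Proof. exact: T0_add. Qed.

Lemma T0_mulr (M : rca0) n (s t : ctx M n -> N M) :
  T0 s -> T0 t -> T0 (fun c => s c * t c).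
Proof. exact: T0_mul. Qed.

Ltac t0 :=
  lazymatch goal with
  | |- T0 (fun c => (@?s c) + (@?t c)) => apply (T0_addr _ _ s t); t0
  | |- T0 (fun c => (@?s c) * (@?t c)) => apply (T0_mulr _ _ s t); t0
  | |- _ => first [apply T0_const | t0_var]
  end.

(** Directed by the shape of the predicate: each connective invokes its closure lemma, and
    quantifiers are accepted only when visibly bounded. *)
Ltac d0 :=
  cbv beta; lazymatch goal with
  | |- D0 (fun c => nle (@?s c) (@?t c)) =>
      apply (D0_or _ _ (fun c => nlt (s c) (t c)) (fun c => s c = t c)); d0
  | |- D0 (fun c => (@?P c) /\ (@?Q c)) => apply (D0_and _ _ P Q); d0
  | |- D0 (fun c => (@?P c) \/ (@?Q c)) => apply (D0_or _ _ P Q); d0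
  | |- D0 (fun c => ~ (@?P c)) => apply (D0_not _ _ P); d0
  | |- D0 (fun c => (@?s c) = (@?t c)) => apply (D0_eq _ _ s t); t0
  | |- D0 (fun c => nlt (@?s c) (@?t c)) => apply (D0_lt _ _ s t); t0
  | |- D0 (fun c => nmem (@?s c) ?X) => apply (D0_mem _ _ s X); t0
  | |- D0 (fun c => exists y, nlt y (@?t c) /\ (@?P c y)) =>
      apply (D0_bex _ _ t P); [t0|d0]
  | |- D0 (fun c => forall y, nlt y (@?t c) -> (@?P c y)) =>
      apply (D0_ball _ _ t P); [t0|d0]
  | |- D0 (fun c => (@?P c) -> (@?Q c)) => apply (D0_imp _ _ P Q); d0
  end.

(** * Order and cancellation *)

Section Order.

Variable M : rca0.
Notation N := (N M).
Implicit Types x y u v w : N.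

Lemma ind0 (P : N -> Prop) : D0 (fun c : ctx M 1 => P c.2) ->
  P 0 -> (forall x, P x -> P (x + 1)) -> forall x, P x.
Proof. exact: D0_induction. Qed.

Lemma indS (P : N -> N -> Prop) : D0 (fun c : ctx M 2 => P c.1.2 c.2) ->
  (exists y, P 0 y) -> (forall x y, P x y -> exists y, P (x + 1) y) ->
  forall x, exists y, P x y.
Proof.
move=> dP P0 PS; apply: (Sig_induction _ (fun x => exists y, P x y)) => //.
  by exists (fun c => P c.1.2 c.2).
by move=> x [y]; apply: PS.
Qed.

Lemma naddI u : injective (fun x : N => x + u).
Proof.
move=> x y; move: u; apply: ind0 => [||u IH]; first by d0.
  by rewrite !addr0.
by rewrite !addrA => /nS_inj.
Qed.

Lemma n_case x : x = 0 \/ exists y, x = y + 1.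
Proof.
have [y [->|->]] : exists y, x = 0 \/ x = y + 1.
- move: x; apply: indS; [by d0|by exists 0; left|].
  by move=> x y _; exists x; right.
- by left.
- by right; exists y.
Qed.

(** Order becomes a statement about addition, so that inequalities reduce to explicit differences
    and [ring]. *)
Lemma nltE x y : x <n y <-> exists u, y = x + u + 1.
Proof.
split=> [|[u ->]].
(* The difference [u] is quantified in front of the disjunction, which gives [indS] a Delta0
   matrix. *)
- have [u [//|->]] : exists u, ~ x <n y \/ y = x + u + 1.
    move: y; apply: indS; first by d0.
      by exists 0; left; apply: nlt0.
    move=> y u Hu; have [/nltS[xy|->]|?] := pselect (x <n y + 1).
    - by case: Hu => // ->; exists (u + 1); right; ring.
    - by exists 0; right; ring.
    - by exists u; left.
  by exists u.
- move: u; apply: ind0 => [||u IH]; first by d0.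
    by rewrite addr0; apply/nltS; right.
  by apply/nltS; left; rewrite addrA.
Qed.

Lemma nlt_irr x : ~ x <n x.
Proof.
rewrite nltE => -[u H]; have : 0 + x = (u + 1) + x by rewrite add0r {1}H; ring.
by move/naddI/esym; apply: nS_neq0.
Qed.

Lemma nlt_trans x y u : x <n y -> y <n u -> x <n u.
Proof.
rewrite !nltE => -[a ->] [b ->]; exists (a + b + 1); ring.
Qed.

Lemma nlt_total x y : [\/ x <n y, x = y | y <n x].
Proof.
have : x <n y \/ (x = y \/ y <n x).
  move: y; apply: ind0 => [||y [xy|[->|]]]; first by d0.
  - case: (n_case x) => [->|[u ->]]; first by right; left.
    by right; right; apply/nltE; exists u; rewrite add0r.
  - by left; apply/nltS; left.
  - by left; apply/nltS; right.
  - rewrite nltE => -[u ->]; case: (n_case u) => [->|[v ->]].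
    + by right; left; ring.
    + by right; right; apply/nltE; exists v; ring.
by case=> [|[|]]; [constructor 1|constructor 2|constructor 3].
Qed.

Lemma nleE x y : x <=n y <-> exists u, y = x + u.
Proof.
split=> [[/nltE[u ->]|->]|[u ->]].
- by exists (u + 1); ring.
- by exists 0; rewrite addr0.
- case: (n_case u) => [->|[v ->]]; first by right; rewrite addr0.
  by left; apply/nltE; exists v; ring.
Qed.

Lemma nle_total x y : x <=n y \/ y <=n x.
Proof. by case: (nlt_total x y) => H; [left; left|left; right|right; left]. Qed.

Lemma nle_anti x y : x <=n y -> y <=n x -> x = y.
Proof. by move=> [xy|//] [yx|//]; case: (nlt_irr x); apply: nlt_trans yx. Qed.

Lemma nlt_mulS x y u : x <n y -> x * (u + 1) <n y * (u + 1).
Proof.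
rewrite !nltE => -[a ->]; exists ((a + 1) * u + a); ring.
Qed.

Lemma nmulSI u x y : x * (u + 1) = y * (u + 1) -> x = y.
Proof.
by case: (nlt_total x y) => // H E; case: (nlt_irr (x * (u + 1)));
  [rewrite {2}E|rewrite {1}E]; apply: nlt_mulS.
Qed.

Lemma nle_mulSI u x y : x * (u + 1) <=n y * (u + 1) -> x <=n y.
Proof.
case: (nlt_total x y) => [?|?|H]; [by left|by right|] => H'.
have E : x * (u + 1) = y * (u + 1) by apply: nle_anti => //; left; apply: nlt_mulS.
by right; apply: nmulSI E.
Qed.

(** * The ordered field of fractions

    The triple [(p, n, d)] stands for [(p - n) / (d + 1)]. *)

Definition triple : Type := (N * N * N)%type.
Implicit Types a b c : triple.

Definition tequiv a b : Prop :=
  let: (p, n, d) := a in let: (p', n', d') := b in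
  p * (d' + 1) + n' * (d + 1) = p' * (d + 1) + n * (d' + 1).

Lemma tequiv_refl a : tequiv a a.
Proof. by case: a => [[p n] d]. Qed.

Lemma tequiv_sym a b : tequiv a b -> tequiv b a.
Proof. by case: a => [[p n] d]; case: b => [[p' n'] d'] /= ->. Qed.

Lemma tequiv_trans a b c : tequiv a b -> tequiv b c -> tequiv a c.
Proof.
case: a => [[p n] d]; case: b => [[p' n'] d']; case: c => [[p'' n''] d''] /= H H'.
apply: (nmulSI d').
apply: (naddI (n' * (d + 1) * (d'' + 1) + p' * (d + 1) * (d'' + 1))) => /=.
have -> : (p * (d'' + 1) + n'' * (d + 1)) * (d' + 1) +
    (n' * (d + 1) * (d'' + 1) + p' * (d + 1) * (d'' + 1)) =
  (p * (d' + 1) + n' * (d + 1)) * (d'' + 1) +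
  (p' * (d'' + 1) + n'' * (d' + 1)) * (d + 1) by ring.
by rewrite H H'; ring.
Qed.

Definition frac : Type := quot triple tequiv.
Definition fcls : triple -> frac := qclass triple tequiv.
Definition frep : frac -> triple := qrepr triple tequiv.

Lemma fclsP a b : fcls a = fcls b <-> tequiv a b.
Proof. exact: (qclassP _ _ tequiv_refl tequiv_sym tequiv_trans). Qed.

Lemma frepK q : fcls (frep q) = q.
Proof. exact: qreprK. Qed.

Lemma frep_equiv a : tequiv (frep (fcls a)) a.
Proof. by apply/fclsP; rewrite frepK. Qed.

(** Denominators are stored minus one: [(d + 1) * (d' + 1)] equals [d * d' + d + d' + 1]. *)
Definition tadd a b : triple :=
  let: (p, n, d) := a in let: (p', n', d') := b in
  (p * (d' + 1) + p' * (d + 1), n * (d' + 1) + n' * (d + 1), d * d' + d + d').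
Definition topp a : triple := let: (p, n, d) := a in (n, p, d).
Definition tmul a b : triple :=
  let: (p, n, d) := a in let: (p', n', d') := b in
  (p * p' + n * n', p * n' + n * p', d * d' + d + d').
Definition tnneg a : Prop := let: (p, n, d) := a in n <=n p.

Lemma tadd_equiv a a' b b' : tequiv a a' -> tequiv b b' -> tequiv (tadd a b) (tadd a' b').
Proof.
case: a => [[p n] d]; case: a' => [[p' n'] d'].
case: b => [[q m] e]; case: b' => [[q' m'] e'] /= H H'.
transitivity ((p * (d' + 1) + n' * (d + 1)) * ((e + 1) * (e' + 1)) +
  (q * (e' + 1) + m' * (e + 1)) * ((d + 1) * (d' + 1))); first by ring.
by rewrite H H'; ring.
Qed.

Lemma tmul_equivl a a' b : tequiv a a' -> tequiv (tmul a b) (tmul a' b).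
Proof.
case: a => [[p n] d]; case: a' => [[p' n'] d']; case: b => [[q m] e] /= H.
transitivity ((p * (d' + 1) + n' * (d + 1)) * (q * (e + 1)) +
  (p' * (d + 1) + n * (d' + 1)) * (m * (e + 1))); first by ring.
transitivity ((p' * (d + 1) + n * (d' + 1)) * (q * (e + 1)) +
  (p * (d' + 1) + n' * (d + 1)) * (m * (e + 1))); first by rewrite H.
by ring.
Qed.

Lemma tmulC a b : tequiv (tmul a b) (tmul b a).
Proof. by case: a => [[p n] d]; case: b => [[p' n'] d'] /=; ring. Qed.

Lemma tmul_equiv a a' b b' : tequiv a a' -> tequiv b b' -> tequiv (tmul a b) (tmul a' b').
Proof.
move=> H H'; apply: (tequiv_trans _ (tmul a' b)); first exact: tmul_equivl.
apply: (tequiv_trans _ (tmul b a')); first exact: tmulC.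
apply: (tequiv_trans _ (tmul b' a')); [exact: tmul_equivl|exact: tmulC].
Qed.

Lemma topp_equiv a a' : tequiv a a' -> tequiv (topp a) (topp a').
Proof.
case: a => [[p n] d]; case: a' => [[p' n'] d'] /= H.
by rewrite addrC -H addrC.
Qed.

Lemma tnneg_equiv a a' : tequiv a a' -> tnneg a -> tnneg a'.
Proof.
case: a => [[p n] d]; case: a' => [[p' n'] d'] /= H /nleE[u E]; subst p.
apply: (nle_mulSI d); apply/nleE; exists (u * (d' + 1)).
apply: (naddI (n * (d' + 1))) => /=; rewrite -H; ring.
Qed.

Definition fadd (q r : frac) : frac := fcls (tadd (frep q) (frep r)).
Definition fopp (q : frac) : frac := fcls (topp (frep q)).
Definition fmul (q r : frac) : frac := fcls (tmul (frep q) (frep r)).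
Definition fnneg (q : frac) : Prop := tnneg (frep q).

Lemma faddE a b : fadd (fcls a) (fcls b) = fcls (tadd a b).
Proof. by apply/fclsP; apply: tadd_equiv; apply: frep_equiv. Qed.
Lemma fmulE a b : fmul (fcls a) (fcls b) = fcls (tmul a b).
Proof. by apply/fclsP; apply: tmul_equiv; apply: frep_equiv. Qed.
Lemma foppE a : fopp (fcls a) = fcls (topp a).
Proof. by apply/fclsP; apply: topp_equiv; apply: frep_equiv. Qed.
Lemma fnnegE a : fnneg (fcls a) <-> tnneg a.
Proof.
by split; apply: tnneg_equiv; [|apply: tequiv_sym]; apply: frep_equiv.
Qed.

Lemma frac_ind (P : frac -> Prop) :
  (forall p n d, P (fcls (p, n, d))) -> forall q, P q.
Proof. by move=> H q; rewrite -(frepK q); case: (frep q) => [[p n] d]. Qed.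

Let zeroF : frac := fcls (0, 0, 0).
Let oneF : frac := fcls (1, 0, 0).

Lemma faddA : associative fadd.
Proof.
elim/frac_ind=> p n d; elim/frac_ind=> p' n' d'; elim/frac_ind=> p'' n'' d''.
by rewrite !faddE; apply/fclsP => /=; ring.
Qed.
Lemma faddC : commutative fadd.
Proof.
elim/frac_ind=> p n d; elim/frac_ind=> p' n' d'.
by rewrite !faddE; apply/fclsP => /=; ring.
Qed.
Lemma fadd0 : left_id zeroF fadd.
Proof. by elim/frac_ind=> p n d; rewrite faddE; apply/fclsP => /=; ring. Qed.
Lemma faddN : left_inverse zeroF fopp fadd.
Proof. by elim/frac_ind=> p n d; rewrite foppE faddE; apply/fclsP => /=; ring. Qed.
Lemma fmulA : associative fmul.
Proof.
elim/frac_ind=> p n d; elim/frac_ind=> p' n' d'; elim/frac_ind=> p'' n'' d''.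
by rewrite !fmulE; apply/fclsP => /=; ring.
Qed.
Lemma fmulC : commutative fmul.
Proof.
elim/frac_ind=> p n d; elim/frac_ind=> p' n' d'.
by rewrite !fmulE; apply/fclsP => /=; ring.
Qed.
Lemma fmul1 : left_id oneF fmul.
Proof. by elim/frac_ind=> p n d; rewrite fmulE; apply/fclsP => /=; ring. Qed.
Lemma fmulDl : left_distributive fmul fadd.
Proof.
elim/frac_ind=> p n d; elim/frac_ind=> p' n' d'; elim/frac_ind=> p'' n'' d''.
by rewrite !(fmulE, faddE); apply/fclsP => /=; ring.
Qed.
Lemma f1_neq0 : oneF <> zeroF.
Proof. by move/fclsP => /=; rewrite !mul0r !addr0 add0r !mul1r => /n1_neq0. Qed.

(** The sign of [p - n] decides: a nonzero numerator is [u + 1] up to sign, so [u] becomes the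
    stored denominator. Zero is its own inverse, following the convention for fields. *)
Lemma finv_ex q : exists r, (q <> zeroF -> fmul r q = oneF) /\ (q = zeroF -> r = zeroF).
Proof.
elim/frac_ind: q => p n d; case: (nlt_total p n) => H.
- have /nltE[u E] := H; exists (fcls (0, d + 1, u)); split.
    by move=> _; rewrite fmulE; apply/fclsP => /=; rewrite E; ring.
  move/fclsP; rewrite /= !mul0r !addr0 !add0r !mulr1 => H'.
  by case: (nlt_irr p); rewrite {2}H'.
- exists zeroF; split=> // H'; case: H'; apply/fclsP; rewrite /= H; ring.
- have /nltE[u E] := H; exists (fcls (d + 1, 0, u)); split.
    by move=> _; rewrite fmulE; apply/fclsP => /=; rewrite E; ring.
  move/fclsP; rewrite /= !mul0r !addr0 !add0r !mulr1 => H'.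
  by case: (nlt_irr p); rewrite {1}H'.
Qed.

Definition finv (q : frac) : frac := proj1_sig (cid (finv_ex q)).

End Order.

Arguments fcls {M}.

HB.instance Definition _ (M : rca0) := gen_eqMixin (frac M).
HB.instance Definition _ (M : rca0) := gen_choiceMixin (frac M).
HB.instance Definition _ (M : rca0) :=
  GRing.isZmodule.Build (frac M) (faddA M) (faddC M) (fadd0 M) (faddN M).

Lemma f1_neq0b (M : rca0) : fcls (1, 0, 0) != GRing.zero :> frac M.
Proof. by apply/eqP; apply: f1_neq0. Qed.

HB.instance Definition _ (M : rca0) :=
  GRing.Zmodule_isComNzRing.Build (frac M)
    (fmulA M) (fmulC M) (fmul1 M) (fmulDl M) (f1_neq0b M).

Lemma fmulV (M : rca0) (q : frac M) : q != 0 -> finv M q * q = 1.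
Proof. by rewrite /finv; case: (cid _) => r [H _] /eqP /=; apply: H. Qed.

Lemma finv0 (M : rca0) : finv M 0 = 0.
Proof. by rewrite /finv; case: (cid _) => r [_ H] /=; apply: H. Qed.

HB.instance Definition _ (M : rca0) :=
  GRing.ComNzRing_isField.Build (frac M) (fmulV M) (finv0 M).

(** * The order of the field of fractions *)

Definition fle {M : rca0} (q r : frac M) : bool := `[< fnneg M (r - q) >].
Definition flt {M : rca0} (q r : frac M) : bool := (r != q) && fle q r.
Definition fnorm {M : rca0} (q : frac M) : frac M := if fle 0 q then q else - q.

Section FracOrder.

Variable M : rca0.
Implicit Types q r : frac M.

Lemma fle0E q : fle 0 q = `[< fnneg M q >].
Proof. by rewrite /fle subr0. Qed.

Lemma fle0_add q r : fle 0 q -> fle 0 r -> fle 0 (q + r).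
Proof.
rewrite !fle0E => /asboolP Hq /asboolP Hr; apply/asboolP; move: Hq Hr.
elim/frac_ind: q => p n d; elim/frac_ind: r => p' n' d'.
rewrite [_ + _](faddE M) !fnnegE /= => /nleE[u ->] /nleE[v ->].
by apply/nleE; exists (u * (d' + 1) + v * (d + 1)); ring.
Qed.

Lemma fle0_mul q r : fle 0 q -> fle 0 r -> fle 0 (q * r).
Proof.
rewrite !fle0E => /asboolP Hq /asboolP Hr; apply/asboolP; move: Hq Hr.
elim/frac_ind: q => p n d; elim/frac_ind: r => p' n' d'.
rewrite [_ * _](fmulE M) !fnnegE /= => /nleE[u ->] /nleE[v ->].
by apply/nleE; exists (u * v); ring.
Qed.

Lemma fle0_anti q : fle 0 q -> fle q 0 -> q = 0.
Proof.
rewrite fle0E /fle sub0r => /asboolP Hq /asboolP Hr; move: Hq Hr.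
elim/frac_ind: q => p n d; rewrite [- _](foppE M) !fnnegE /= => H H'.
by apply/fclsP; rewrite /= (nle_anti _ _ _ H H'); ring.
Qed.

Lemma fsub_ge0 q r : fle 0 (r - q) = fle q r.
Proof. by rewrite fle0E. Qed.

Lemma fle0_total q : fle 0 q || fle q 0.
Proof.
rewrite fle0E /fle sub0r; apply/orP.
elim/frac_ind: q => p n d; rewrite [- _](foppE M).
by case: (nle_total _ n p) => H; [left|right]; apply/asboolP/fnnegE.
Qed.

Lemma fnormN q : fnorm (- q) = fnorm q.
Proof.
rewrite /fnorm; case: ifPn => H; case: ifPn => H' //.
- have -> : q = 0; last by rewrite oppr0.
  by apply: fle0_anti => //; rewrite /fle sub0r -fle0E.
- by rewrite opprK.
- have := fle0_total (- q); rewrite (negbTE H) /= /fle sub0r opprK -fle0E.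
  by rewrite (negbTE H').
Qed.

Lemma fge0_norm q : fle 0 q -> fnorm q = q.
Proof. by rewrite /fnorm => ->. Qed.

Lemma flt_def q r : flt q r = (r != q) && fle q r.
Proof. by []. Qed.

End FracOrder.

HB.instance Definition _ (M : rca0) := Num.IntegralDomain_isLeReal.Build (frac M)
  (fle0_add M) (fle0_mul M) (fle0_anti M) (fsub_ge0 M) (fle0_total M)
  (fnormN M) (fge0_norm M) (flt_def M).

(** * The embedding of the numbers into the field of fractions *)

Definition nq {M : rca0} (x : N M) : frac M := fcls (x, 0, 0).
Notation "x %:q" := (nq x) (at level 2, left associativity, format "x %:q").

Section Embedding.

Variable M : rca0.
Implicit Types x y u : N M.

Lemma nqD x y : (x + y)%:q = x%:q + y%:q.
Proof. by rewrite [RHS](faddE M); apply/fclsP => /=; ring. Qed.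
Lemma nqM x y : (x * y)%:q = x%:q * y%:q.
Proof. by rewrite [RHS](fmulE M); apply/fclsP => /=; ring. Qed.
Lemma nq0 : (0 : N M)%:q = 0.
Proof. by []. Qed.
Lemma nq1 : (1 : N M)%:q = 1.
Proof. by []. Qed.

Lemma nle_q x y : x <=n y <-> x%:q <= y%:q.
Proof.
rewrite -subr_ge0 [_ <= _]fle0E.
have -> : y%:q - x%:q = fcls (y, x, 0).
  by rewrite [- _](foppE M) [_ + _](faddE M); apply/fclsP => /=; ring.
by split=> [?|/asboolP/fnnegE//]; apply/asboolP/fnnegE.
Qed.

Lemma nq_inj x y : x%:q = y%:q -> x = y.
Proof. by move=> E; apply: nle_anti; apply/nle_q; rewrite E. Qed.

Lemma nlt_q x y : x <n y <-> x%:q < y%:q.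
Proof.
split=> [H|].
- rewrite lt_neqAle; apply/andP; split; last by apply/nle_q; left.
  by apply/eqP => /nq_inj E; move: H; rewrite E; apply: nlt_irr.
- case: (nlt_total _ x y) => [//|->|H]; first by rewrite ltxx.
  by rewrite ltNge; have /nle_q -> : y <=n x by left.
Qed.

Lemma nq_ge0 x : 0 <= x%:q.
Proof. by rewrite -nq0; apply/nle_q/nleE; exists x; rewrite add0r. Qed.

Lemma fcls_q p n d : fcls (p, n, d) = (p%:q - n%:q) / (d + 1)%:q :> frac M.
Proof.
have d0 : (d + 1)%:q != 0 :> frac M.
  by apply/eqP; rewrite -nq0 => /nq_inj; apply: nS_neq0.
apply: (mulIf d0); rewrite mulfVK // [- _](foppE M) [LHS](fmulE M) [RHS](faddE M).
by apply/fclsP => /=; ring.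
Qed.

Lemma nS_le x y : x <n y <-> x + 1 <=n y.
Proof.
split=> [/nltE[u ->]|/nleE[u ->]].
- by apply/nleE; exists u; ring.
- by apply/nltE; exists u; ring.
Qed.

Lemma nqS_le x y : (x%:q < y%:q) = (x%:q + 1 <= y%:q).
Proof.
apply/idP/idP; first by move/nlt_q/nS_le/nle_q; rewrite nqD.
by rewrite -nq1 -nqD => /nle_q/nS_le/nlt_q.
Qed.

End Embedding.

(** * Closure properties of definable predicates and functions *)

Section Closure.

Variable M : rca0.
Notation N := (N M).
Notation ctx := (ctx M).

(** A change of context that is a renaming of variables, parameters included; definability is
    carried along by substitution. *)
Definition reindexing {n m} (g : ctx n -> ctx m) : Prop :=
  exists h : nat -> nat, forall c p i, env M (g c) p i = env M c p (h i).

Lemma reindexing_fst n : reindexing (fun c : ctx n.+1 => c.1 : ctx n).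
Proof. by exists S. Qed.

Lemma reindexing_comp n m k (g : ctx m -> ctx k) (h : ctx n -> ctx m) :
  reindexing g -> reindexing h -> reindexing (fun c => g (h c)).
Proof. by move=> [r Hr] [s Hs]; exists (fun i => s (r i)) => c p i; rewrite Hr Hs. Qed.

Lemma reindexing_pair n m (g : ctx n -> ctx m) (v : ctx n -> N) k :
  reindexing g -> (forall c p, env M c p k = v c) ->
  reindexing (fun c => (g c, v c) : ctx m.+1).
Proof.
move=> [r Hr] Hv; exists (fun i => if i is j.+1 then r j else k) => c p [|i] /=.
- by rewrite Hv.
- exact: Hr.
Qed.

Lemma D0_reindex n m (g : ctx n -> ctx m) (P : ctx m -> Prop) :
  reindexing g -> D0 P -> D0 (fun c => P (g c)).
Proof.
move=> [h Hh] [A [p [w [dA HA]]]].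
exists (subst (fun i => Var (h i)) (fun X => X) A), p, w.
split; first exact: Delta0_subst.
move=> c; rewrite -HA sat_subst.
suff -> : (fun i => teval M (env M c p) (Var (h i))) = env M (g c) p by [].
by apply: funext => i; rewrite Hh.
Qed.

Lemma reindexing_up n m (g : ctx n -> ctx m) : reindexing g ->
  reindexing (fun c : ctx n.+1 => (g c.1, c.2) : ctx m.+1).
Proof.
move=> Hg; apply: (reindexing_pair _ _ _ _ 0) => //.
by apply: (reindexing_comp _ _ _ g) => //; apply: reindexing_fst.
Qed.

Lemma reindexing_drop1 n : reindexing (fun c : ctx n.+2 => (c.1.1, c.2) : ctx n.+1).
Proof. by apply: reindexing_up; apply: reindexing_fst. Qed.

Lemma reindexing_drop2 n :
  reindexing (fun c : ctx n.+3 => (c.1.1.1, c.1.2, c.2) : ctx n.+2).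
Proof. by apply: (reindexing_up _ _ _ (reindexing_drop1 n)). Qed.

Lemma reindexing_tt n : reindexing (fun c : ctx n => tt : ctx 0).
Proof.
by exists (fun i => n + i)%N; elim: n => [|n IH] c p i //=; apply: IH.
Qed.

Lemma Sig_ext n (P Q : ctx n -> Prop) : (forall c, P c <-> Q c) -> Sig P -> Sig Q.
Proof. by move=> PQ [R dR HR]; exists R => // c; rewrite -PQ. Qed.

Lemma Sig_reindex n m (g : ctx n -> ctx m) (P : ctx m -> Prop) :
  reindexing g -> Sig P -> Sig (fun c => P (g c)).
Proof.
move=> Hg [R dR HR]; exists (fun c => R (g c.1, c.2)) => //.
exact: (D0_reindex _ _ _ _ (reindexing_up _ _ _ Hg) dR).
Qed.

Lemma Sig_or n (P Q : ctx n -> Prop) : Sig P -> Sig Q -> Sig (fun c => P c \/ Q c).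
Proof.
move=> [R dR HR] [S dS HS]; exists (fun c => R c \/ S c); first exact: D0_or.
move=> c; rewrite HR HS; split=> [[[y Hy]|[y Hy]]|[y [Hy|Hy]]].
- by exists y; left.
- by exists y; right.
- by left; exists y.
- by right; exists y.
Qed.

Lemma nlt_bound2 (x y : N) : exists u, x <n u /\ y <n u.
Proof.
exists (x + y + 1); split; apply/nltE; [by exists y|exists x]; ring.
Qed.

(** [Sig] allows one unbounded quantifier: the two witnesses are placed below a common number and
    become bounded. *)
Lemma Sig_and n (P Q : ctx n -> Prop) : Sig P -> Sig Q -> Sig (fun c => P c /\ Q c).
Proof.
move=> [R dR HR] [S dS HS].
exists (fun c : ctx n.+1 => (exists y, y <n c.2 /\ R (c.1, y)) /\
                            (exists y, y <n c.2 /\ S (c.1, y))).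
  apply: D0_and; [apply: (D0_bex _ _ (fun c : ctx n.+1 => c.2) (fun c y => R (c.1, y)))
                 |apply: (D0_bex _ _ (fun c : ctx n.+1 => c.2) (fun c y => S (c.1, y)))];
    try (by t0); exact: D0_reindex _ _ _ _ (reindexing_drop1 n) _.
move=> c; rewrite HR HS; split=> [[[y Hy] [z Hz]]|[u [[y [_ Hy]] [z [_ Hz]]]]].
- have [u [yu zu]] := nlt_bound2 y z; exists u; split; [by exists y|by exists z].
- by split; [exists y|exists z].
Qed.

Lemma Sig_ex n (P : ctx n -> N -> Prop) :
  Sig (fun c : ctx n.+1 => P c.1 c.2) -> Sig (fun c => exists x, P c x).
Proof.
move=> [R dR HR].
exists (fun c : ctx n.+1 => exists x, x <n c.2 /\ exists y, y <n c.2 /\ R ((c.1, x), y)).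
  apply: (D0_bex _ _ (fun c : ctx n.+1 => c.2)
    (fun (c : ctx n.+1) x => exists y, y <n c.2 /\ R ((c.1, x), y)));
    first by t0.
  apply: (D0_bex _ _ (fun c : ctx n.+2 => c.1.2) (fun c y => R ((c.1.1, c.2), y)));
    first by t0.
  exact: D0_reindex _ _ _ _ (reindexing_drop2 n) _.
move=> c; split=> [[x /(HR (c, x))[y Hy]]|[u [x [_ [y [_ Hy]]]]]].
- have [u [yu xu]] := nlt_bound2 y x; exists u, x; split=> //; by exists y.
- by exists x; apply/(HR (c, x)); exists y.
Qed.

(** Sigma1-induction on [d] for a bound valid below [d]. Witnesses are given only below [b]; the
    disjunct [b <n d] keeps the statement true afterwards. *)
Lemma collection (R : N -> N -> Prop) : D0 (fun c : ctx 2 => R c.1.2 c.2) ->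
  forall b, (forall x, x <n b -> exists y, R x y) ->
  exists w, forall x, x <n b -> exists y, y <n w /\ R x y.
Proof.
move=> dR b Hb.
have [w [/nlt_irr //|]] : exists w, b <n b \/
    forall x, x <n b -> exists y, y <n w /\ R x y; last by move=> H; exists w.
have : forall d, exists w, b <n d \/ forall x, x <n d -> exists y, y <n w /\ R x y.
  apply: indS.
  - apply: D0_or; first by d0.
    apply: (D0_ball _ _ (fun c : ctx 2 => c.1.2)
      (fun (c : ctx 2) x => exists y, y <n c.2 /\ R x y)); first by t0.
    apply: (D0_bex _ _ (fun c : ctx 3 => c.1.2) (fun (c : ctx 3) y => R c.2 y)); first by t0.
    apply: (D0_reindex _ _ (fun c : ctx 4 => ((tt, c.1.2), c.2) : ctx 2) _ _ dR).
    exact: reindexing_up _ _ _ (reindexing_up _ _ _ (reindexing_tt _)).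
  - by exists 0; right=> x /nlt0.
  - move=> d w [bd|IH]; first by exists 0; left; apply/nltS; left.
    have [db|db] := pselect (d <n b); last first.
      exists 0; left; apply/nltS; case: (nlt_total _ d b) => // H; by [right|left].
    have [y Hy] := Hb d db; exists (w + y + 1); right => x /nltS[/IH[z [zw Hz]]|->].
    + exists z; split=> //; apply: nlt_trans zw _; apply/nltE; exists y; ring.
    + exists y; split=> //; apply/nltE; exists w; ring.
by move=> /(_ b).
Qed.

(** Collection gives one bound for all witnesses, which moves the unbounded quantifier outside the
    bounded one. *)
Lemma Sig_ball n (t : ctx n -> N) (P : ctx n -> N -> Prop) : T0 t ->
  Sig (fun c : ctx n.+1 => P c.1 c.2) -> Sig (fun c => forall x, x <n t c -> P c x).
Proof.
move=> dt [R dR HR].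
exists (fun c : ctx n.+1 => forall x, x <n t c.1 -> exists y, y <n c.2 /\ R ((c.1, x), y)).
  apply: (D0_ball _ _ (fun c : ctx n.+1 => t c.1)
    (fun (c : ctx n.+1) x => exists y, y <n c.2 /\ R ((c.1, x), y))).
    exact: T0_fst.
  apply: (D0_bex _ _ (fun c : ctx n.+2 => c.1.2) (fun c y => R ((c.1.1, c.2), y)));
    first by t0.
  exact: D0_reindex _ _ _ _ (reindexing_drop2 n) _.
move=> c; split=> [H|[w H] x /H[y [_ Hy]]]; last by apply/(HR (c, x)); exists y.
have dRc : D0 (fun c' : ctx 2 => R ((c, c'.1.2), c'.2)).
  have [A [p [w [dA HA]]]] := dR; exists A, (env M c p), w; split=> // c'.
  by rewrite -HA.
have [x /H/(HR (c, x)) //|w Hw] := collection (fun x y => R ((c, x), y)) dRc (t c).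
by exists w.
Qed.

Lemma D0_D1 n (P : ctx n -> Prop) : D0 P -> D1 P.
Proof. by move=> dP; split; apply: D0_Sig => //; apply: D0_not. Qed.

Lemma D1_Sig n (P : ctx n -> Prop) : D1 P -> Sig P.
Proof. by case. Qed.

Lemma D1_ext n (P Q : ctx n -> Prop) : (forall c, P c <-> Q c) -> D1 P -> D1 Q.
Proof.
move=> PQ [H H']; split; first exact: Sig_ext H.
by apply: Sig_ext H' => c; rewrite PQ.
Qed.

Lemma D1_not n (P : ctx n -> Prop) : D1 P -> D1 (fun c => ~ P c).
Proof.
move=> [H H']; split=> //; apply: Sig_ext H => c; by rewrite not_notE.
Qed.

Lemma D1_and n (P Q : ctx n -> Prop) : D1 P -> D1 Q -> D1 (fun c => P c /\ Q c).
Proof.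
move=> [H1 H2] [H3 H4]; split; first exact: Sig_and.
by apply: Sig_ext (Sig_or _ _ _ H2 H4) => c; rewrite not_andE.
Qed.

Lemma D1_or n (P Q : ctx n -> Prop) : D1 P -> D1 Q -> D1 (fun c => P c \/ Q c).
Proof.
move=> [H1 H2] [H3 H4]; split; first exact: Sig_or.
by apply: Sig_ext (Sig_and _ _ _ H2 H4) => c; rewrite not_orE.
Qed.

Lemma D1_imp n (P Q : ctx n -> Prop) : D1 P -> D1 Q -> D1 (fun c => P c -> Q c).
Proof.
move=> H1 H2; apply: (D1_ext _ (fun c => ~ P c \/ Q c)) => [c|].
  by rewrite implyE.
by apply: D1_or => //; apply: D1_not.
Qed.

(** Totality makes a Sigma1 graph enough: [P (f c)] and its negation both take the form
    [exists x, x = f c /\ ...], so substituting [f] preserves Delta1. *)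
Definition F1 {n} (f : ctx n -> N) : Prop := Sig (fun c : ctx n.+1 => c.2 = f c.1).

Lemma F1_T0 n (f : ctx n -> N) : T0 f -> F1 f.
Proof.
by move=> Hf; apply: D0_Sig; apply: D0_eq; [apply: T0_snd|apply: T0_fst].
Qed.

Lemma F1_fst n (f : ctx n -> N) : F1 f -> F1 (fun c : ctx n.+1 => f c.1).
Proof. exact: (Sig_reindex _ _ _ _ (reindexing_drop1 n)). Qed.

Lemma Sig_inst n (f : ctx n -> N) (P : ctx n -> N -> Prop) : F1 f ->
  Sig (fun c : ctx n.+1 => P c.1 c.2) -> Sig (fun c => P c (f c)).
Proof.
move=> Hf HP; apply: (Sig_ext _ (fun c => exists x, x = f c /\ P c x)) => [c|].
  by split=> [[x [->]]//|?]; exists (f c).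
exact: (Sig_ex _ (fun c x => x = f c /\ P c x) (Sig_and _ _ _ Hf HP)).
Qed.

Lemma Sig_lift1 n (f : ctx n -> N) (P : N -> Prop) :
  F1 f -> Sig (fun c : ctx 1 => P c.2) -> Sig (fun c => P (f c)).
Proof.
move=> Hf HP; apply: (Sig_inst _ f (fun c x => P x) Hf).
apply: (Sig_reindex _ _ (fun c : ctx n.+1 => (tt, c.2) : ctx 1) _ _ HP).
exact: reindexing_up _ _ _ (reindexing_tt _).
Qed.

Lemma Sig_lift2 n (f g : ctx n -> N) (P : N -> N -> Prop) :
  F1 f -> F1 g -> Sig (fun c : ctx 2 => P c.1.2 c.2) -> Sig (fun c => P (f c) (g c)).
Proof.
move=> Hf Hg HP; apply: (Sig_inst _ f (fun c x => P x (g c)) Hf).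
apply: (Sig_inst _ (fun c : ctx n.+1 => g c.1) (fun c x => P c.2 x)); first exact: F1_fst.
apply: (Sig_reindex _ _ (fun c : ctx n.+2 => (tt, c.1.2, c.2) : ctx 2) _ _ HP).
exact: reindexing_up _ _ _ (reindexing_up _ _ _ (reindexing_tt _)).
Qed.

Lemma Sig_lift3 n (f g h : ctx n -> N) (P : N -> N -> N -> Prop) :
  F1 f -> F1 g -> F1 h -> Sig (fun c : ctx 3 => P c.1.1.2 c.1.2 c.2) ->
  Sig (fun c => P (f c) (g c) (h c)).
Proof.
move=> Hf Hg Hh HP; apply: (Sig_inst _ f (fun c x => P x (g c) (h c)) Hf).
apply: (Sig_inst _ (fun c : ctx n.+1 => g c.1) (fun c x => P c.2 x (h c.1))).
  exact: F1_fst.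
apply: (Sig_inst _ (fun c : ctx n.+2 => h c.1.1) (fun c x => P c.1.2 c.2 x)).
  exact: F1_fst _ _ (F1_fst _ _ Hh).
apply: (Sig_reindex _ _ (fun c : ctx n.+3 => (tt, c.1.1.2, c.1.2, c.2) : ctx 3) _ _ HP).
exact: reindexing_up _ _ _ (reindexing_up _ _ _ (reindexing_up _ _ _ (reindexing_tt _))).
Qed.

Lemma D1_lift1 n (f : ctx n -> N) (P : N -> Prop) :
  F1 f -> D1 (fun c : ctx 1 => P c.2) -> D1 (fun c => P (f c)).
Proof.
move=> Hf [H H']; split; first exact: (Sig_lift1 _ f P).
exact: (Sig_lift1 _ f (fun x => ~ P x)).
Qed.

Lemma D1_lift2 n (f g : ctx n -> N) (P : N -> N -> Prop) :
  F1 f -> F1 g -> D1 (fun c : ctx 2 => P c.1.2 c.2) -> D1 (fun c => P (f c) (g c)).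
Proof.
move=> Hf Hg [H H']; split; first exact: (Sig_lift2 _ f g P).
exact: (Sig_lift2 _ f g (fun x y => ~ P x y)).
Qed.

Lemma F1_lift1 n (f : ctx n -> N) (F : N -> N) :
  F1 f -> Sig (fun c : ctx 2 => c.2 = F c.1.2) -> F1 (fun c => F (f c)).
Proof.
move=> Hf HF; apply: (Sig_lift2 _ (fun c : ctx n.+1 => f c.1) (fun c => c.2)
  (fun x y => y = F x)) => //; first exact: F1_fst.
by apply: F1_T0; t0.
Qed.

Lemma F1_lift2 n (f g : ctx n -> N) (F : N -> N -> N) : F1 f -> F1 g ->
  Sig (fun c : ctx 3 => c.2 = F c.1.1.2 c.1.2) -> F1 (fun c => F (f c) (g c)).
Proof.
move=> Hf Hg HF; apply: (Sig_lift3 _ (fun c : ctx n.+1 => f c.1)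
  (fun c => g c.1) (fun c => c.2) (fun x y z => z = F x y)) => //; try exact: F1_fst.
by apply: F1_T0; t0.
Qed.

Lemma F1_const n (x : N) : F1 (fun _ : ctx n => x).
Proof. by apply: F1_T0; t0. Qed.
Lemma F1_snd n : F1 (fun c : ctx n.+1 => c.2).
Proof. by apply: F1_T0; t0. Qed.
Lemma F1_add n (f g : ctx n -> N) : F1 f -> F1 g -> F1 (fun c => f c + g c).
Proof. by move=> Hf Hg; apply: (F1_lift2 _ f g (fun x y => x + y)) => //; apply: D0_Sig; d0. Qed.
Lemma F1_mul n (f g : ctx n -> N) : F1 f -> F1 g -> F1 (fun c => f c * g c).
Proof. by move=> Hf Hg; apply: (F1_lift2 _ f g (fun x y => x * y)) => //; apply: D0_Sig; d0. Qed.

Lemma D1_eq n (f g : ctx n -> N) : F1 f -> F1 g -> D1 (fun c => f c = g c).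
Proof. by move=> Hf Hg; apply: (D1_lift2 _ f g (fun x y => x = y)) => //; apply: D0_D1; d0. Qed.
Lemma D1_lt n (f g : ctx n -> N) : F1 f -> F1 g -> D1 (fun c => f c <n g c).
Proof. by move=> Hf Hg; apply: (D1_lift2 _ f g (fun x y => x <n y)) => //; apply: D0_D1; d0. Qed.
Lemma D1_le n (f g : ctx n -> N) : F1 f -> F1 g -> D1 (fun c => f c <=n g c).
Proof. by move=> Hf Hg; apply: (D1_lift2 _ f g (fun x y => x <=n y)) => //; apply: D0_D1; d0. Qed.
Lemma D1_mem n (f : ctx n -> N) X : F1 f -> D1 (fun c => nmem (f c) X).
Proof.
by move=> Hf; apply: (D1_lift1 _ f (fun x => nmem x X)) => //; apply: D0_D1; d0.
Qed.
Lemma D1_const n (P : Prop) : D1 (fun _ : ctx n => P).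
Proof.
have dF : D1 (fun _ : ctx n => False) by apply: D0_D1; apply: D0_false.
have [p|np] := pselect P.
- by apply: D1_ext (D1_not _ _ dF) => c; split=> // _ [].
- by apply: D1_ext dF => c; split.
Qed.

Lemma Sig_fball n (f : ctx n -> N) (P : ctx n -> N -> Prop) : F1 f ->
  Sig (fun c : ctx n.+1 => P c.1 c.2) -> Sig (fun c => forall x, x <n f c -> P c x).
Proof.
move=> Hf HP; apply: (Sig_inst _ f (fun c b => forall x, x <n b -> P c x)) => //.
apply: (Sig_ball _ (fun c : ctx n.+1 => c.2) (fun (c : ctx n.+1) x => P c.1 x)); first by t0.
exact: (Sig_reindex _ _ _ _ (reindexing_drop1 n) HP).
Qed.

Lemma D1_ball n (f : ctx n -> N) (P : ctx n -> N -> Prop) : F1 f ->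
  D1 (fun c : ctx n.+1 => P c.1 c.2) -> D1 (fun c => forall x, x <n f c -> P c x).
Proof.
move=> Hf [H H']; split; first exact: Sig_fball.
apply: (Sig_ext _ (fun c => exists x, x <n f c /\ ~ P c x)) => [c|].
  split=> [[x [xf nP]] H0|/existsNP[x /not_implyP[? ?]]]; last by exists x.
  by apply: nP; apply: H0.
apply: (Sig_ex _ (fun c x => x <n f c /\ ~ P c x)); apply: Sig_and => //.
by apply: D1_Sig; apply: D1_lt; [apply: F1_snd|apply: F1_fst].
Qed.

Lemma D1_bex n (f : ctx n -> N) (P : ctx n -> N -> Prop) : F1 f ->
  D1 (fun c : ctx n.+1 => P c.1 c.2) -> D1 (fun c => exists x, x <n f c /\ P c x).
Proof.
move=> Hf HP; apply: (D1_ext _ (fun c => ~ forall x, x <n f c -> ~ P c x)) => [c|].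
  split=> [/existsNP[x /not_implyP[? /contrapT ?]]|[x [xf Px]] H]; first by exists x.
  exact: (H x).
by apply: D1_not; apply: D1_ball => //; apply: D1_not.
Qed.

Lemma F1_unique n (G : ctx n -> N -> Prop) : Sig (fun c : ctx n.+1 => G c.1 c.2) ->
  (forall c, exists x, G c x) -> (forall c x y, G c x -> G c y -> x = y) ->
  exists2 f, F1 f & forall c, G c (f c).
Proof.
move=> HG ex uniq; exists (fun c => proj1_sig (cid (ex c))).
  apply: Sig_ext HG => c; case: (cid _) => x /= Hx.
  by split=> [H|->//]; apply: uniq H Hx.
by move=> c; case: (cid _).
Qed.

(** Otherwise induction on [x] shows that nothing below [x] satisfies [P], a Sigma1 statement
    because the complement of [P] is Sigma1. *)
Lemma D1_least (P : N -> Prop) : D1 (fun c : ctx 1 => P c.2) ->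
  (exists x, P x) -> exists x, P x /\ forall y, y <n x -> ~ P y.
Proof.
move=> [_ HP] [x0 Px0]; apply: contrapT => H.
have : forall x, forall y, y <n x -> ~ P y.
  apply: Sig_induction.
  - apply: (Sig_ball _ (fun c : ctx 1 => c.2) (fun (c : ctx 1) y => ~ P y)); first by t0.
    apply: (Sig_reindex _ _ (fun c : ctx 2 => (tt, c.2) : ctx 1) _ _ HP).
    exact: reindexing_up _ _ _ (reindexing_tt _).
  - by move=> y /nlt0.
  - move=> x IH y /nltS[/IH//|-> Px]; apply: H; by exists x.
by move=> /(_ (x0 + 1) x0); apply=> //; apply/nltS; right.
Qed.

(** The triple representing a value need not be canonical, since comparisons are
    cross-multiplied. *)
Definition FQ {n} (f : ctx n -> frac M) : Prop :=
  exists p m d, [/\ F1 p, F1 m, F1 d & forall c, f c = fcls (p c, m c, d c)].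

Lemma FQ_const n (q : frac M) : FQ (fun _ : ctx n => q).
Proof.
elim/frac_ind: q => p m d; exists (fun _ => p), (fun _ => m), (fun _ => d).
by split=> //; apply: F1_const.
Qed.

Lemma FQ_cls n (p m d : ctx n -> N) :
  F1 p -> F1 m -> F1 d -> FQ (fun c => fcls (p c, m c, d c)).
Proof. by move=> *; exists p, m, d. Qed.

Lemma FQ_nq n (f : ctx n -> N) : F1 f -> FQ (fun c => (f c)%:q).
Proof. by move=> Hf; apply: FQ_cls => //; apply: F1_const. Qed.

Lemma FQ_opp n (f : ctx n -> frac M) : FQ f -> FQ (fun c => - f c).
Proof.
move=> [p [m [d [Hp Hm Hd E]]]]; exists m, p, d; split=> // c.
by rewrite E [LHS](foppE M).
Qed.

Lemma FQ_add n (f g : ctx n -> frac M) : FQ f -> FQ g -> FQ (fun c => f c + g c).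
Proof.
move=> [p [m [d [Hp Hm Hd E]]]] [p' [m' [d' [Hp' Hm' Hd' E']]]].
do 3 eexists; split; last by move=> c; rewrite E E' [LHS](faddE M).
all: repeat (apply: F1_add || apply: F1_mul) => //; exact: F1_const.
Qed.

Lemma FQ_mul n (f g : ctx n -> frac M) : FQ f -> FQ g -> FQ (fun c => f c * g c).
Proof.
move=> [p [m [d [Hp Hm Hd E]]]] [p' [m' [d' [Hp' Hm' Hd' E']]]].
do 3 eexists; split; last by move=> c; rewrite E E' [LHS](fmulE M).
all: repeat (apply: F1_add || apply: F1_mul) => //; exact: F1_const.
Qed.

(** The inverse is the fraction [sg / (pd + 1)], with [pd] the predecessor and [sg] the sign of [f];
    where [f] vanishes, [sg] yields the value 0 that the field prescribes. *)
Lemma FQ_inv n (f : ctx n -> N) : F1 f -> FQ (fun c => ((f c)%:q)^-1).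
Proof.
move=> Hf.
have [pd Hpd Epd] : exists2 g : ctx n -> N, F1 g &
    forall c, (f c = 0 /\ g c = 0) \/ f c = g c + 1.
  apply: (F1_unique _ (fun c x => (f c = 0 /\ x = 0) \/ f c = x + 1)).
  - apply: (Sig_lift2 _ (fun c : ctx n.+1 => f c.1) (fun c => c.2)
      (fun x y => (x = 0 /\ y = 0) \/ x = y + 1)); [exact: F1_fst|exact: F1_snd|].
    by apply: D0_Sig; d0.
  - move=> c; case: (n_case _ (f c)) => [->|[y ->]]; first by exists 0; left.
    by exists y; right.
  - move=> c x y [[-> ->]|->] [[H ->]|H] //; first by case: (nS_neq0 M y).
      by case: (nS_neq0 M x).
    exact: nS_inj H.
have [sg Hsg Esg] : exists2 g : ctx n -> N, F1 g &
    forall c, (f c = 0 /\ g c = 0) \/ (f c <> 0 /\ g c = 1).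
  apply: (F1_unique _ (fun c x => (f c = 0 /\ x = 0) \/ (f c <> 0 /\ x = 1))).
  - apply: (Sig_lift2 _ (fun c : ctx n.+1 => f c.1) (fun c => c.2)
      (fun x y => (x = 0 /\ y = 0) \/ (x <> 0 /\ y = 1))); [exact: F1_fst|exact: F1_snd|].
    by apply: D0_Sig; d0.
  - move=> c; have [->|H] := pselect (f c = 0); first by exists 0; left.
    by exists 1; right.
  - by move=> c x y [[H ->]|[H ->]] [[H' ->]|[H' ->]].
exists sg, (fun _ => 0), pd; split=> //; first exact: F1_const.
move=> c; rewrite fcls_q subr0; case: (Esg c) => -[H ->].
  by rewrite H nq0 invr0 mul0r.
by case: (Epd c) => [[]//|<-]; rewrite nq1 mul1r.
Qed.

Lemma fcls_lt p m d p' m' d' : fcls (p, m, d) < fcls (p', m', d') :> frac M <->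
  p * (d' + 1) + m' * (d + 1) <n p' * (d + 1) + m * (d' + 1).
Proof.
have d0 x : 0 < (x + 1)%:q :> frac M.
  by rewrite -nq0; apply/nlt_q/nltE; exists x; rewrite add0r.
rewrite nlt_q !fcls_q ltr_pdivrMr // mulrAC ltr_pdivlMr // !nqD !nqM !nqD.
by split=> H; lra.
Qed.

Lemma D1_qlt n (f g : ctx n -> frac M) : FQ f -> FQ g -> D1 (fun c => f c < g c).
Proof.
move=> [p [m [d [Hp Hm Hd E]]]] [p' [m' [d' [Hp' Hm' Hd' E']]]].
apply: (D1_ext _ (fun c => p c * (d' c + 1) + m' c * (d c + 1) <n
    p' c * (d c + 1) + m c * (d' c + 1))) => [c|].
  by rewrite E E' fcls_lt.
by apply: D1_lt; repeat (apply: F1_add || apply: F1_mul) => //; exact: F1_const.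
Qed.

Lemma D1_qle n (f g : ctx n -> frac M) : FQ f -> FQ g -> D1 (fun c => f c <= g c).
Proof.
move=> Hf Hg; apply: (D1_ext _ (fun c => ~ g c < f c)) => [c|].
  by rewrite leNgt; split=> /negP.
by apply: D1_not; apply: D1_qlt.
Qed.

End Closure.

Arguments F1 {M n}.
Arguments FQ {M n}.

(** * Semantics of the coded notions

    The connectives are parameters: for their encodings in [form] the notions
    below are convertible to satisfaction of the formulas they translate, and
    these encodings are equal to the usual connectives. *)

Module Sem.
Section Sem.

Variable M : rca0.
Notation N := (N M).
Notation St := (St M).
Variables (AND OR : Prop -> Prop -> Prop)
  (EX : (N -> Prop) -> Prop) (EXS : (St -> Prop) -> Prop).

Notation "A && B" := (AND A B).
Notation "A || B" := (OR A B).
Notation "'Ex' x , A" := (EX (fun x => A)) (at level 200, x binder).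
Notation "'ExS' x , A" := (EXS (fun x => A)) (at level 200, x binder).
Notation "s '<=?' t" := (OR (s <n t) (s = t)) (at level 70).

Implicit Types (c d i j k m n t u v z : N) (X Y F T P Phi : St).

Definition pair i j : N := (i + j) * (i + j) + i.

Definition beta (a b : N) i c : Prop :=
  (c <n (i + 1) * b + 1) && (Ex u, a = u * ((i + 1) * b + 1) + c).

Definition pow2 k m : Prop :=
  Ex a, Ex b, beta a b 0 1 && (beta a b k m &&
    (forall i, i <n k -> Ex c, beta a b i c && beta a b (i + 1) (c + c))).

Definition len (s : N) k : Prop := Ex m, pow2 k m && ((m <=? s) && (s <n m + m)).

Definition initseg (s : N) t : Prop :=
  (0 <n s) && (Ex j, Ex m, Ex v, pow2 j m && ((v <n m) && (t = s * m + v))).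

Definition entry (s : N) i (b : N) : Prop := Ex t, len t i && initseg (t + t + b) s.

Definition binary_tree T : Prop :=
  (forall s, nmem s T -> 0 <n s) &&
  (forall s t, nmem t T -> initseg s t -> nmem s T).

Definition infinite T : Prop := forall k, Ex s, nmem s T && (k <n s).

Definition binary_function F : Prop :=
  (forall z, nmem z F -> Ex i, Ex b, (z = pair i b) && (b <n 1 + 1)) &&
  ((forall i, Ex b, nmem (pair i b) F) &&
  (forall i b c, nmem (pair i b) F -> nmem (pair i c) F -> b = c)).

Definition restriction F k (s : N) : Prop :=
  len s k && (forall i b, i <n k -> nmem (pair i b) F -> entry s i b).

Definition path F T : Prop :=
  binary_function F && (forall k, Ex s, restriction F k s && nmem s T).

Definition WKL : Prop :=
  forall T, binary_tree T -> infinite T -> ExS F, path F T.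

Record rat := Rat { rpos : N; rneg : N; rden : N }.

Definition code (q : rat) : N := pair (pair (rpos q) (rneg q)) (rden q).

Definition allQ (F : rat -> Prop) : Prop := forall p n d, F (Rat p n (d + 1)).
Definition exQ (F : rat -> Prop) : Prop := Ex p, Ex n, Ex d, F (Rat p n (d + 1)).

Notation "'AllQ' q .. r , A" := (allQ (fun q => .. (allQ (fun r => A)) ..))
  (at level 200, q binder, r binder, right associativity).
Notation "'ExQ' q .. r , A" := (exQ (fun q => .. (exQ (fun r => A)) ..))
  (at level 200, q binder, r binder, right associativity).

Definition rat0 : rat := Rat 0 0 1.
Definition rat1 : rat := Rat 1 0 1.

Definition radd (q r : rat) : rat :=
  Rat (rpos q * rden r + rpos r * rden q)
      (rneg q * rden r + rneg r * rden q)
      (rden q * rden r).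
Definition ropp (q : rat) : rat := Rat (rneg q) (rpos q) (rden q).
Definition rsub (q r : rat) : rat := radd q (ropp r).

Definition rlt (q r : rat) : Prop :=
  rpos q * rden r + rneg r * rden q <n rpos r * rden q + rneg q * rden r.
Definition rle (q r : rat) : Prop :=
  rpos q * rden r + rneg r * rden q <=? rpos r * rden q + rneg q * rden r.

Definition rdist_le (q r e : rat) : Prop := rle (rsub q r) e && rle (rsub r q) e.
Definition rdist_lt (q r e : rat) : Prop := rlt (rsub q r) e && rlt (rsub r q) e.

Definition cls := N -> Prop.

Definition sect P i : cls := fun z => nmem (pair i z) P.
Definition mem X : cls := fun z => nmem z X.

Definition rexp := N -> (rat -> Prop) -> Prop.

Definition val (x : cls) : rexp := fun k K => ExQ q, x (pair k (code q)) && K q.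
Definition const (q : rat) : rexp := fun _ K => K q.
Definition eadd (x y : rexp) : rexp :=
  fun k K => x (k + 1) (fun q => y (k + 1) (fun r => K (radd q r))).
Definition esub (x y : rexp) : rexp :=
  fun k K => x (k + 1) (fun q => y (k + 1) (fun r => K (rsub q r))).

Definition real (x : cls) : Prop :=
  (forall z, x z -> Ex k, ExQ q, z = pair k (code q)) &&
  ((forall k, ExQ q, x (pair k (code q))) &&
  ((forall k, AllQ q r, x (pair k (code q)) -> x (pair k (code r)) ->
     code q = code r) &&
  (forall k i, Ex m, pow2 k m &&
     val x k (fun q => val x (k + i) (fun r => rdist_le q r (Rat 1 0 m)))))).

Definition ele (x y : rexp) : Prop :=
  forall k, Ex m, pow2 k m &&
    x k (fun q => y k (fun r => rle q (radd r (Rat (1 + 1) 0 m)))).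
Definition elt (x y : rexp) : Prop := ~ ele y x.
Definition eeq (x y : rexp) : Prop := ele x y && ele y x.

Definition edist_lt (x y e : rexp) : Prop := elt (esub y e) x && elt x (eadd y e).
Definition edist_le (x y e : rexp) : Prop := ele (esub y e) x && ele x (eadd y e).

Definition unit_interval (x : cls) : Prop :=
  real x && (ele (const rat0) (val x) && ele (val x) (const rat1)).

Definition positive_real (x : cls) : Prop := real x && elt (const rat0) (val x).

Definition quintuple n (a r b s : rat) : N :=
  pair (pair (pair (pair n (code a)) (code r)) (code b)) (code s).

Definition maps Phi (a r b s : rat) : Prop := Ex n, nmem (quintuple n a r b s) Phi.

Definition subball (a' r' a r : rat) : Prop := rdist_lt a a' (rsub r r').

Definition continuous_code Phi : Prop :=
  (forall z, nmem z Phi -> Ex n, ExQ a r b s,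
     (z = quintuple n a r b s) && (rlt rat0 r && rlt rat0 s)) &&
  ((AllQ a r b s b' s', maps Phi a r b s -> maps Phi a r b' s' ->
     rdist_le b b' (radd s s')) &&
  ((AllQ a r b s a' r', maps Phi a r b s -> rlt rat0 r' ->
     subball a' r' a r -> maps Phi a' r' b s) &&
  (AllQ a r b s b' s', maps Phi a r b s -> rlt rat0 s' ->
     subball b s b' s' -> maps Phi a r b' s'))).

Definition in_domain Phi (x : cls) : Prop :=
  AllQ e, rlt rat0 e ->
    ExQ a r b s, maps Phi a r b s &&
      (edist_lt (val x) (const a) (const r) && rlt s e).

Definition value Phi (x y : cls) : Prop :=
  real y && (in_domain Phi x &&
  (AllQ a r b s, maps Phi a r b s ->
     edist_lt (val x) (const a) (const r) ->
     edist_le (val y) (const b) (const s))).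

Definition continuous_gauge Phi : Prop :=
  continuous_code Phi &&
  (forall X, unit_interval (mem X) ->
    ExS Y, value Phi (mem X) (mem Y) && positive_real (mem Y)).

Definition fine_cover Phi P (R : St) n : Prop :=
  (forall i, i <n n ->
     unit_interval (sect P i) && (positive_real (sect R i) &&
     (ExS Y, value Phi (sect P i) (mem Y) &&
       ele (val (sect R i)) (val (mem Y))))) &&
  ((forall i j, i <n n -> j <n n ->
     eeq (val (sect P i)) (val (sect P j)) ->
     eeq (val (sect R i)) (val (sect R j))) &&
  (forall X, unit_interval (mem X) ->
     Ex i, (i <n n) &&
       edist_lt (val (mem X)) (val (sect P i)) (val (sect R i)))).

Definition Cousin : Prop :=
  forall Phi, continuous_gauge Phi -> ExS P, ExS R, Ex n, fine_cover Phi P R n.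

End Sem.
End Sem.

Definition and' (A B : Prop) : Prop := ~ (A -> ~ B).
Definition or' (A B : Prop) : Prop := ~ A -> B.
Definition ex' {X : Type} (F : X -> Prop) : Prop := ~ forall x, ~ F x.

Lemma and'E : and' = Logic.and.
Proof.
apply: funext => A; apply: funext => B; apply: propext.
by split=> [/not_implyP[? /contrapT]|[? ?] H] //; apply: H.
Qed.

Lemma or'E : or' = Logic.or.
Proof.
apply: funext => A; apply: funext => B; apply: propext.
rewrite /or'; split=> [H|[a|b] na] //.
by have [?|/H] := pselect A; [left|right].
Qed.

Lemma ex'E (X : Type) : @ex' X = @Logic.ex X.
Proof.
apply: funext => F; apply: propext.
split=> [/existsNP[x /contrapT Hx]|[x Hx] H]; first by exists x.
exact: (H x).
Qed.

Lemma sat_WKL (M : rca0) r w :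
  sat M r w WKL = Sem.WKL M Logic.and Logic.or (@Logic.ex _) (@Logic.ex _).
Proof. by rewrite -and'E -or'E -!ex'E. Qed.

Lemma sat_Cousin (M : rca0) r w :
  sat M r w Cousin = Sem.Cousin M Logic.and Logic.or (@Logic.ex _) (@Logic.ex _).
Proof. rewrite -and'E -or'E -!ex'E. reflexivity. Qed.

(** * Tactics deriving definability *)

Ltac f1_hyp :=
  match goal with
  | H : F1 _ |- _ =>
      first [exact H | exact (F1_fst _ _ _ H)
            | exact (F1_fst _ _ _ (F1_fst _ _ _ H))
            | exact (F1_fst _ _ _ (F1_fst _ _ _ (F1_fst _ _ _ H)))
            | exact (F1_fst _ _ _ (F1_fst _ _ _ (F1_fst _ _ _ (F1_fst _ _ _ H))))]
  end.

Ltac f1_apply rec :=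
  match goal with
  | H : forall n g, F1 g -> F1 (fun c => ?f (g c)) |- F1 (fun c => ?f (@?g c)) =>
      apply (H _ g); rec
  end.

(** This tactic, [d1_user] and [fq_user] are hooks, rebound as new functions and predicates are
    shown definable. *)
Ltac f1_user := fail.

Ltac f1 :=
  cbv beta;
  lazymatch goal with
  | |- F1 (fun c => (@?s c) + (@?t c)) => apply (F1_add _ _ s t); f1
  | |- F1 (fun c => (@?s c) * (@?t c)) => apply (F1_mul _ _ s t); f1
  | |- F1 _ => first [apply F1_const | apply F1_T0; t0_var | f1_hyp | f1_apply f1 | f1_user]
  end.

Ltac d1_user := fail.

Ltac fq_user := fail.

Ltac fq :=
  cbv beta;
  lazymatch goal with
  | |- FQ (fun c => (@?s c) + (@?t c)) => apply (FQ_add _ _ s t); fq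
  | |- FQ (fun c => (@?s c) * (@?t c)) => apply (FQ_mul _ _ s t); fq
  | |- FQ (fun c => - (@?s c)) => apply (FQ_opp _ _ s); fq
  | |- FQ (fun c => nq (@?s c)) => apply (FQ_nq _ _ s); f1
  | |- FQ _ => first [apply FQ_const | fq_user]
  end.

Ltac d1 :=
  cbv beta;
  lazymatch goal with
  | |- D1 (fun c => nle (@?s c) (@?t c)) => apply (D1_le _ _ s t); f1
  | |- D1 (fun c => nlt (@?s c) (@?t c)) => apply (D1_lt _ _ s t); f1
  | |- D1 (fun c => nmem (@?s c) ?X) => apply (D1_mem _ _ s X); f1
  | |- D1 (fun c => (@?P c) /\ (@?Q c)) => apply (D1_and _ _ P Q); d1
  | |- D1 (fun c => (@?P c) \/ (@?Q c)) => apply (D1_or _ _ P Q); d1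
  | |- D1 (fun c => ~ (@?P c)) => apply (D1_not _ _ P); d1
  | |- D1 (fun c => is_true ((@?s c) < (@?t c))) => apply (D1_qlt _ _ s t); fq
  | |- D1 (fun c => is_true ((@?s c) <= (@?t c))) => apply (D1_qle _ _ s t); fq
  | |- D1 (fun c => (@?s c) = (@?t c)) => apply (D1_eq _ _ s t); f1
  | |- D1 (fun c => exists y, nlt y (@?t c) /\ (@?P c y)) =>
      apply (D1_bex _ _ t P); [f1|d1]
  | |- D1 (fun c => forall y, nlt y (@?t c) -> (@?P c y)) =>
      apply (D1_ball _ _ t P); [f1|d1]
  | |- D1 (fun c => (@?P c) -> (@?Q c)) => apply (D1_imp _ _ P Q); d1
  | |- D1 _ => first [apply D1_const | assumption | d1_user]
  end.

Ltac sig :=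
  cbv beta;
  lazymatch goal with
  | |- Sig (fun c => (@?P c) /\ (@?Q c)) => apply (Sig_and _ _ P Q); sig
  | |- Sig (fun c => (@?P c) \/ (@?Q c)) => apply (Sig_or _ _ P Q); sig
  | |- Sig (fun c => exists y, (@?P c y)) => apply (Sig_ex _ _ P); sig
  | |- Sig (fun c => forall y, nlt y (@?t c) -> (@?P c y)) =>
      apply (Sig_fball _ _ t P); [f1|sig]
  | |- Sig _ => first [assumption | apply D1_Sig; d1]
  end.

(** * Powers of two *)

Section Pow2.

Variable M : rca0.
Notation N := (N M).
Notation ctx := (ctx M).
Notation and_ := Logic.and.
Notation ex_ := (@Logic.ex _).
Notation beta := (Sem.beta M and_ ex_).
Notation pow2 := (Sem.pow2 M and_ ex_).
Implicit Types a b d i j k l m u v w x y : N.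

Lemma Sigind (P : N -> Prop) : Sig (fun c : ctx 1 => P c.2) ->
  P 0 -> (forall x, P x -> P (x + 1)) -> forall x, P x.
Proof. exact: Sig_induction. Qed.

Lemma nlt_S x : x <n x + 1.
Proof. by apply/nltS; right. Qed.

Lemma nle_mulS x y : x <n x * (y + 1) + 1.
Proof. by apply/nltE; exists (x * y); ring. Qed.

(** The modulus is positive, so the quotient is at most the first argument and its quantifier can be
    bounded. *)
Lemma D1_beta (n : nat) (fa fb fi fc : ctx n -> N) : F1 fa -> F1 fb -> F1 fi -> F1 fc ->
  D1 (fun c => beta (fa c) (fb c) (fi c) (fc c)).
Proof.
move=> Ha Hb Hi Hc.
apply: (D1_ext _ _ (fun c => fc c <n (fi c + 1) * fb c + 1 /\ exists u, u <n fa c + 1 /\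
  fa c = u * ((fi c + 1) * fb c + 1) + fc c)).
  move=> c; split=> [[H1 [u [_ H2]]]|[H1 [u H2]]]; split=> //; exists u => //.
  by split=> //; rewrite H2; apply/nltE; exists (u * ((fi c + 1) * fb c) + fc c); ring.
by d1.
Qed.

Ltac d1_user ::=
  lazymatch goal with
  | |- D1 (fun c => Sem.beta _ _ _ (@?a c) (@?b c) (@?i c) (@?v c)) =>
      apply (D1_beta _ a b i v); f1
  end.

Lemma n_div x m : exists u v, v <n m + 1 /\ x = u * (m + 1) + v.
Proof.
move: x; apply: Sigind; first by sig.
  by exists 0, 0; split; [apply/nltE; exists m; ring|ring].
move=> x [u [v [vm ->]]]; have [/nltS H|H] := pselect (v + 1 <n m + 1).
  by exists u, (v + 1); split; [apply/nltS|ring].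
exists (u + 1), 0; split; first by apply/nltE; exists m; ring.
have -> : m = v; last by ring.
by move/nltS: vm => [/nS_le/nltS ?|->].
Qed.

Lemma beta_uniq a b i v v' : beta a b i v -> beta a b i v' -> v = v'.
Proof.
rewrite /Sem.beta; move: ((i + 1) * b + 1) => m [H [u E]] [H' [u' E']].
wlog: u u' v v' H E H' E' / u <=n u'.
  move=> W; case: (nle_total _ u u') => uu; first exact: (W u u').
  by apply/esym; apply: (W u' u).
case/nleE => w Ew; case: (n_case _ w) => [w0|[w' Ew']].
  by move: E'; rewrite E Ew w0 addr0 ![u * _ + _]addrC => /naddI.
have Ev : v = (w' + 1) * m + v'.
  by apply: (naddI _ (u * m)) => /=; rewrite addrC -E E' Ew Ew'; ring.
have /nltE[x Ex] := H; case: (nlt_irr _ m); apply/nltE; exists (w' * m + v' + x).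
by rewrite {1}Ex Ev; ring.
Qed.

(** Stands in for a factorial. The bound on the quotient [w] is carried along to keep the matrix of
    the induction Delta0. *)
Lemma common_multiple l : exists y, y <> 0 /\ forall i, i <n l -> exists w, y = w * (i + 1).
Proof.
have [y [Hy H]] : exists y, y <> 0 /\
    forall i, i <n l -> exists w, w <n y + 1 /\ y = w * (i + 1).
  move: l; apply: indS; first by d0.
    by exists 1; split; [exact: n1_neq0|move=> i /nlt0].
  move=> l y [y0 Hy]; exists (y * (l + 1)); split.
    by move=> E; apply: y0; apply: (nmulSI _ l); rewrite E mul0r.
  move=> i /nltS[/Hy[w [_ ->]]|->].
  - exists (w * (l + 1)); split; last by ring.
    rewrite -[w * (i + 1) * (l + 1)]mulrA [(i + 1) * _]mulrC mulrA; exact: nle_mulS.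
  - by exists y; split=> //; apply: nle_mulS.
by exists y; split=> // i /H[w [_ Hw]]; exists w.
Qed.

(* [m_l] is invertible modulo [m_j], where [m_i = (i + 1) b + 1]: the
   combination [(j + 1) m_l - (l + 1) m_j = j - l] divides [b], hence is
   invertible modulo [m_j]. *)
Lemma modulus_inverse l i w (j := l + i + 1) (b := w * (i + 1)) : b <> 0 ->
  exists u t, u * ((l + 1) * b + 1) = t * ((j + 1) * b + 1) + 1.
Proof.
move=> b0; have [|[n' En]] := n_case _ ((j + 1) * b).
  by move=> H; case: b0; apply: (nmulSI _ j); rewrite mul0r mulrC.
(* Modulo [m_j], the product of [m_l] and [(j + 1) * (j + 1) * w] is [(j + 1) * b], that is -1; the
   last factor [(j + 1) * b] is -1 again and restores the sign. *)
exists ((j + 1) * (j + 1) * w * ((j + 1) * b)).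
exists (n' * (1 + (j + 1) * w * (l + 1)) + (j + 1) * w * (l + 1)).
apply: nq_inj; have {En} En : n'%:q = (j%:q + 1) * b%:q - 1.
  by move: (f_equal nq En); rewrite !(nqD, nqM, nq1) => ->; ring.
rewrite !(nqD, nqM, nq1) En /b /j !(nqD, nqM, nq1); ring.
Qed.

Lemma inverse_mul x y m :
  (exists u t, u * x = t * m + 1) -> (exists u t, u * y = t * m + 1) ->
  exists u t, u * (x * y) = t * m + 1.
Proof.
move=> [u [t E]] [u' [t' E']]; exists (u * u'), (t * t' * m + t + t').
by transitivity ((u * x) * (u' * y)); [ring|rewrite E E'; ring].
Qed.

(** The step of recursion: a coded sequence gets one more value. The old modulus base may be too
    small, so a new one is chosen and all remainders are rebuilt by Chinese remaindering. *)
Lemma beta_extend a b k (c : N) : exists a' b',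
  (forall i v, i <=n k -> beta a b i v -> beta a' b' i v) /\ beta a' b' (k + 1) c.
Proof.
have [y [y0 Hy]] := common_multiple (k + 1 + 1).
(* The factor [y] makes the moduli with indices up to [k + 1] pairwise coprime; the factor
   [a + c + 1] makes them exceed the old values, which are at most [a], and the new value [c]. *)
pose b' := y * (a + c + 1).
have b'0 : b' <> 0.
  by rewrite /b' => E; apply: y0; apply: (nmulSI _ (a + c)); rewrite E mul0r.
have [y' Ey] : exists y', y = y' + 1 by case: (n_case _ y).
have b'_large v i : v <=n a + c -> v <n (i + 1) * b' + 1.
  move=> /nleE[u Eu]; apply/nltE; exists (u + (1 + y' * (a + c + 1)) + i * b').
  have -> : b' = a + c + 1 + y' * (a + c + 1) by rewrite /b' Ey; ring.
  by rewrite Eu; ring.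
pose V i v := (i <=n k /\ beta a b i v) \/ (i = k + 1 /\ v = c).
have V_ex i : i <n k + 1 + 1 -> exists v, V i v.
  move=> /nltS[/nltS ik|->]; last by exists c; right.
  have [u [v [Hv Ev]]] := n_div a ((i + 1) * b).
  by exists v; left; split=> //; split=> //; exists u.
have V_le i v : V i v -> v <=n a + c.
  case=> -[_]; last by move=> ->; apply/nleE; exists a; ring.
  by case=> _ [u ->]; apply/nleE; exists (u * ((i + 1) * b + 1) + c); ring.
pose md i := (i + 1) * b' + 1.
have [A HA] : exists A, forall i, i <n k + 1 + 1 -> exists v, V i v /\ beta A b' i v.
  (* Induction on the number [l] of congruences already solved. [Pr] is a common multiple of the
     first [l] moduli that is invertible modulo the remaining ones; the first disjunct covers [l]
     beyond the range. *)
  suff : forall l, k + 1 + 1 <n l \/ exists A Pr,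
      [/\ forall i, i <n l -> exists w, Pr = w * md i,
          forall i, i <n l -> exists v, V i v /\ beta A b' i v &
          forall j, j <n k + 1 + 1 -> j <n l \/ exists u t, u * Pr = t * md j + 1].
    by move=> /(_ (k + 1 + 1))[/nlt_irr//|[A [Pr [_ H _]]]]; exists A.
  apply: Sigind.
  - apply: (Sig_ext _ _ (fun c : ctx 1 => k + 1 + 1 <n c.2 \/ exists A Pr,
      (forall i, i <n c.2 -> exists w, Pr = w * md i) /\
      (forall i, i <n c.2 -> exists v, V i v /\ beta A b' i v) /\
      forall j, j <n k + 1 + 1 -> j <n c.2 \/ exists u t, u * Pr = t * md j + 1)).
      move=> [[] l] /=; split=> -[H|[A [Pr H]]]; try (by left); right; exists A, Pr.
      - by case: H => ? [].
      - by case: H.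
    by rewrite /V /md; sig.
  - right; exists 0, 1; split=> [i /nlt0|i /nlt0|j _] //.
    by right; exists 1, 0; ring.
  - move=> l [H|[A [Pr [HPr HA Hinv]]]].
      by left; apply: nlt_trans H _; apply: nlt_S.
    have [lk|lk] := pselect (l <n k + 1 + 1); last first.
      by left; case: (nlt_total _ l (k + 1 + 1)) => // H; apply/nltS; [right|left].
    right; have [/nlt_irr //|[u [t Eu]]] := Hinv l lk.
    have [v Vv] := V_ex l lk.
    (* [u] inverts [Pr] modulo the [l]-th modulus, where [(l + 1) * b'] is -1; so [Pr * s] is
       congruent to [v - A], without subtraction. *)
    pose s := u * (v + (l + 1) * b' * A).
    exists (A + Pr * s), (Pr * md l); split.
    + move=> i /nltS[/HPr[w ->]|->]; last by exists Pr.
      by exists (w * md l); ring.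
    + move=> i /nltS[il|->].
      * have [x [Vx [Hx [q Eq]]]] := HA i il; have [w Ew] := HPr i il.
        exists x; split=> //; split=> //; exists (q + w * s).
        by rewrite {1}Eq Ew /md; ring.
      * exists v; split=> //; split; first exact/b'_large/(V_le l).
        exists (A + t * (v + (l + 1) * b' * A)).
        transitivity (A + (u * Pr) * (v + (l + 1) * b' * A)); first by rewrite /s; ring.
        by rewrite Eu /md; ring.
    + move=> j jk; have [jl|[u' [t' E']]] := Hinv j jk.
        by left; apply: nlt_trans jl _; apply: nlt_S.
      case: (nlt_total _ l j) => [lj|->|jl].
      * right; apply: inverse_mul; first by exists u', t'.
        have /nltE[i Ei] := lj.
        have [|w Ew] := Hy i.
          apply: nlt_trans jk; rewrite Ei; apply/nltE; exists l; ring.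
        have Eb : b' = (w * (a + c + 1)) * (i + 1) by rewrite /b' Ew; ring.
        rewrite /md Ei Eb; apply: modulus_inverse; by rewrite -Eb.
      * by left; apply: nlt_S.
      * by left; apply: nlt_trans jl _; apply: nlt_S.
exists A, b'; split.
- move=> i v ik Hv; have [|v' [[[_ Hv']|[Ei _]] H]] := HA i.
  + by apply/nltS; left; apply/nltS.
  + by rewrite (beta_uniq _ _ _ _ _ Hv Hv').
  + by move/nltS: ik; rewrite Ei => /nlt_irr.
- have [|v' [[[Ei _]|[_ Ev]] H]] := HA (k + 1); first exact: nlt_S.
  + by move/nltS: Ei => /nlt_irr.
  + by rewrite -Ev.
Qed.

Lemma pow2_0 : pow2 0 1.
Proof.
exists 1, 1; have B : beta 1 1 0 1.
  by split; [apply/nltE; exists 0; ring|exists 0; ring].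
by split=> //; split=> // i /nlt0.
Qed.

Lemma pow2_S k m : pow2 k m -> pow2 (k + 1) (m + m).
Proof.
move=> [a [b [H0 [Hk HS]]]]; have [a' [b' [Hi Hc]]] := beta_extend a b k (m + m).
exists a', b'; split; first by apply: Hi => //; apply/nleE; exists k; ring.
split=> // i /nltS[ik|->].
- have [x [Hx Hx']] := HS i ik; exists x; split; apply: Hi => //; first by left.
  exact/nS_le.
- by exists m; split=> //; apply: Hi => //; right.
Qed.

Lemma pow2_uniq k m m' : pow2 k m -> pow2 k m' -> m = m'.
Proof.
move=> [a [b [H0 [Hk HS]]]] [a' [b' [H0' [Hk' HS']]]].
have : forall i, k <n i \/ exists v, beta a b i v /\ beta a' b' i v.
  apply: Sigind.
  - by sig.
  - by right; exists 1.
  - move=> i [ki|[v [Hv Hv']]]; first by left; apply: nlt_trans ki _; apply: nlt_S.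
    have [ik|ik] := pselect (i <n k); last first.
      by left; case: (nlt_total _ k i) => // H; apply/nltS; [left|right].
    have [x [Hx Hx']] := HS i ik; have [y [Hy Hy']] := HS' i ik.
    right; exists (v + v); split.
    - by rewrite {1}(beta_uniq _ _ _ _ _ Hv Hx) (beta_uniq _ _ _ _ _ Hv Hx).
    - by rewrite {1}(beta_uniq _ _ _ _ _ Hv' Hy) (beta_uniq _ _ _ _ _ Hv' Hy).
move=> /(_ k)[/nlt_irr //|[v [Hv Hv']]].
by rewrite (beta_uniq _ _ _ _ _ Hk Hv) (beta_uniq _ _ _ _ _ Hk' Hv').
Qed.

Lemma Sig_pow2 : Sig (fun c : ctx 2 => pow2 c.1.2 c.2).
Proof. by rewrite /Sem.pow2; sig. Qed.

Lemma pow2_total k : exists m, pow2 k m.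
Proof.
move: k; apply: Sigind.
- apply: (Sig_ex _ _ (fun (c : ctx 1) m => pow2 c.2 m)); exact: Sig_pow2.
- by exists 1; apply: pow2_0.
- by move=> k [m Hm]; exists (m + m); apply: pow2_S.
Qed.

Definition two (k : N) : N := proj1_sig (cid (pow2_total k)).

Lemma twoP k m : pow2 k m <-> m = two k.
Proof.
rewrite /two; case: (cid _) => x /= Hx; split=> [H|->//].
exact: pow2_uniq H Hx.
Qed.

Lemma two0 : two 0 = 1.
Proof. by apply/esym/twoP; apply: pow2_0. Qed.

Lemma twoS k : two (k + 1) = two k + two k.
Proof. by apply/esym/twoP; apply: pow2_S; apply/twoP. Qed.

Lemma F1_two (n : nat) (f : ctx n -> N) : F1 f -> F1 (fun c => two (f c)).
Proof.
move=> Hf; apply: F1_lift1 => //; apply: Sig_ext Sig_pow2 => c; exact: twoP.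
Qed.

Ltac f1_user ::=
  lazymatch goal with
  | |- F1 (fun c => two (@?f c)) => apply (F1_two _ f); f1
  end.

Lemma twoD k j : two (k + j) = two k * two j.
Proof.
move: j; apply: Sigind.
- by sig.
- by rewrite addr0 two0 mulr1.
- by move=> j IH; rewrite addrA !twoS IH; ring.
Qed.

Lemma two_gt k : k <n two k.
Proof.
move: k; apply: Sigind.
- by sig.
- by rewrite two0 -[1]add0r; apply: nlt_S.
- move=> k /nltE[x E]; rewrite twoS {1}E; apply/nltE; exists (k + x + x).
  by rewrite E; ring.
Qed.

End Pow2.

Arguments two {M}.

Ltac f1_user ::=
  lazymatch goal with
  | |- F1 (fun c => two (@?f c)) => apply (F1_two _ _ f); f1
  end.

(** * The scale 2^-k *)

Definition eps {M : rca0} (k : N M) : frac M := ((two k)%:q)^-1.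

Section Eps.

Variable M : rca0.
Notation N := (N M).
Implicit Types (i j k m s t u v x y : N) (q r : frac M).

Lemma two1 : two (1 : N) = 1 + 1.
Proof. by have := twoS M 0; rewrite add0r two0. Qed.

Lemma two_q_gt0 k : 0 < (two k)%:q :> frac M.
Proof. by apply: le_lt_trans (nq_ge0 _ k) _; apply/nlt_q/two_gt. Qed.

Lemma two_eps k : (two k)%:q * eps k = 1 :> frac M.
Proof. by rewrite mulfV // gt_eqF // two_q_gt0. Qed.

Lemma eps_gt0 k : 0 < eps k.
Proof. by rewrite invr_gt0 two_q_gt0. Qed.

Lemma eps_0 : eps (0 : N) = 1.
Proof. by rewrite /eps two0 nq1 invr1. Qed.

Lemma epsD k j : eps (k + j) = eps k * eps j.
Proof. by rewrite /eps twoD nqM invfM. Qed.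

Lemma epsS k : eps k = 2 * eps (k + 1).
Proof.
have E1 : eps (1 : N) = 1 / 2 :> frac M.
  have := two_eps 1; rewrite two1 nqD nq1 => H; lra.
rewrite epsD E1; lra.
Qed.

Lemma eps_le1 k : eps k <= 1.
Proof.
have := two_eps k; have H := eps_gt0 k.
have : 1 <= (two k)%:q :> frac M.
  have /nltE[x ->] := two_gt _ k; rewrite !nqD nq1.
  have := nq_ge0 _ k; have := nq_ge0 _ x; lra.
nra.
Qed.

Lemma eps_le k j : k <=n j -> eps j <= eps k.
Proof.
move=> /nleE[i ->]; rewrite epsD; have := eps_le1 i; have := eps_gt0 k; nra.
Qed.

(** The Archimedean property: a positive [(p - n) / (d + 1)] is at least [1 / (d + 1)], which
    exceeds [eps (d + 1)]. *)
Lemma eps_small q : 0 < q -> exists k, eps k < q.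
Proof.
elim/frac_ind: q => p n d; rewrite fcls_q => H; exists (d + 1).
have d0 : 0 < (d + 1)%:q :> frac M.
  by rewrite -nq0; apply/nlt_q/nltE; exists d; rewrite add0r.
have {}H : (n%:q < p%:q :> frac M) by move: H; rewrite pmulr_lgt0 ?invr_gt0 // subr_gt0.
rewrite nqS_le in H.
apply: (@lt_le_trans _ _ ((d + 1)%:q)^-1).
  rewrite ltf_pV2 ?posrE ?two_q_gt0 //; apply/nlt_q; exact: two_gt.
apply: ler_peMl; [by rewrite invr_ge0 ltW|lra].
Qed.

Lemma q_lt_S x y : x%:q < y%:q + 1 :> frac M -> x%:q <= y%:q :> frac M.
Proof. by rewrite leNgt nqS_le => H; apply/negP => H'; lra. Qed.

Lemma FQ_eps n (f : ctx M n -> N) : F1 f -> FQ (fun c => eps (f c)).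
Proof. by move=> Hf; apply: FQ_inv; apply: F1_two. Qed.

Lemma FQ_fst n (f : ctx M n -> frac M) : FQ f -> FQ (fun c : ctx M n.+1 => f c.1).
Proof.
move=> [p [m [d [Hp Hm Hd E]]]].
exists (fun c => p c.1), (fun c => m c.1), (fun c => d c.1).
by split; [exact: F1_fst..|move=> c; rewrite E].
Qed.

Lemma FQ_lift1 n (f : N -> frac M) (g : ctx M n -> N) :
  FQ (fun c : ctx M 1 => f c.2) -> F1 g -> FQ (fun c => f (g c)).
Proof.
move=> [p [m [d [Hp Hm Hd E]]]] Hg.
have L (h : ctx M 1 -> N) : F1 h -> F1 (fun c : ctx M n => h (tt, g c)).
  move=> Hh; apply: (F1_lift1 _ _ g (fun x => h (tt, x)) Hg).
  by apply: Sig_ext Hh => -[[[] x] y].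
exists (fun c => p (tt, g c)), (fun c => m (tt, g c)), (fun c => d (tt, g c)).
by split; [exact: L..|move=> c; rewrite -E].
Qed.

End Eps.

Ltac fq_hyp :=
  match goal with
  | H : FQ _ |- _ =>
      first [exact H | exact (FQ_fst _ _ _ H)
            | exact (FQ_fst _ _ _ (FQ_fst _ _ _ H))
            | exact (FQ_fst _ _ _ (FQ_fst _ _ _ (FQ_fst _ _ _ H)))]
  | H : FQ (fun c : ctx _ 1 => ?f c.2) |- FQ (fun c => ?f (@?g c)) =>
      apply (FQ_lift1 _ _ f g H); f1
  end.

Ltac fq_user ::=
  lazymatch goal with
  | |- FQ (fun c => eps (@?s c)) => apply (FQ_eps _ _ s); f1
  | |- FQ _ => fq_hyp
  end.

(** * Strings and trees *)

Section Trees.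

Variable M : rca0.
Notation N := (N M).
Notation St := (St M).
Notation ctx := (ctx M).
Notation and_ := Logic.and.
Notation or_ := Logic.or.
Notation ex_ := (@Logic.ex _).
Notation len := (Sem.len M and_ or_ ex_).
Notation initseg := (Sem.initseg M and_ ex_).
Notation binary_tree := (Sem.binary_tree M and_ ex_).
Notation pair := (Sem.pair M).
Implicit Types (i j k m s t u v x y : N) (q r a : frac M) (T F : St).

Lemma lenE s k : len s k <-> two k <=n s /\ s <n two k + two k.
Proof.
split=> [[m [/twoP -> ]] //|H]; exists (two k); split=> //; exact/twoP.
Qed.

Lemma initsegE s t :
  initseg s t <-> 0 <n s /\ exists j v, v <n two j /\ t = s * two j + v.
Proof.
split=> -[s0]; split=> //.
- by move: b => [j [m [v [/twoP -> [vm ->]]]]]; exists j, v.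
- by move: b => [j [v [vm ->]]]; exists j, (two j), v; split=> //; apply/twoP.
Qed.

Lemma pair_inj i j i' j' : pair i j = pair i' j' -> i = i' /\ j = j'.
Proof.
rewrite /Sem.pair => E.
have L (x y x' y' : N) : (x + y) * (x + y) + x = (x' + y') * (x' + y') + x' ->
    ~ x + y <n x' + y'.
  move=> E' /nltE[u Eu]; case: (nlt_irr _ ((x' + y') * (x' + y') + x')).
  rewrite -{1}E' Eu; apply/nltE.
  by exists (x + y + y + (x + y) * u + (x + y) * u + u * u + u + u + x'); ring.
have Es : i + j = i' + j'.
  by case: (nlt_total _ (i + j) (i' + j')) => // H;
    [case: (L _ _ _ _ E)|case: (L _ _ _ _ (esym E))].
have Ei : i = i' by move: E; rewrite Es ![_ * _ + _]addrC => /naddI.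
by split=> //; move: Es; rewrite Ei ![i' + _]addrC => /naddI.
Qed.

Lemma n_div_two x k : exists u v, v <n two k /\ x = u * two k + v.
Proof.
have [|[m E]] := n_case _ (two k); last by rewrite E; apply: n_div.
by move=> E; have := two_gt _ k; rewrite E => /nlt0.
Qed.

Lemma nS_split x y : x <n y -> exists j, y = x + 1 + j.
Proof. by move=> /nS_le/nleE[j ->]; exists j. Qed.

Definition inT T k s : Prop := nmem s T /\ len s k.

Lemma len_pos s k : len s k -> 0 <n s.
Proof.
move=> /lenE[/nleE[u ->] _]; have /nltE[x ->] := two_gt _ k.
by apply/nltE; exists (k + x + u); ring.
Qed.

(** The equation says that [s] is [t] without its last [i] digits; dividing the bounds on [t] by
    [two i] gives the length of [s]. *)
Lemma inT_prefix T k i t s v : binary_tree T -> v <n two i ->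
  t = s * two i + v -> inT T (k + i) t -> inT T k s.
Proof.
move=> [_ closed] vi Et [tT /lenE[H1 H2]].
have E0 := two_q_gt0 M i; have Ek := two_q_gt0 M k.
move/nle_q: H1; move/nlt_q: H2; rewrite Et twoD !(nqD, nqM) => H2 H1.
have v0 := nq_ge0 _ v; move/nlt_q: vi => vi'.
have L : len s k.
  apply/lenE; split.
  - apply/nle_q; apply: q_lt_S; rewrite -(ltr_pM2r E0); nra.
  - by apply/nlt_q; rewrite nqD -(ltr_pM2r E0); nra.
split=> //; apply: (closed s t tT); apply/initsegE; split; first exact: len_pos L.
by exists i, v; split=> //; apply/nlt_q.
Qed.

(** Infinite means that codes are unbounded. A code above [two k] has length at least [k], the
    length being found by the least number principle, and its truncation to [k] digits is in the
    tree. *)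
Lemma inT_nonempty T k : binary_tree T -> Sem.infinite M and_ ex_ T -> exists s, inT T k s.
Proof.
move=> treeT infT; have [t [tT kt]] := infT (two k).
have [l [Hl minl]] : exists l, t <n two (l + 1) /\ forall y, y <n l -> ~ t <n two (y + 1).
  apply: D1_least; first by d1.
  exists t; apply: (nlt_trans _ _ _ _ (two_gt _ t)).
  by have /nltE[x E] := two_gt _ t; rewrite twoS; apply/nltE; exists (t + x); rewrite E; ring.
have lent : len t l.
  apply/lenE; rewrite -twoS; split=> //.
  case: (n_case _ l) => [->|[y E]].
    have /nltE[x Ex] := proj1 treeT t tT; rewrite two0; apply/nleE; exists x.
    by rewrite Ex; ring.
  have := minl y; rewrite -E => H; case: (nlt_total _ t (two l)) => // H'; last by left.
  - by case: H => //; rewrite E; apply: nlt_S.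
  - by right.
have [kl|kl] := pselect (k <=n l); last first.
  have lk : l + 1 <=n k by apply/nS_le; case: (nlt_total _ l k) => // H; case: kl; [right|left].
  have /nleE[i E] := lk; case: (nlt_irr _ t); apply: nlt_trans Hl _.
  move: kt; rewrite E twoD => /nlt_q kt; apply/nlt_q; apply: le_lt_trans kt.
  rewrite nqM ler_peMr ?nq_ge0 //.
  have /nltE[x ->] := two_gt _ i.
  by rewrite !nqD nq1; have := nq_ge0 _ i; have := nq_ge0 _ x; lra.
have /nleE[i E] := kl; have [s [v [vi Et]]] := n_div_two t i.
by exists s; apply: (inT_prefix T k i t s v) => //; rewrite -E.
Qed.

(** A cut [B u k], read [u / 2^k <= x + 1], selects at every level [k] the
    string [s] whose interval [[s/2^k - 1, (s+1)/2^k - 1]] contains [x]. *)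

Section PathOfCut.

Variables (T : St) (B : N -> N -> Prop) (k1 : N).
Hypotheses (treeT : binary_tree T) (dB : D1 (fun c : ctx 2 => B c.1.2 c.2))
  (B_mono : forall u v k, u <=n v -> B v k -> B u k)
  (B_scale : forall u k i, B u k <-> B (u * two i) (k + i))
  (B_zero : forall k, B 0 k) (B_bound : forall k, exists u, ~ B u k)
  (B_T : forall k s, k1 <=n k -> B s k -> ~ B (s + 1) k -> inT T k s).

Let str k s : Prop := B s k /\ ~ B (s + 1) k.

Let D1_B n (f g : ctx n -> N) : F1 f -> F1 g -> D1 (fun c => B (f c) (g c)).
Proof. by move=> Hf Hg; apply: D1_lift2. Qed.

Let str_uniq k s s' : str k s -> str k s' -> s = s'.
Proof.
move=> [H1 H2] [H1' H2']; case: (nlt_total _ s s') => // /nS_le H.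
- by case: H2; apply: B_mono H1'.
- by case: H2'; apply: B_mono H1.
Qed.

Let str_ex k : exists s, str k s.
Proof.
have [|u [nB min]] := D1_least _ (fun u => ~ B u k) _ (B_bound k).
  by apply: D1_not; apply: D1_B; f1.
case: (n_case _ u) => [E|[s E]]; first by case: nB; rewrite E.
exists s; split; last by rewrite -E.
by apply: contrapT; apply: min; rewrite E; apply: nlt_S.
Qed.

Let str_prefix k i t s v : str (k + i) t -> v <n two i -> t = s * two i + v -> str k s.
Proof.
move=> [H1 H2] vi Et; split.
- by apply/(B_scale s k i); apply: B_mono H1; apply/nleE; exists v.
- move=> /(B_scale _ k i) H; apply: H2; apply: B_mono H.
  have /nltE[x E] := vi; apply/nleE; exists x.
  by rewrite Et mulrDl mul1r [X in _ + X = _]E; ring.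
Qed.

(** The cut is invariant under refining the scale, so the selected strings extend each other; the
    digits [f (i + 1) - 2 f i] form a Delta1 set. *)
Lemma path_of_cut : exists F, Sem.path M and_ or_ ex_ F T.
Proof.
have [f' Hf' Hfs] : exists2 f : ctx 1 -> N, F1 f & forall c, str c.2 (f c).
  apply: (F1_unique M 1 (fun (c : ctx 1) s => str c.2 s)).
  - rewrite /str; apply: D1_Sig; apply: D1_and; [|apply: D1_not]; apply: D1_B; f1.
  - by move=> c; apply: str_ex.
  - by move=> c; apply: str_uniq.
pose f k := f' (tt, k).
have fs k : str k (f k) := Hfs (tt, k).
have Hf n (g : ctx n -> N) : F1 g -> F1 (fun c => f (g c)).
  move=> Hg; apply: (F1_lift1 _ _ g f Hg).
  by apply: Sig_ext Hf' => -[[[] x] y].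
have fD k i : exists v, v <n two i /\ f (k + i) = f k * two i + v.
  have [s [v [vi E]]] := n_div_two (f (k + i)) i; exists v; split=> //.
  by rewrite {1}E (str_uniq _ _ _ (fs k) (str_prefix _ _ _ _ _ (fs (k + i)) vi E)).
(* [B_T] speaks only of levels from [k1] on; level [k] is reached as a prefix of level [k + k1]. *)
have fT k : inT T k (f k).
  have [v [vi E]] := fD k k1; apply: (inT_prefix _ _ _ _ _ _ treeT vi E).
  have [H1 H2] := fs (k + k1); apply: B_T => //; apply/nleE; exists k; ring.
have fS i : exists b, b <n 1 + 1 /\ f (i + 1) = f i + f i + b.
  have [b [b2 E]] := fD i 1; rewrite two1 in b2 E.
  by exists b; split=> //; rewrite E; ring.
have [F HF] : exists F, forall z, nmem z F <-> exists i, i <n z + 1 /\ exists b, b <n 1 + 1 /\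
    (z = pair i b /\ f (i + 1) = f i + f i + b).
  apply: D1_comprehension; by rewrite /Sem.pair; d1.
have HFp i b : nmem (pair i b) F <-> b <n 1 + 1 /\ f (i + 1) = f i + f i + b.
  rewrite HF; split=> [[i' [_ [b' [H [/pair_inj[-> ->] E]]]]]|[H1 H2]]; first by split.
  exists i; split; last by exists b.
  by rewrite /Sem.pair; apply/nltE; exists ((i + b) * (i + b)); ring.
exists F; split; first split.
- by move=> z /HF[i [_ [b [b2 [E _]]]]]; exists i, b.
- split=> [i|i b b' /HFp[_ E] /HFp[_ E']].
  + by have [b H] := fS i; exists b; apply/HFp.
  + by move: E'; rewrite E ![f i + f i + _]addrC => /naddI.
move=> k; exists (f k); have [fkT fkl] := fT k; split=> //; split=> // i b ik /HFp[b2 E].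
have [_ lfi] := fT i; exists (f i); split=> //; rewrite -E; apply/initsegE; split.
  by have [_ /len_pos] := fT (i + 1).
have [j ->] := nS_split _ _ ik; have [v [vj Ev]] := fD (i + 1) j.
by exists j, v.
Qed.

End PathOfCut.

End Trees.

(** * A path from a point lying near every level of the tree *)

Definition lo {M : rca0} (s k : N M) : frac M := s%:q * eps k - 1.
Definition hi {M : rca0} (s k : N M) : frac M := (s%:q + 1) * eps k - 1.

Definition cauchy {M : rca0} (f : N M -> frac M) : Prop :=
  forall k i, f k - f (k + i) <= eps k /\ f (k + i) - f k <= eps k.

Section PathOfNear.

Variable M : rca0.
Notation N := (N M).
Notation St := (St M).
Notation ctx := (ctx M).
Notation and_ := Logic.and.
Notation or_ := Logic.or.
Notation ex_ := (@Logic.ex _).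
Notation binary_tree := (Sem.binary_tree M and_ ex_).
Implicit Types (i j k m s t u v x y : N) (q r a : frac M) (T F : St).

Lemma cauchy_lt f m n : cauchy f -> f m - f n < eps m + eps n.
Proof.
move=> Cf; have := eps_gt0 M m; have := eps_gt0 M n.
case: (nle_total _ m n) => /nleE[i ->] => H1 H2.
- by have [] := Cf m i; lra.
- by have [] := Cf n i; lra.
Qed.

Lemma scale_eps u k i : (u * two i)%:q * eps (k + i) = u%:q * eps k.
Proof.
rewrite nqM epsD -mulrA [eps k * eps i]mulrC [(two i)%:q * _]mulrA two_eps mul1r.
by [].
Qed.

Lemma eps_small2 q k : 0 < q -> exists n, k <=n n /\ eps n < q.
Proof.
move=> /eps_small[i Hi]; exists (k + i); split; first by apply/nleE; exists i.
by apply: le_lt_trans Hi; apply: eps_le; apply/nleE; exists k; ring.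
Qed.

Lemma eps_mul_le u v k : u%:q * eps k <= v%:q * eps k -> u <=n v.
Proof. by rewrite (ler_pM2r (eps_gt0 M k)) => /nle_q. Qed.

Lemma eps_mul_lt u v k : u%:q * eps k < (v%:q + 1) * eps k -> u <=n v.
Proof. by rewrite (ltr_pM2r (eps_gt0 M k)) => /q_lt_S/nle_q. Qed.

Variables (T : St) (f : N -> frac M).
(** [near] is how a vanishing gauge enters: its terms are at most [8 * eps n], with [n] the stage
    they are computed from, and the distance is at most twice that. For [n] at least [k + 4],
    [16 * eps n] is at most [eps k], so the truncation at [eps k] is inactive. *)
Hypotheses (treeT : binary_tree T) (Hf : FQ (fun c : ctx 1 => f c.2))
  (Cf : cauchy f) (f_ge0 : forall k, - (2 * eps k) <= f k)
  (f_le1 : forall k, f k <= 1 + 2 * eps k)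
  (near : forall k n, k + (1 + 1 + 1 + 1) <=n n -> exists s, inT M T k s /\
     lo s k - 16 * eps n <= f n <= hi s k + 16 * eps n).

Lemma f_gtm1 : exists m, -1 < f m - eps m.
Proof.
(* At index 2 the total error is [3 * eps 2], which is below 1. *)
exists (1 + 1); have := f_ge0 (1 + 1); have := eps_0 M.
have := epsS M 0; have := epsS M (0 + 1); rewrite add0r; lra.
Qed.

Lemma f_lt3 : exists m, f m + eps m < 3.
Proof.
exists 1; have := f_le1 1; have := eps_0 M.
have := epsS M 0; rewrite add0r; lra.
Qed.

(** The hypothesis separates the point from every dyadic number, so both the cut and its complement
    are witnessed at some index of the sequence; hence the cut is Delta1. *)
Lemma path_nondyadic :
  (forall u k, exists m, eps m < f m - (u%:q * eps k - 1) \/ f m - (u%:q * eps k - 1) < - eps m) ->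
  exists F, Sem.path M and_ or_ ex_ F T.
Proof.
move=> nd; pose B u k := exists m, u%:q * eps k - 1 < f m - eps m.
have nB u k : ~ B u k <-> exists m, f m + eps m < u%:q * eps k - 1.
  split=> [H|[m Hm] [n Hn]].
  - have [m [Hm|Hm]] := nd u k; last by exists m; lra.
    by case: H; exists m; lra.
  - by have := cauchy_lt _ n m Cf; lra.
apply: (path_of_cut M T B 0 treeT).
- split; first by rewrite /B; sig.
  by apply: (Sig_ext _ _ (fun c : ctx 2 => exists m, f m + eps m < c.1.2%:q * eps c.2 - 1));
    [move=> c; rewrite nB|sig].
- move=> u v k /nle_q uv [m Hm]; exists m; apply: le_lt_trans Hm.
  by rewrite lerD2r ler_pM2r // eps_gt0.
- by move=> u k i; rewrite /B scale_eps.
- by move=> k; have [m Hm] := f_gtm1; exists m; rewrite nq0 mul0r sub0r.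
(* At level [k] the number [4 * 2^k] marks the point 3. *)
- move=> k; exists ((1 + 1 + 1 + 1) * two k); apply/nB; have [m Hm] := f_lt3; exists m.
  by rewrite nqM -mulrA two_eps mulr1 !nqD nq1; lra.
- move=> k s _ [m Hm] /nB[m' Hm'].
  (* The point lies inside the interval of [s] with margin [g]. Taking [17 * eps n < g] covers the
     [16 * eps n] of [near] and the [eps n] of the approximation, so the nearby string must be
     [s]. *)
  pose g := Num.min (f m - eps m - lo s k) (hi s k - (f m' + eps m')).
  have g0 : 0 < g / 17.
    rewrite divr_gt0 // lt_min /lo /hi !subr_gt0 Hm /=.
    by move: Hm'; rewrite nqD nq1.
  have [n [Hn1 Hn2]] := eps_small2 _ (k + (1 + 1 + 1 + 1) + m + m') g0.
  have Hg1 : g <= f m - eps m - lo s k by rewrite ge_min lexx.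
  have Hg2 : g <= hi s k - (f m' + eps m') by rewrite ge_min lexx orbT.
  have [|s' [Hs' /andP[L1 L2]]] := near k n.
    by have /nleE[i ->] := Hn1; apply/nleE; exists (m + m' + i); ring.
  have F1m : f m - eps m <= f n + eps n.
    by have := cauchy_lt _ m n Cf; lra.
  have F2m : f n - eps n <= f m' + eps m'.
    by have := cauchy_lt _ n m' Cf; lra.
  suff -> : s = s' by [].
  have en := eps_gt0 M n.
  apply: nle_anti.
  + by apply: (eps_mul_lt _ _ k); rewrite /lo /hi in Hg1 Hg2 L1 L2 *; lra.
  + by apply: (eps_mul_lt _ _ k); rewrite /lo /hi in Hg1 Hg2 L1 L2 *; lra.
Qed.

(** From level [k0] on, only the two strings adjacent to the point can be near it: [j * two i] on
    its right and the predecessor on its left. If all right ones are in the tree, the non-strict cut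
    follows them. If one fails, prefix closure excludes the right ones from then on, and the strict
    cut follows the left ones. The point is rational, so both cuts are decidable. *)
Lemma path_dyadic j k0 :
  (forall m, - eps m <= f m - (j%:q * eps k0 - 1) <= eps m) ->
  exists F, Sem.path M and_ or_ ex_ F T.
Proof.
(* [x] is the point shifted by 1, the scale on which cuts are read. *)
move=> dy; pose x := j%:q * eps k0.
have x0 : 0 < x.
  have [m Hm] := f_gtm1; have /andP[H1 H2] := dy m; rewrite /x; lra.
have xj : x <= j%:q.
  by rewrite /x; have := eps_le1 M k0; have := nq_ge0 _ j; nra.
have near' i : inT M T (k0 + i) (j * two i) \/
    exists2 s, inT M T (k0 + i) s & s + 1 = j * two i.
  (* The errors [16 * eps n] of [near] and [eps n] of [dy] together stay below one interval
     length. *)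
  have e0 : 0 < eps (k0 + i) / 17 by rewrite divr_gt0 // eps_gt0.
  have [n [Hn1 Hn2]] := eps_small2 _ (k0 + i + (1 + 1 + 1 + 1)) e0.
  have [s [Hs /andP[L1 L2]]] := near _ _ Hn1.
  have /andP[D1 D2] := dy n; have E := scale_eps j k0 i.
  have H1 : s <=n j * two i.
    apply: (eps_mul_lt _ _ (k0 + i)); rewrite mulrDl mul1r E.
    by rewrite /lo /hi in L1 L2; lra.
  have H2 : j * two i <=n s + 1.
    apply: (eps_mul_lt _ _ (k0 + i)); rewrite E nqD nq1.
    by rewrite /lo /hi in L1 L2; lra.
  case: H1 => [/nS_le H1|<-]; last by left.
  by right; exists s => //; apply: nle_anti.
have [all0|/existsNP[i0 Hi0]] := pselect (forall i, inT M T (k0 + i) (j * two i)).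
- pose B u k := u%:q * eps k <= x.
  apply: (path_of_cut M T B k0 treeT).
  + by rewrite /B; d1.
  + move=> u v k /nle_q uv; rewrite /B; apply: le_trans.
    by rewrite ler_pM2r // eps_gt0.
  + by move=> u k i; rewrite /B scale_eps.
  + by move=> k; rewrite /B nq0 mul0r ltW.
  + move=> k; exists (j * two k + 1); rewrite /B; apply/negP; rewrite -ltNge.
    rewrite nqD nq1 mulrDl mul1r nqM -mulrA two_eps mulr1.
    by have := eps_gt0 M k; lra.
  + move=> k s /nleE[i ->]; rewrite /B nqD nq1 => H1 /negP; rewrite -ltNge => H2.
    suff -> : s = j * two i by [].
    have E := scale_eps j k0 i; apply: nle_anti.
    * by apply: (eps_mul_le _ _ (k0 + i)); rewrite E.
    * by apply: (eps_mul_lt _ _ (k0 + i)); rewrite E.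
- pose B u k := u%:q * eps k < x.
  apply: (path_of_cut M T B (k0 + i0) treeT).
  + by rewrite /B; d1.
  + move=> u v k /nle_q uv; rewrite /B; apply: le_lt_trans.
    by rewrite ler_pM2r // eps_gt0.
  + by move=> u k i; rewrite /B scale_eps.
  + by move=> k; rewrite /B nq0 mul0r.
  + move=> k; exists (j * two k); rewrite /B; apply/negP; rewrite -leNgt.
    by rewrite nqM -mulrA two_eps mulr1.
  + move=> k s /nleE[i ->]; rewrite /B nqD nq1 => H1 /negP; rewrite -leNgt => H2.
    rewrite -addrA in H1 H2 *; have [H|[s' Hs' Es']] := near' (i0 + i).
      case: Hi0; apply: (inT_prefix M T _ i (j * two (i0 + i)) _ 0 treeT).
      * by apply/nlt_q; rewrite nq0; apply: two_q_gt0.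
      * by rewrite twoD addr0; ring.
      * by rewrite -addrA.
    suff -> : s = s' by [].
    have E := scale_eps j k0 (i0 + i); rewrite -Es' nqD nq1 -/x in E.
    apply: nle_anti.
    * by apply: (eps_mul_lt _ _ (k0 + (i0 + i))); rewrite E.
    * apply: (eps_mul_le _ _ (k0 + (i0 + i))).
      by have := eps_gt0 M (k0 + (i0 + i)); lra.
Qed.

Lemma path_of_near : exists F, Sem.path M and_ or_ ex_ F T.
Proof.
have [[u [k H]]|H] := pselect (exists u k, forall m,
    - eps m <= f m - (u%:q * eps k - 1) <= eps m); first exact: path_dyadic H.
apply: path_nondyadic => u k; apply: contrapT => H'; apply: H; exists u, k => m.
rewrite !leNgt; apply/andP; split; apply/negP => Hm; apply: H'; exists m; by [right|left].
Qed.

End PathOfNear.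

(** * Coded rationals and reals *)

Section Codes.

Variable M : rca0.
Notation N := (N M).
Notation ctx := (ctx M).
Notation and_ := Logic.and.
Notation or_ := Logic.or.
Notation ex_ := (@Logic.ex _).
Notation pair := (Sem.pair M).
Notation rat := (Sem.rat M).
Notation Rat := (Sem.Rat M).
Notation rpos := (Sem.rpos M).
Notation rneg := (Sem.rneg M).
Notation rden := (Sem.rden M).
Notation code := (Sem.code M).
Notation rexp := (Sem.rexp M).
Notation cls := (Sem.cls M).
Notation real := (Sem.real M and_ or_ ex_).
Notation val := (Sem.val M and_ ex_).
Notation ele := (Sem.ele M and_ or_ ex_).
Notation rle := (Sem.rle M or_).
Notation rlt := (Sem.rlt M).
Implicit Types (i j k m u v w y z : N) (q r e : rat) (x : cls).

(* On numbers that are not pairs both projections take the value [0]. *)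
Lemma unpair_ex z : exists ij : N * N, (exists i j, z = pair i j /\ ij = (i, j)) \/
  ((forall i j, z <> pair i j) /\ ij = (0, 0)).
Proof.
have [[i [j E]]|H] := pselect (exists i j, z = pair i j).
- by exists (i, j); left; exists i, j.
- by exists (0, 0); right; split=> // i j E; apply: H; exists i, j.
Qed.

Definition unpair z : N * N := proj1_sig (cid (unpair_ex z)).
Definition p1 z : N := (unpair z).1.
Definition p2 z : N := (unpair z).2.

Lemma unpairE i j : unpair (pair i j) = (i, j).
Proof.
rewrite /unpair; case: (cid _) => ij /= [[i' [j' [/pair_inj[-> ->] ->]]] //|[H _]].
by case: (H i j).
Qed.

Lemma p1E i j : p1 (pair i j) = i. Proof. by rewrite /p1 unpairE. Qed.
Lemma p2E i j : p2 (pair i j) = j. Proof. by rewrite /p2 unpairE. Qed.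

Lemma pair_boundl i j : i <n pair i j + 1.
Proof. by apply/nltE; exists ((i + j) * (i + j)); rewrite /Sem.pair; ring. Qed.

Lemma pair_boundr i j : j <n pair i j + 1.
Proof.
case: (n_case _ j) => [->|[u ->]].
  by apply/nltE; exists (pair i 0); rewrite /Sem.pair; ring.
apply/nltE; exists (i + i * i + i * (u + 1) + i * (u + 1) + u * (u + 1)).
by rewrite /Sem.pair; ring.
Qed.

(** The components of a pair do not exceed it, so being no pair is a bounded statement and the graph
    of [unpair] is Delta0. *)
Lemma unpair_graph i j z : (i, j) = unpair z <-> z = pair i j \/
  (i = 0 /\ j = 0 /\ forall i, i <n z + 1 -> forall j, j <n z + 1 -> z <> pair i j).
Proof.
split=> [|[->|[-> [-> H]]]]; last 2 first.
- by rewrite unpairE.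
- rewrite /unpair; case: (cid _) => ij /= [[i' [j' [E ->]]]|[_ ->] //].
  by case: (H i' _ j') => //; rewrite E; [apply: pair_boundl|apply: pair_boundr].
- rewrite /unpair; case: (cid _) => ij /= [[i' [j' [E ->]]]|[H ->]] [-> ->].
  + by left.
  + by right; split=> //; split=> // i' _ j' _; apply: H.
Qed.

Lemma F1_p1 (n : nat) (f : ctx n -> N) : F1 f -> F1 (fun c => p1 (f c)).
Proof.
move=> Hf; apply: (F1_lift1 _ _ f p1 Hf).
apply: (Sig_ext _ _ (fun c : ctx 2 => exists y, c.1.2 = pair c.2 y \/ (c.2 = 0 /\ y = 0 /\
    forall i, i <n c.1.2 + 1 -> forall j, j <n c.1.2 + 1 -> c.1.2 <> pair i j))).
  move=> c; rewrite /p1; split=> [[y /unpair_graph <-] //|E].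
  by exists (unpair c.1.2).2; apply/unpair_graph; rewrite E; case: (unpair _).
by rewrite /Sem.pair; sig.
Qed.

Lemma F1_p2 (n : nat) (f : ctx n -> N) : F1 f -> F1 (fun c => p2 (f c)).
Proof.
move=> Hf; apply: (F1_lift1 _ _ f p2 Hf).
apply: (Sig_ext _ _ (fun c : ctx 2 => exists y, c.1.2 = pair y c.2 \/ (y = 0 /\ c.2 = 0 /\
    forall i, i <n c.1.2 + 1 -> forall j, j <n c.1.2 + 1 -> c.1.2 <> pair i j))).
  move=> c; rewrite /p2; split=> [[y /unpair_graph <-] //|E].
  by exists (unpair c.1.2).1; apply/unpair_graph; rewrite E; case: (unpair _).
by rewrite /Sem.pair; sig.
Qed.

Definition qv r : frac M := ((rpos r)%:q - (rneg r)%:q) / (rden r)%:q.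
Definition pd r : Prop := 0 <n rden r.

Definition rat_of z : rat := Rat (p1 (p1 z)) (p2 (p1 z)) (p2 z).
Definition is_code z : Prop := z = code (rat_of z) /\ 0 <n p2 z.
Definition qc z : frac M := qv (rat_of z).

Lemma rat_of_code r : rat_of (code r) = r.
Proof. by case: r => p n d; rewrite /rat_of /Sem.code /= !p1E !p2E. Qed.

Lemma qc_code r : qc (code r) = qv r.
Proof. by rewrite /qc rat_of_code. Qed.

Lemma is_code_code r : pd r -> is_code (code r).
Proof.
move=> Hr; split; first by rewrite rat_of_code.
by move: Hr; rewrite -{1}(rat_of_code r).
Qed.

Lemma pd_S p n (d : N) : pd (Rat p n (d + 1)).
Proof. by apply/nltE; exists d; rewrite /=; ring. Qed.

Lemma pd_ex r : pd r -> exists p n d, r = Rat p n (d + 1).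
Proof.
case: r => p n d /nltE[u /= E]; exists p, n, u; rewrite E; congr Sem.Rat; ring.
Qed.

Lemma pd_q r : pd r -> 0 < (rden r)%:q :> frac M.
Proof. by move/nlt_q; rewrite nq0. Qed.

Lemma pd_add q r : pd q -> pd r -> pd (Sem.radd M q r).
Proof. by move=> /pd_q Hq /pd_q Hr; apply/nlt_q; rewrite nq0 nqM mulr_gt0. Qed.

Lemma pd_sub q r : pd q -> pd r -> pd (Sem.rsub M q r).
Proof. by move=> Hq Hr; apply: pd_add. Qed.

Lemma qv_add q r : pd q -> pd r -> qv (Sem.radd M q r) = qv q + qv r.
Proof.
move=> /pd_q Hq /pd_q Hr; rewrite /qv /= !(nqD, nqM); field.
by rewrite !gt_eqF.
Qed.

Lemma qv_sub q r : pd q -> pd r -> qv (Sem.rsub M q r) = qv q - qv r.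
Proof.
move=> Hq Hr; rewrite /Sem.rsub qv_add //; congr (_ + _).
by rewrite /qv /= -mulNr opprB.
Qed.

Lemma rlt_qv q r : pd q -> pd r -> (rlt q r <-> qv q < qv r).
Proof.
move=> /pd_q Hq /pd_q Hr; rewrite /qv ltr_pdivrMr // mulrAC ltr_pdivlMr //.
by rewrite /Sem.rlt nlt_q !(nqD, nqM); split=> H; lra.
Qed.

Lemma rle_qv q r : pd q -> pd r -> (rle q r <-> qv q <= qv r).
Proof.
move=> /pd_q Hq /pd_q Hr; rewrite /qv ler_pdivrMr // mulrAC ler_pdivlMr //.
by rewrite [rle q r]nle_q !(nqD, nqM); split=> H; lra.
Qed.

Lemma rdist_le_qv q r e : pd q -> pd r -> pd e ->
  (Sem.rdist_le M and_ or_ q r e <-> qv q - qv r <= qv e /\ qv r - qv q <= qv e).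
Proof.
move=> Hq Hr He; rewrite -(qv_sub q r) // -(qv_sub r q) // -!rle_qv //; exact: pd_sub.
Qed.

Lemma rdist_lt_qv q r e : pd q -> pd r -> pd e ->
  (Sem.rdist_lt M and_ q r e <-> qv q - qv r < qv e /\ qv r - qv q < qv e).
Proof.
move=> Hq Hr He; rewrite -(qv_sub q r) // -(qv_sub r q) // -!rlt_qv //; exact: pd_sub.
Qed.

Lemma qv_rat0 : qv (Sem.rat0 M) = 0.
Proof. by rewrite /qv /= subrr mul0r. Qed.
Lemma pd_rat0 : pd (Sem.rat0 M).
Proof. by apply/nltE; exists 0; rewrite /= !add0r. Qed.
Lemma qv_rat1 : qv (Sem.rat1 M) = 1.
Proof. by rewrite /qv /= nq0 nq1 subr0 divr1. Qed.
Lemma pd_rat1 : pd (Sem.rat1 M).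
Proof. exact: pd_rat0. Qed.
Lemma qv_eps k : qv (Rat 1 0 (two k)) = eps k.
Proof. by rewrite /qv /= nq0 nq1 subr0 div1r. Qed.
Lemma qv_2eps k : qv (Rat (1 + 1) 0 (two k)) = 2 * eps k.
Proof. by rewrite /qv /= nq0 nqD nq1 subr0. Qed.
Lemma pd_two p n k : pd (Rat p n (two k)).
Proof. by apply/nlt_q; rewrite nq0 two_q_gt0. Qed.

Lemma exQ_code (K : rat -> Prop) :
  Sem.exQ M ex_ K <-> exists r, pd r /\ K r.
Proof.
split=> [[p [n [d H]]]|[r [/pd_ex[p [n [d ->]]] H]]]; last by exists p, n, d.
by exists (Rat p n (d + 1)); split=> //; apply: pd_S.
Qed.

Lemma allQ_code (K : rat -> Prop) :
  Sem.allQ M K <-> forall r, pd r -> K r.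
Proof.
split=> [H r /pd_ex[p [n [d ->]]]|H p n d]; first exact: H.
by apply: H; apply: pd_S.
Qed.

(** A real seen from the metatheory. Its terms stay codes rather than fractions, since uniqueness in
    [real] concerns codes and the graph of [f] must be definable from [x]. *)
Definition code_seq x (f : N -> N) : Prop :=
  [/\ forall z, x z <-> exists k, z = pair k (f k),
      forall k, is_code (f k) & cauchy (fun k => qc (f k))].

Lemma pd_rat_of z : is_code z -> pd (rat_of z).
Proof. by case. Qed.

Lemma code_seq_mem x f k z : code_seq x f -> x (pair k z) <-> z = f k.
Proof.
move=> [Hx _ _]; rewrite Hx; split=> [[k' /pair_inj[-> ->]] //|->]; by exists k.
Qed.

Lemma val_code_seq x f k (K : rat -> Prop) : code_seq x f -> val x k K <-> K (rat_of (f k)).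
Proof.
move=> Hx; have [_ Hc _] := Hx; rewrite /Sem.val exQ_code; split=> [[r [_ []]]|H].
- by rewrite (code_seq_mem _ _ _ _ Hx) => <-; rewrite rat_of_code.
- exists (rat_of (f k)); split; first exact: pd_rat_of.
  by split=> //; rewrite (code_seq_mem _ _ _ _ Hx); case: (Hc k).
Qed.

Lemma realP x : real x <-> exists f, code_seq x f.
Proof.
split=> [[H1 [H2 [H3 H4]]]|[f Hf]].
- have ex k : exists z, x (pair k z) /\ is_code z.
    have /exQ_code[r [Hr Hx]] := H2 k; exists (code r); split=> //.
    exact: is_code_code.
  pose f k := proj1_sig (cid (ex k)).
  have [Hfx Hfc] : (forall k, x (pair k (f k))) /\ (forall k, is_code (f k)).
    by split=> k; rewrite /f; case: (cid _) => z [].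
  have Hf k r : pd r -> x (pair k (code r)) -> code r = f k.
    move=> Hr Hx; have [E Hd] := Hfc k; rewrite E.
    have /allQ_code/(_ r Hr)/allQ_code/(_ _ (pd_rat_of _ (Hfc k))) := H3 k.
    by apply=> //; rewrite -E.
  have Hseq z : x z <-> exists k, z = pair k (f k).
    split=> [Hz|[k ->] //]; have [k /exQ_code[r [Hr E]]] := H1 z Hz.
    by exists k; rewrite E; congr Sem.pair; apply: Hf; rewrite // -E.
  have Hv k (K : rat -> Prop) : val x k K -> K (rat_of (f k)).
    by move=> /exQ_code[r [Hr [Hx HK]]]; rewrite -(Hf k r) // rat_of_code.
  exists f; split=> // k i; have [m [/twoP -> /Hv/Hv]] := H4 k i.
  by rewrite rdist_le_qv ?qv_eps //; (apply: pd_two || apply: pd_rat_of).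
- have [H1 H2 H3] := Hf; split; [|split; [|split]].
  + move=> z /H1[k ->]; exists k; apply/exQ_code; exists (rat_of (f k)).
    by split; [apply: pd_rat_of|congr Sem.pair; case: (H2 k)].
  + move=> k; apply/exQ_code; exists (rat_of (f k)); split; first exact: pd_rat_of.
    by rewrite (code_seq_mem _ _ _ _ Hf); case: (H2 k).
  + move=> k; apply/allQ_code => q Hq; apply/allQ_code => r Hr.
    by rewrite !(code_seq_mem _ _ _ _ Hf) => -> ->.
  + move=> k i; exists (two k); split; first exact/twoP.
    rewrite (val_code_seq _ _ _ _ Hf) (val_code_seq _ _ _ _ Hf).
    rewrite rdist_le_qv ?qv_eps //; first exact: H3.
    all: by [exact: pd_rat_of | exact: pd_two].
Qed.

(** Real expressions are in continuation style; [g] is the sequence of field values behind one, and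
    reduces comparisons to inequalities between fractions. *)
Definition repr (x : rexp) (g : N -> frac M) : Prop :=
  exists r : N -> rat, [/\ forall k, pd (r k), forall k K, x k K <-> K (r k) &
    forall k, g k = qv (r k)].

Lemma repr_val x f : code_seq x f -> repr (val x) (fun k => qc (f k)).
Proof.
move=> Hf; exists (fun k => rat_of (f k)); split=> // k.
- by have [_ H _] := Hf; apply: pd_rat_of.
- by move=> K; apply: val_code_seq.
Qed.

Lemma repr_const r : pd r -> repr (Sem.const M r) (fun _ => qv r).
Proof. by move=> Hr; exists (fun _ => r). Qed.

Lemma repr_add (x y : rexp) f g : repr x f -> repr y g ->
  repr (Sem.eadd M x y) (fun k => f (k + 1) + g (k + 1)).
Proof.
move=> [r [Hr Kr Er]] [s [Hs Ks Es]]; exists (fun k => Sem.radd M (r (k + 1)) (s (k + 1))).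
split=> [k|k K|k]; first exact: pd_add.
- by rewrite /Sem.eadd Kr Ks.
- by rewrite qv_add // -Er -Es.
Qed.

Lemma repr_sub (x y : rexp) f g : repr x f -> repr y g ->
  repr (Sem.esub M x y) (fun k => f (k + 1) - g (k + 1)).
Proof.
move=> [r [Hr Kr Er]] [s [Hs Ks Es]]; exists (fun k => Sem.rsub M (r (k + 1)) (s (k + 1))).
split=> [k|k K|k]; first exact: pd_sub.
- by rewrite /Sem.esub Kr Ks.
- by rewrite qv_sub // -Er -Es.
Qed.

Lemma eleE (x y : rexp) f g : repr x f -> repr y g ->
  (ele x y <-> forall k, f k <= g k + 2 * eps k).
Proof.
move=> [r [Hr Kr Er]] [s [Hs Ks Es]].
have E k : rle (r k) (Sem.radd M (s k) (Rat (1 + 1) 0 (two k))) <-> f k <= g k + 2 * eps k.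
  have Hp := pd_two (1 + 1) 0 k.
  by rewrite rle_qv ?qv_add ?qv_2eps -?Er -?Es //; apply: pd_add.
split=> H k; have := H k.
- by move=> [m [/twoP ->]]; rewrite Kr Ks E.
- by rewrite -E => H'; exists (two k); split; [exact/twoP|rewrite Kr Ks].
Qed.

Lemma eltE (x y : rexp) f g : repr x f -> repr y g ->
  (Sem.elt M and_ or_ ex_ x y <-> exists k, f k + 2 * eps k < g k).
Proof.
move=> Hx Hy; rewrite /Sem.elt (eleE _ _ _ _ Hy Hx); split=> [/existsNP[k /negP]|[k H] H'].
- by rewrite -ltNge; exists k.
- by have := H' k; rewrite leNgt H.
Qed.

Lemma F1_code_seq x f : D1 (fun c : ctx 1 => x c.2) -> code_seq x f ->
  forall (n : nat) (g : ctx n -> N), F1 g -> F1 (fun c => f (g c)).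
Proof.
move=> Hx Hf n g Hg; apply: (F1_lift1 _ _ g f Hg).
apply: (Sig_ext _ _ (fun c : ctx 2 => x (pair c.1.2 c.2))).
  by move=> c; rewrite (code_seq_mem _ _ _ _ Hf).
apply: (Sig_lift1 _ _ (fun c : ctx 2 => pair c.1.2 c.2) x); last by case: Hx.
by rewrite /Sem.pair; f1.
Qed.

Lemma FQ_qc (n : nat) (f : ctx n -> N) : F1 f -> FQ (fun c => qc (f c)).
Proof.
move=> Hf; have H1 := F1_p1 _ _ Hf; rewrite /qc /qv /rat_of /=.
have H2 := F1_p1 _ _ H1; have H3 := F1_p2 _ _ H1; have H4 := F1_p2 _ _ Hf.
apply: FQ_mul; last exact: FQ_inv.
by apply: FQ_add; [|apply: FQ_opp]; apply: FQ_nq.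
Qed.

End Codes.

Arguments p1 {M}.
Arguments p2 {M}.
Arguments qc {M}.
Arguments qv {M}.
Arguments pd {M}.

Ltac f1_user ::=
  lazymatch goal with
  | |- F1 (fun c => two (@?f c)) => apply (F1_two _ _ f); f1
  | |- F1 (fun c => p1 (@?f c)) => apply (F1_p1 _ _ f); f1
  | |- F1 (fun c => p2 (@?f c)) => apply (F1_p2 _ _ f); f1
  end.

Ltac fq_user ::=
  lazymatch goal with
  | |- FQ (fun c => eps (@?s c)) => apply (FQ_eps _ _ s); f1
  | |- FQ (fun c => qc (@?s c)) => apply (FQ_qc _ _ s); f1
  | |- FQ _ => fq_hyp
  end.

(** * The gauge of a tree *)

Section Gauge.

Variable M : rca0.
Notation N := (N M).
Notation St := (St M).
Notation ctx := (ctx M).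
Notation and_ := Logic.and.
Notation or_ := Logic.or.
Notation ex_ := (@Logic.ex _).
Notation pair := (Sem.pair M).
Notation rat := (Sem.rat M).
Notation Rat := (Sem.Rat M).
Notation val := (Sem.val M and_ ex_).
Notation const := (Sem.const M).
Notation cls := (Sem.cls M).
Implicit Types (i j k m s t u v w y z : N) (q a h : frac M) (x : cls).

Variable T : St.
Hypothesis treeT : Sem.binary_tree M and_ ex_ T.

(** For [q >= 0] this says that the distance from [a] to [T_k] exceeds [q], without forming the
    minimum over the strings. *)
Definition far k a q : Prop :=
  forall s, inT M T k s -> a + q < lo s k \/ hi s k < a - q.

(* [Dn n a q] says that [q] is below the [n]-th approximation of the gauge at
   [a], that is, [max_(k <= n) min (2^-k) (dist (a, T_k) / 2)]. *)
Definition Dn n a q : Prop :=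
  q < 0 \/ exists k, k <n n + 1 /\ (q < eps k /\ far k a (2 * q)).

(** Strings of length [k] lie below [two k + two k], so the quantifier over them is bounded. *)
Lemma D1_far (n : nat) (fk : ctx n -> N) (fa fq : ctx n -> frac M) :
  F1 fk -> FQ fa -> FQ fq -> D1 (fun c => far (fk c) (fa c) (fq c)).
Proof.
move=> Hk Ha Hq.
apply: (D1_ext _ _ (fun c => forall s, s <n two (fk c) + two (fk c) ->
  nmem s T -> two (fk c) <=n s ->
  fa c + fq c < s%:q * eps (fk c) - 1 \/ (s%:q + 1) * eps (fk c) - 1 < fa c - fq c)).
  move=> c; split=> H s.
  - by move=> [sT /lenE[s1 s2]]; apply: H.
  - by move=> s1 sT s2; apply: H; split=> //; apply/lenE.
by d1.
Qed.

Lemma D1_Dn (n : nat) (fn : ctx n -> N) (fa fq : ctx n -> frac M) :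
  F1 fn -> FQ fa -> FQ fq -> D1 (fun c => Dn (fn c) (fa c) (fq c)).
Proof.
move=> Hn Ha Hq; rewrite /Dn; apply: D1_or; first by d1.
apply: (D1_bex _ _ (fun c => fn c + 1)
  (fun c k => fq c < eps k /\ far k (fa c) (2 * fq c))); first by f1.
by apply: D1_and; [d1|apply: D1_far; [f1|fq|fq]].
Qed.

Lemma far_lip k a a' q q' : a - a' <= q - q' -> a' - a <= q - q' -> far k a q -> far k a' q'.
Proof. by move=> H1 H2 H s /H[?|?]; [left|right]; lra. Qed.

(** Lipschitz continuity in terms of lower cuts: moving the point by [h] changes half the distance
    by at most [h / 2]. *)
Lemma Dn_lip n a a' h q : a - a' <= h -> a' - a <= h -> Dn n a q -> Dn n a' (q - h).
Proof.
move=> H1 H2; have [qh|qh] := ltP (q - h) 0; first by left.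
case=> [q0|[k [kn [qk Hk]]]]; first by exfalso; lra.
right; exists k; split=> //; split; first by lra.
by apply: far_lip Hk; lra.
Qed.

Lemma Dn_anti n a q q' : q' <= q -> Dn n a q -> Dn n a q'.
Proof.
move=> H; rewrite -[q'](subKr q).
by apply: Dn_lip; rewrite subrr subr_ge0.
Qed.

Lemma Dn_lt n a q q' : Dn n a q -> ~ Dn n a q' -> q < q'.
Proof. by move=> H H'; rewrite ltNge; apply/negP => /Dn_anti/(_ H). Qed.

(** Terms beyond [n] are at most [eps n], so lowering [q] by [eps n] removes their contribution. The
    modulus is uniform in the point. *)
Lemma Dn_cauchy n m a q : Dn m a q -> Dn n a (q - eps n).
Proof.
have e0 := eps_gt0 M n; case=> [q0|[k [km [qk Hk]]]]; first by left; lra.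
have [kn|nk] := pselect (k <n n + 1).
- by apply: (Dn_anti _ _ q); [lra|right; exists k].
- left; have : eps k <= eps n; last by lra.
  apply: eps_le; case: (nlt_total _ n k) => H; [by left|by right|].
  by case: nk; apply/nltS; left.
Qed.

(** The approximation is located on the grid of multiples of [eps n] by the least one outside the
    cut; it is at most 1, so [two n] bounds the search. *)
Lemma Dn_approx n a : exists j, Dn n a ((j%:q - 1) * eps n) /\ ~ Dn n a (j%:q * eps n).
Proof.
have [||j [nD min]] := D1_least _ (fun j => ~ Dn n a (j%:q * eps n)).
- by apply: D1_not; apply: D1_Dn; [f1|fq|fq].
- exists (two n); rewrite two_eps => -[|[k [_ [H _]]]]; first by rewrite ltr10.
  by have := eps_le1 M k; rewrite leNgt H.
exists j; split=> //; case: (n_case _ j) => [->|[i E]].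
- by left; rewrite nq0 sub0r mulN1r oppr_lt0 eps_gt0.
- rewrite E nqD nq1 addrK; apply: contrapT; apply: min.
  by rewrite E; apply: nlt_S.
Qed.

Lemma Dn_approx_uniq n a j j' :
  Dn n a ((j%:q - 1) * eps n) -> ~ Dn n a (j%:q * eps n) ->
  Dn n a ((j'%:q - 1) * eps n) -> ~ Dn n a (j'%:q * eps n) -> j = j'.
Proof.
move=> H1 H2 H3 H4.
have L i i' : Dn n a ((i%:q - 1) * eps n) -> ~ Dn n a (i'%:q * eps n) -> i <=n i'.
  move=> H H'; have := Dn_lt _ _ _ _ H H'; rewrite (ltr_pM2r (eps_gt0 M n)) => H''.
  by apply/nle_q; apply: q_lt_S; lra.
by apply: nle_anti; apply: L.
Qed.

(** The [n]-th approximation at [a] lies within [s - r - eps n] of [b]: [r] pays for moving inside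
    the ball, [eps n] for passing from the approximation to the gauge. *)
Definition G n (a r b s : frac M) : Prop :=
  Dn n a (b - s + r + eps n) /\ ~ Dn n a (b + s - r - eps n).

(** The index [n] of a quintuple records the stage at which the condition is checked. Membership is
    thereby Delta1, while the mapping relation quantifies over [n]. *)
Lemma Phi_ex : exists Phi : St,
  (forall n (a r b s : rat), pd a -> pd r -> pd b -> pd s ->
    (nmem (Sem.quintuple M n a r b s) Phi <->
     0 < qv r /\ G n (qv a) (qv r) (qv b) (qv s))) /\
  forall z, nmem z Phi -> exists n (a r b s : rat),
    [/\ pd a, pd r, pd b, pd s & z = Sem.quintuple M n a r b s].
Proof.
pose cs z := p2 z; pose cb z := p2 (p1 z); pose cr z := p2 (p1 (p1 z)).
pose ca z := p2 (p1 (p1 (p1 z))); pose cn z := p1 (p1 (p1 (p1 z))).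
pose ic z := z = pair (pair (p1 (p1 z)) (p2 (p1 z))) (p2 z) /\ 0 <n p2 z.
have [Phi HPhi] : exists Phi, forall z, nmem z Phi <->
    (z = pair (pair (pair (pair (cn z) (ca z)) (cr z)) (cb z)) (cs z) /\
    (ic (ca z) /\ (ic (cr z) /\ (ic (cb z) /\ ic (cs z))))) /\
    (0 < qc (cr z) /\ G (cn z) (qc (ca z)) (qc (cr z)) (qc (cb z)) (qc (cs z))).
  apply: D1_comprehension; apply: D1_and.
  - by rewrite /ic /cs /cb /cr /ca /cn /Sem.pair; d1.
  - apply: D1_and; first by rewrite /cr; d1.
    rewrite /G; apply: D1_and; [|apply: D1_not]; apply: D1_Dn;
      rewrite /cs /cb /cr /ca /cn; (f1 || fq).
exists Phi; split.
- move=> n a r b s Ha Hr Hb Hs; rewrite HPhi; set z := Sem.quintuple M n a r b s.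
  have -> : cs z = Sem.code M s by rewrite /cs p2E.
  have -> : cb z = Sem.code M b by rewrite /cb p1E p2E.
  have -> : cr z = Sem.code M r by rewrite /cr !p1E p2E.
  have -> : ca z = Sem.code M a by rewrite /ca !p1E p2E.
  have -> : cn z = n by rewrite /cn !p1E.
  rewrite !qc_code; split=> [[_ ?] //|?]; split=> //; split=> //.
  by split; [|split; [|split]]; apply: is_code_code.
- move=> z /HPhi[[E [Ia [Ir [Ib Is]]]] _].
  exists (cn z), (rat_of M (ca z)), (rat_of M (cr z)), (rat_of M (cb z)), (rat_of M (cs z)).
  split; try (by apply: pd_rat_of); rewrite /Sem.quintuple {1}E.
  have IE w : ic w -> Sem.code M (rat_of M w) = w by case=> /esym.
  by rewrite !IE.
Qed.

Variable Phi : St.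
Hypotheses
  (PhiE : forall n (a r b s : rat), pd a -> pd r -> pd b -> pd s ->
    (nmem (Sem.quintuple M n a r b s) Phi <->
     0 < qv r /\ G n (qv a) (qv r) (qv b) (qv s)))
  (Phi_form : forall z, nmem z Phi -> exists n (a r b s : rat),
    [/\ pd a, pd r, pd b, pd s & z = Sem.quintuple M n a r b s]).

Lemma mapsE (a r b s : rat) : pd a -> pd r -> pd b -> pd s ->
  (Sem.maps M ex_ Phi a r b s <->
   0 < qv r /\ exists n, G n (qv a) (qv r) (qv b) (qv s)).
Proof.
move=> Ha Hr Hb Hs; split=> [[n /PhiE[] //]|[r0 [n Hn]]].
- by split=> //; exists n.
- by exists n; apply/PhiE.
Qed.

Lemma G_pos n (a r b s : frac M) : 0 < r -> G n a r b s -> 0 < s.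
Proof.
by move=> r0 [H1 H2]; have := Dn_lt _ _ _ _ H1 H2; have := eps_gt0 M n; lra.
Qed.

Lemma G_consistent n n' (a r b s b' s' : frac M) :
  0 < r -> G n a r b s -> G n' a r b' s' -> b' - b <= s + s'.
Proof.
move=> r0 [_ H2] [H1 _]; have := eps_gt0 M n'.
by have := Dn_lt _ _ _ _ (Dn_cauchy n _ _ _ H1) H2; lra.
Qed.

Lemma continuous_code_Phi : Sem.continuous_code M and_ or_ ex_ Phi.
Proof.
split; [|split; [|split]].
- move=> z /[dup] Hz /Phi_form[n [a [r [b [s [Ha Hr Hb Hs E]]]]]].
  move: Hz; rewrite E PhiE // => -[r0 Hn]; exists n.
  apply/exQ_code; exists a; split=> //; apply/exQ_code; exists r; split=> //.
  apply/exQ_code; exists b; split=> //; apply/exQ_code; exists s; split=> //.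
  split=> //; rewrite !rlt_qv ?qv_rat0 //; try exact: pd_rat0.
  by split=> //; apply: G_pos Hn.
- apply/allQ_code => a Ha; apply/allQ_code => r Hr; apply/allQ_code => b Hb.
  apply/allQ_code => s Hs; apply/allQ_code => b' Hb'; apply/allQ_code => s' Hs'.
  rewrite !mapsE // rdist_le_qv ?qv_add //; last exact: pd_add.
  move=> [r0 [n Hn]] [_ [n' Hn']]; split.
  + by rewrite [qv s + _]addrC; apply: (G_consistent _ _ _ _ _ _ _ _ r0 Hn' Hn).
  + exact: (G_consistent _ _ _ _ _ _ _ _ r0 Hn Hn').
- apply/allQ_code => a Ha; apply/allQ_code => r Hr; apply/allQ_code => b Hb.
  apply/allQ_code => s Hs; apply/allQ_code => a' Ha'; apply/allQ_code => r' Hr'.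
  rewrite !mapsE // rlt_qv ?qv_rat0 //; last exact: pd_rat0.
  rewrite /Sem.subball rdist_lt_qv ?qv_sub //; last exact: pd_sub.
  move=> [r0 [n [H1 H2]]] r'0 [A1 A2]; split=> //; exists n; split.
  + apply: (Dn_anti _ _ (qv b - qv s + qv r + eps n - (qv r - qv r'))); first by lra.
    by apply: Dn_lip H1; lra.
  + move=> H; apply: H2; apply: (Dn_anti _ _ (qv b + qv s - qv r' - eps n - (qv r - qv r'))).
      by lra.
    by apply: Dn_lip H; lra.
- apply/allQ_code => a Ha; apply/allQ_code => r Hr; apply/allQ_code => b Hb.
  apply/allQ_code => s Hs; apply/allQ_code => b' Hb'; apply/allQ_code => s' Hs'.
  rewrite !mapsE // rlt_qv ?qv_rat0 //; last exact: pd_rat0.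
  rewrite /Sem.subball rdist_lt_qv ?qv_sub //; last exact: pd_sub.
  move=> [r0 [n [H1 H2]]] s'0 [A1 A2]; split=> //; exists n; split.
  + by apply: Dn_anti H1; lra.
  + by move=> H; apply: H2; apply: Dn_anti H; lra.
Qed.

Lemma edist_ltE x f (a r : rat) : code_seq M x f -> pd a -> pd r ->
  (Sem.edist_lt M and_ or_ ex_ (val x) (const a) (const r) <->
   (exists k, qv a - qv r + 2 * eps k < qc (f k)) /\
   (exists k, qc (f k) + 2 * eps k < qv a + qv r)).
Proof.
move=> Hf Ha Hr; rewrite /Sem.edist_lt.
have Rx := repr_val _ _ _ Hf; have Ra := repr_const _ _ Ha; have Rr := repr_const _ _ Hr.
by rewrite (eltE _ _ _ _ _ (repr_sub _ _ _ _ _ Ra Rr) Rx)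
  (eltE _ _ _ _ _ Rx (repr_add _ _ _ _ _ Ra Rr)).
Qed.

Lemma edist_leE x f (a r : rat) : code_seq M x f -> pd a -> pd r ->
  (Sem.edist_le M and_ or_ ex_ (val x) (const a) (const r) <->
   (forall k, qv a - qv r <= qc (f k) + 2 * eps k) /\
   (forall k, qc (f k) <= qv a + qv r + 2 * eps k)).
Proof.
move=> Hf Ha Hr; rewrite /Sem.edist_le.
have Rx := repr_val _ _ _ Hf; have Ra := repr_const _ _ Ha; have Rr := repr_const _ _ Hr.
by rewrite (eleE _ _ _ _ _ (repr_sub _ _ _ _ _ Ra Rr) Rx)
  (eleE _ _ _ _ _ Rx (repr_add _ _ _ _ _ Ra Rr)).
Qed.

Definition four : N := 1 + 1 + 1 + 1.

(** The radius [4 * eps n] exceeds the [2 * eps n] that strict comparison of reals demands; the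
    radius [8 * eps n] of the values leaves room for it, for the [eps n] in [G] and for one grid
    step. *)
Lemma approx_maps x f n j : code_seq M x f ->
  Dn n (qc (f n)) ((j%:q - 1) * eps n) -> ~ Dn n (qc (f n)) (j%:q * eps n) ->
  let a := rat_of M (f n) in let r := Rat four 0 (two n) in
  let b := Rat j 0 (two n) in let s := Rat (four + four) 0 (two n) in
  [/\ pd a, pd r, pd b, pd s &
    [/\ Sem.maps M ex_ Phi a r b s,
        Sem.edist_lt M and_ or_ ex_ (val x) (const a) (const r),
        qv b = j%:q * eps n & qv s = 8 * eps n]].
Proof.
move=> Hf H1 H2 a r b s; have [_ Hc _] := Hf.
have Ha : pd a by apply: pd_rat_of.
have Hr : pd r by apply: pd_two.
have Hb : pd b by apply: pd_two.
have Hs : pd s by apply: pd_two.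
have Er : qv r = 4 * eps n by rewrite /qv /= nq0 subr0 /four !nqD nq1; congr (_ * _); lra.
have Es : qv s = 8 * eps n by rewrite /qv /= nq0 subr0 /four !nqD nq1; congr (_ * _); lra.
have Eb : qv b = j%:q * eps n by rewrite /qv /= nq0 subr0.
have e0 := eps_gt0 M n; split=> //; split=> //.
- apply/mapsE => //; rewrite Er; split; first by lra.
  exists n; rewrite Es Eb; split.
  + by apply: Dn_anti H1; lra.
  + by move=> H; apply: H2; apply: Dn_anti H; lra.
- apply/(edist_ltE _ f) => //; rewrite Er; split; exists n; rewrite /a -/(qc (f n)); lra.
Qed.

Lemma in_domain_Phi x f : code_seq M x f -> Sem.in_domain M and_ or_ ex_ Phi x.
Proof.
move=> Hf; apply/allQ_code => e He; rewrite rlt_qv ?qv_rat0 //; last exact: pd_rat0.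
move=> e0; have [|n Hn] := eps_small M (qv e / 8); first by lra.
have [j [H1 H2]] := Dn_approx n (qc (f n)).
have [Ha Hr Hb Hs [Hm Hd _ Es]] := approx_maps _ _ _ _ Hf H1 H2.
apply/exQ_code; eexists; split; first exact: Ha; apply/exQ_code; eexists; split; first exact: Hr.
apply/exQ_code; eexists; split; first exact: Hb; apply/exQ_code; eexists; split; first exact: Hs.
by split=> //; split=> //; rewrite rlt_qv // Es; lra.
Qed.

Lemma graph_set (g : N -> N) : (forall (n : nat) (h : ctx n -> N), F1 h -> F1 (fun c => g (h c))) ->
  exists Y, forall z, nmem z Y <-> exists k, z = pair k (g k).
Proof.
move=> Hg; have [|Y HY] := D1_comprehension M (fun z => z = pair (p1 z) (g (p1 z))).
  by rewrite /Sem.pair; d1.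
exists Y => z; rewrite HY; split=> [E|[k ->]]; last by rewrite p1E.
by exists (p1 z).
Qed.

Lemma eps_plus2 k : eps k = 4 * eps (k + (1 + 1)).
Proof. by rewrite epsS [eps (k + 1)]epsS -addrA; lra. Qed.

(** Reading argument and gauge at index [k + 2] costs three errors of at most [eps (k + 2)], from
    the argument, the stage and the grid; together they stay below [eps k], which is
    [4 * eps (k + 2)]. *)
Lemma value_ex x f : D1 (fun c : ctx 1 => x c.2) -> code_seq M x f ->
  exists Y g, [/\ code_seq M (Sem.mem M Y) g, Sem.value M and_ or_ ex_ Phi x (Sem.mem M Y) &
    forall k, let n := k + (1 + 1) in
      Dn n (qc (f n)) (qc (g k) - eps n) /\ ~ Dn n (qc (f n)) (qc (g k))].
Proof.
move=> Dx Hf; have Ff := F1_code_seq _ _ _ Dx Hf.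
have [_ Hcf Cf] := Hf.
pose R k j := let n := k + (1 + 1) in
  Dn n (qc (f n)) ((j%:q - 1) * eps n) /\ ~ Dn n (qc (f n)) (j%:q * eps n).
have [jj' Hjj HR] : exists2 jj : ctx 1 -> N, F1 jj & forall c, R c.2 (jj c).
  apply: (F1_unique M 1 (fun (c : ctx 1) j => R c.2 j)).
  - rewrite /R; apply: D1_Sig; apply: D1_and; [|apply: D1_not]; apply: D1_Dn; (f1 || fq).
  - by move=> c; apply: Dn_approx.
  - by move=> c j j' [? ?] [? ?]; apply: Dn_approx_uniq; eassumption.
pose jj k := jj' (tt, k); have {}HR k : R k (jj k) := HR (tt, k).
have {}Hjj (n : nat) (h : ctx n -> N) : F1 h -> F1 (fun c => jj (h c)).
  by move=> Hh; apply: (F1_lift1 _ _ h jj Hh); apply: Sig_ext Hjj => -[[[] u] v].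
pose g k := Sem.code M (Rat (jj k) 0 (two (k + (1 + 1)))).
have [|Y HY] := graph_set g.
  by move=> n h Hh; rewrite /g /Sem.code /Sem.pair /=; f1.
have Eg k : qc (g k) = (jj k)%:q * eps (k + (1 + 1)) by rewrite qc_code /qv /= nq0 subr0.
have Hg k : let n := k + (1 + 1) in
    Dn n (qc (f n)) (qc (g k) - eps n) /\ ~ Dn n (qc (f n)) (qc (g k)).
  have [H1 H2] := HR k; rewrite /= Eg; split=> //.
  by move: H1; congr (Dn _ _ _); ring.
have Sg : code_seq M (Sem.mem M Y) g.
  split=> [//|k|k i]; first by apply: is_code_code; apply: pd_two.
  have [H1 H2] := Hg k; have [H1' H2'] := Hg (k + i).
  have e0 := eps_gt0 M (k + (1 + 1)); have e4 := eps_plus2 k.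
  have E : k + i + (1 + 1) = k + (1 + 1) + i by ring.
  rewrite E in H1' H2'; have [C1 C2] := Cf (k + (1 + 1)) i.
  have ee : eps (k + (1 + 1) + i) <= eps (k + (1 + 1)).
    by apply: eps_le; apply/nleE; exists i.
  have L1 := Dn_lt _ _ _ _ (Dn_cauchy (k + (1 + 1) + i) _ _ _ (Dn_lip _ _ _ _ _ C1 C2 H1)) H2'.
  have L2 := Dn_lt _ _ _ _ (Dn_cauchy (k + (1 + 1)) _ _ _ (Dn_lip _ _ _ _ _ C2 C1 H1')) H2.
  by split; lra.
exists Y, g; split=> //; split; first by apply/realP; exists g.
split; first exact: in_domain_Phi Hf.
apply/allQ_code => a Ha; apply/allQ_code => r Hr; apply/allQ_code => b Hb.
apply/allQ_code => s Hs; rewrite mapsE // => -[r0 [n [G1 G2]]].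
rewrite (edist_ltE _ f) // (edist_leE _ g) // => -[[k1 K1] [k2 K2]].
(* Membership in the open ball is witnessed at [k1] and [k2]; the Cauchy condition transfers it to
   each term at the cost of [eps m]. *)
have near m : qc (f m) - qv a <= qv r + eps m /\ qv a - qc (f m) <= qv r + eps m.
  have e1 := eps_gt0 M k1; have e2 := eps_gt0 M k2.
  have := cauchy_lt _ _ k1 m Cf; have := cauchy_lt _ _ m k2 Cf; split; lra.
split=> k; have [H1 H2] := Hg k; have [N1 N2] := near (k + (1 + 1)).
- have e0 := eps_gt0 M (k + (1 + 1)); have e4 := eps_plus2 k; have en := eps_gt0 M n.
  by have := Dn_lt _ _ _ _ (Dn_cauchy (k + (1 + 1)) _ _ _ (Dn_lip _ _ _ _ _ N2 N1 G1)) H2; lra.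
- have e0 := eps_gt0 M (k + (1 + 1)); have e4 := eps_plus2 k.
  by have := Dn_lt _ _ _ _ (Dn_cauchy n _ _ _ (Dn_lip _ _ _ _ _ N1 N2 H1)) G2; lra.
Qed.

Hypothesis no_path : ~ exists F, Sem.path M and_ or_ ex_ F T.

Lemma continuous_gauge_Phi : Sem.continuous_gauge M and_ or_ ex_ ex_ Phi.
Proof.
split; first exact: continuous_code_Phi.
move=> X [/realP[f Hf] [X0 X1]].
have DX : D1 (fun c : ctx 1 => Sem.mem M X c.2) by rewrite /Sem.mem; d1.
have [Y [g [Hg HY Hgf]]] := value_ex _ _ DX Hf.
have Ff := F1_code_seq _ _ _ DX Hf.
have Rf := repr_val _ _ _ Hf; have Rg := repr_val _ _ _ Hg.
exists Y; split=> //; split; first by apply/realP; exists g.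
rewrite (eltE _ _ _ _ _ (repr_const _ _ (pd_rat0 M)) Rg) qv_rat0.
apply: contrapT => H; apply: no_path.
apply: (path_of_near M T (fun k => qc (f k)) treeT).
- by fq.
- by case: Hf.
- move: X0; rewrite (eleE _ _ _ _ _ (repr_const _ _ (pd_rat0 M)) Rf) qv_rat0 => X0 k.
  by have := X0 k; lra.
- by move: X1; rewrite (eleE _ _ _ _ _ Rf (repr_const _ _ (pd_rat1 M))) qv_rat1.
- move=> k n /nleE[i En].
  (* The term of the value at index [l] is computed from stage [n = l + 2]. *)
  pose l := k + (1 + 1) + i; have El : n = l + (1 + 1) by rewrite En /l; ring.
  have [_] := Hgf l; rewrite -El => nD.
  have en := eps_gt0 M n.
  (* A value that is not positive has its [l]-th term at most [2 * eps l], that is, [8 * eps n]. *)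
  have gl : qc (g l) <= 8 * eps n.
    rewrite leNgt; apply/negP => H'; apply: H; exists l; rewrite add0r.
    by rewrite eps_plus2 -El; lra.
  have g0 : 0 <= qc (g l) by rewrite leNgt; apply/negP => H'; apply: nD; left.
  have ek : 16 * eps n <= eps k.
    have := eps_plus2 k; have := eps_plus2 (k + (1 + 1)).
    have : eps n <= eps (k + (1 + 1) + (1 + 1)); last by lra.
    by apply: eps_le; apply/nleE; exists i; rewrite En; ring.
  (* As [g l] is below [eps k], the failure of [Dn] at level [k] can only come from the distance to
     [T_k]. *)
  have nfar : ~ far k (qc (f n)) (2 * qc (g l)).
    move=> Hfar; apply: nD; right; exists k; split; last by split=> //; lra.
    by rewrite En; apply/nltE; exists (1 + 1 + 1 + 1 + i); ring.
  have /existsNP[s /not_implyP[Hs /not_orP[/negP L1 /negP L2]]] := nfar.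
  by exists s; split=> //; rewrite -!leNgt in L1 L2; apply/andP; split; lra.
Qed.

End Gauge.

(** * A fine cover misses a level of the tree *)

Section Cover.

Variable M : rca0.
Notation N := (N M).
Notation St := (St M).
Notation ctx := (ctx M).
Notation and_ := Logic.and.
Notation or_ := Logic.or.
Notation ex_ := (@Logic.ex _).
Notation pair := (Sem.pair M).
Notation rat := (Sem.rat M).
Notation Rat := (Sem.Rat M).
Notation val := (Sem.val M and_ ex_).
Notation sect := (Sem.sect M).
Notation mem := (Sem.mem M).
Implicit Types (i j k m s t u v w y z : N) (T P R X Y : St).

(** The argument for Delta0 relations, repeated with a Sigma1 relation; it bounds the levels
    belonging to the points of a cover. *)
Lemma Sig_collection (Q : N -> N -> Prop) : Sig (fun c : ctx 2 => Q c.1.2 c.2) ->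
  forall b : N, (forall x : N, x <n b -> exists y, Q x y) ->
  exists w, forall x : N, x <n b -> exists y, y <n w /\ Q x y.
Proof.
move=> HQ b Hb.
suff : forall l, b <n l \/ exists w, forall x : N, x <n l -> exists y, y <n w /\ Q x y.
  by move=> /(_ b)[/nlt_irr|].
apply: Sigind.
- apply: Sig_or; first by sig.
  apply: (Sig_ex _ _ (fun (c : ctx 1) w =>
    forall x : N, x <n c.2 -> exists y, y <n w /\ Q x y)).
  apply: (Sig_fball _ _ (fun c : ctx 2 => c.1.2)
    (fun (c : ctx 2) x => exists y, y <n c.2 /\ Q x y)); first by f1.
  apply: (Sig_ex _ _ (fun (c : ctx 3) y => y <n c.1.2 /\ Q c.2 y)).
  apply: Sig_and; first by sig.
  by apply: (Sig_lift2 _ _ (fun c : ctx 4 => c.1.2) (fun c => c.2)); [f1|f1|].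
- by right; exists 0 => x /nlt0.
- move=> l [bl|[w Hw]]; first by left; apply: nlt_trans bl _; apply: nlt_S.
  have [lb|lb] := pselect (l <n b); last first.
    by left; case: (nlt_total _ b l) => // H; apply/nltS; [left|right].
  have [y Hy] := Hb l lb; right; exists (w + y + 1) => x /nltS[/Hw[y' [yw Hy']]|->].
  + by exists y'; split=> //; apply: nlt_trans yw _; apply/nltE; exists y; ring.
  + by exists y; split=> //; apply/nltE; exists w; ring.
Qed.

Lemma lo_prefix k i s t v : v <n two i -> t = s * two i + v ->
  lo s k <= lo t (k + i) <= hi s k.
Proof.
move=> /nlt_q vi ->; rewrite /lo /hi nqD mulrDl scale_eps.
have := scale_eps M 1 k i; rewrite mul1r nq1 mul1r => E.
have := eps_gt0 M (k + i); have := nq_ge0 _ v; set e := eps (k + i) in E * => v0 e0.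
have H1 : 0 <= v%:q * e by apply: mulr_ge0 => //; apply: ltW.
have H2 : v%:q * e <= eps k by rewrite -E ler_pM2r // ltW.
by apply/andP; split; lra.
Qed.

Lemma code_seq_const (r : rat) : pd r ->
  exists X, code_seq M (mem X) (fun _ => Sem.code M r).
Proof.
move=> Hr; have [|X HX] := graph_set M (fun _ => Sem.code M r).
  by move=> n h _; apply: F1_const.
exists X; split=> [//|k|k i]; first exact: is_code_code.
by rewrite subrr ltW // eps_gt0.
Qed.

Variables (T Phi : St).
Hypotheses (treeT : Sem.binary_tree M and_ ex_ T)
  (infT : Sem.infinite M and_ ex_ T)
  (PhiE : forall n (a r b s : rat), pd a -> pd r -> pd b -> pd s ->
    (nmem (Sem.quintuple M n a r b s) Phi <->
     0 < qv r /\ G M T n (qv a) (qv r) (qv b) (qv s))).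

(** The gauge is half a distance, so a radius below it leaves a distance of nearly twice the radius;
    the surplus pays for the approximations. The conclusion concerns rational terms only, which
    makes it Sigma1, and [4 * eps m] covers the errors of [f m] and [fr m]. *)
Lemma far_of_value x f (xr : Sem.cls M) fr Y :
  code_seq M x f -> code_seq M xr fr ->
  Sem.elt M and_ or_ ex_ (Sem.const M (Sem.rat0 M)) (val xr) ->
  Sem.value M and_ or_ ex_ Phi x (mem Y) -> Sem.ele M and_ or_ ex_ (val xr) (val (mem Y)) ->
  exists k m, far M T k (qc (f m)) (qc (fr m) + 4 * eps m).
Proof.
move=> Hf Hfr r0 [/realP[g Hg] [_ HY]] rY.
have Rr := repr_val _ _ _ Hfr; have Rg := repr_val _ _ _ Hg.
move: r0; rewrite (eltE _ _ _ _ _ (repr_const _ _ (pd_rat0 M)) Rr) qv_rat0 => -[k0 Hk0].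
move: rY; rewrite (eleE _ _ _ _ _ Rr Rg) => rY.
have e0 := eps_gt0 M k0.
(* With [e = eps n], positivity gives [fr n > eps k0 - e > 30 e], and the bounds on the value give
   [j e >= fr n - 12 e]; hence [2 (j - 1) e >= fr n + 4 e]. *)
have [|n Hn] := eps_small M (eps k0 / 31); first by lra.
have en := eps_gt0 M n.
have [j [H1 H2]] := Dn_approx M T n (qc (f n)).
have [Ha Hr Hb Hs [Hm Hd Eb Es]] := approx_maps M T Phi PhiE _ _ _ _ Hf H1 H2.
move/allQ_code: HY => /(_ _ Ha)/allQ_code/(_ _ Hr)/allQ_code/(_ _ Hb)/allQ_code/(_ _ Hs)/(_ Hm Hd).
rewrite (edist_leE _ _ g) // Eb Es => -[_ /(_ n) Hgn].
have Hrn := rY n; have [_ _ Cfr] := Hfr; have Crn := cauchy_lt _ _ k0 n Cfr.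
case: H1 => [|[k [_ [_ Hk]]]]; first by lra.
by exists k, n; apply: far_lip Hk; lra.
Qed.

Lemma no_fine_cover P R n : ~ Sem.fine_cover M and_ or_ ex_ ex_ Phi P R n.
Proof.
move=> [cov1 [_ cov2]].
(* The terms of centre and radius are quantified as members of [P] and [R], so that [Q] is Sigma1
   and collection applies. *)
pose Q i k := exists m u v, (nmem (pair i (pair m u)) P /\ nmem (pair i (pair m v)) R) /\
  far M T k (qc u) (qc v + 4 * eps m).
have [||K HK] := Sig_collection Q _ n.
- rewrite /Q; apply: (Sig_ex _ _ (fun (c : ctx 2) m => exists u v,
    (nmem (pair c.1.2 (pair m u)) P /\ nmem (pair c.1.2 (pair m v)) R) /\
    far M T c.2 (qc u) (qc v + 4 * eps m))).
  apply: (Sig_ex _ _ (fun (c : ctx 3) u => exists v,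
    (nmem (pair c.1.1.2 (pair c.2 u)) P /\ nmem (pair c.1.1.2 (pair c.2 v)) R) /\
    far M T c.1.2 (qc u) (qc v + 4 * eps c.2))).
  apply: (Sig_ex _ _ (fun (c : ctx 4) v =>
    (nmem (pair c.1.1.1.2 (pair c.1.2 c.2)) P /\ nmem (pair c.1.1.1.2 (pair c.1.2 v)) R) /\
    far M T c.1.1.2 (qc c.2) (qc v + 4 * eps c.1.2))).
  apply: D1_Sig; apply: D1_and; first by rewrite /Sem.pair; d1.
  by apply: D1_far; [f1|fq|fq].
- move=> i /cov1[[/realP[f Hf] _] [[/realP[fr Hfr] r0] [Y [HY rY]]]].
  have [k [m H]] := far_of_value _ _ _ _ _ Hf Hfr r0 HY rY.
  exists k, m, (f m), (fr m); split=> //; split.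
  + by apply/(code_seq_mem _ _ _ _ _ Hf).
  + by apply/(code_seq_mem _ _ _ _ _ Hfr).
(* The uncovered point is the left endpoint of the interval of a string in [T] of length [K]. Each
   point of the cover has a level [k] below [K], and the interval of the prefix of length [k] still
   contains the endpoint. *)
have [s Hs] := inT_nonempty M T K treeT infT.
have Hr : pd (Rat s (two K) (two K)) by apply: pd_two.
have [X HX] := code_seq_const _ Hr.
have Ex : qv (Rat s (two K) (two K)) = lo s K.
  by rewrite /qv /= mulrBl [X in _ - X]two_eps.
have RX := repr_val _ _ _ HX.
have [x0 x1] : 0 <= lo s K /\ lo s K <= 1.
  have [_ /lenE[/nle_q s1 /nlt_q s2]] := Hs; rewrite nqD in s2.
  have := two_eps M K; have eK := eps_gt0 M K; rewrite /lo => E.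
  split.
  - by rewrite subr_ge0 -E ler_pM2r.
  - by rewrite lerBlDr -{1}E -{1}E -mulrDl ler_pM2r // ltW.
have [|i [ni [D1 D2]]] := cov2 X.
  split; first by apply/realP; eexists; exact: HX.
  split.
  - rewrite (eleE _ _ _ _ _ (repr_const _ _ (pd_rat0 M)) RX) qc_code qv_rat0 Ex => k.
    by have := eps_gt0 M k; lra.
  - rewrite (eleE _ _ _ _ _ RX (repr_const _ _ (pd_rat1 M))) qc_code qv_rat1 Ex => k.
    by have := eps_gt0 M k; lra.
have [[/realP[f Hf] _] [[/realP[fr Hfr] _] _]] := cov1 i ni.
have Rf := repr_val _ _ _ Hf; have Rfr := repr_val _ _ _ Hfr.
move: D1 D2; rewrite (eltE _ _ _ _ _ (repr_sub _ _ _ _ _ Rf Rfr) RX).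
rewrite (eltE _ _ _ _ _ RX (repr_add _ _ _ _ _ Rf Rfr)) qc_code Ex => -[k1 D1] [k2 D2].
have [k [kK [m [u [v [[Hu Hv] Hfar]]]]]] := HK i ni.
have Eu : u = f m by apply/(code_seq_mem _ _ _ _ _ Hf).
have Ev : v = fr m by apply/(code_seq_mem _ _ _ _ _ Hfr).
have [Cf Cr] : cauchy (fun k => qc (f k)) /\ cauchy (fun k => qc (fr k)).
  by case: Hf => _ _ ?; case: Hfr.
have /nleE[l El] : k <=n K by left.
have [s' [w [wl Es]]] := n_div_two M s l.
have Hs' : inT M T k s' by apply: (inT_prefix M T k l s s' w) => //; rewrite -El.
have /andP[L1 L2] := lo_prefix k l s' s w wl Es.
rewrite -El in L1 L2; have em := eps_gt0 M m.
(* The strict comparisons leave [2 * eps k1 = 4 * eps (k1 + 1)], more than the errors of centre and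
   radius at index [k1 + 1], and likewise for [k2]; those at index [m] are paid by [4 * eps m]. *)
have E1 := epsS M k1; have E2 := epsS M k2.
have e1 := eps_gt0 M (k1 + 1); have e2 := eps_gt0 M (k2 + 1).
have := cauchy_lt _ _ m (k1 + 1) Cf; have := cauchy_lt _ _ (k2 + 1) m Cf.
have := cauchy_lt _ _ (k1 + 1) m Cr; have := cauchy_lt _ _ (k2 + 1) m Cr.
by case: (Hfar s' Hs'); rewrite Eu Ev; lra.
Qed.

End Cover.

(** * From Cousin's lemma to weak König's lemma, in every model and hence provably *)

Lemma Cousin_WKL (M : rca0) :
  Sem.Cousin M Logic.and Logic.or (@Logic.ex _) (@Logic.ex _) ->
  Sem.WKL M Logic.and Logic.or (@Logic.ex _) (@Logic.ex _).
Proof.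
move=> cousin T treeT infT; apply: contrapT => no_path.
have [Phi [PhiE Phi_form]] := Phi_ex M T.
have [P [R [n]]] := cousin Phi (continuous_gauge_Phi M T treeT Phi PhiE Phi_form no_path).
exact: (no_fine_cover M T Phi treeT infT PhiE).
Qed.

Theorem theorem4p2 : proves RCA0 (Imp Cousin WKL).
Proof.
apply: completeness => M HM r w; pose M' := Rca0 M (w 0%N) HM.
change (sat M' r w Cousin -> sat M' r w WKL).
rewrite sat_Cousin sat_WKL; exact: Cousin_WKL.
Qed.
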